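(* Let $\mathcal P_t=e^{t\mathcal L}$ be a primitive quantum Markov semigroup satisfying the $\sigma$-GNS detailed balance condition for its full-rank invariant state $\sigma$, and let $p\in(1,2]$. If the Ricci curvature bound $\mathrm{Ric}_p(\mathcal L)\ge\kappa$ holds for some $\kappa>0$, then the quantum $p$-Beckner inequality $$\alpha_p\,\mathcal F_{p,\sigma}(\rho)\le p^{-2}\,\mathcal E_{p,\mathcal L}(\Gamma_\sigma^{-1}(\rho))\qquad\text{for all }\rho\in\mathcal D_+(\mathcal H)$$ holds with a constant $\alpha_p\ge\kappa/2$.
   Context: $\mathcal H$ is a Hilbert space of finite dimension $d$; $\mathcal D_+(\mathcal H)$ is the set of full-rank density operators; $\dagger$ is the adjoint for $\langle X,Y\rangle=\mathrm{Tr}(X^*Y)$. A quantum Markov semigroup is a $C_0$-semigroup of completely positive unital maps on $\mathcal B(\mathcal H)$ with generator $\mathcal L$; primitive means there is a unique invariant state $\sigma$ ($\mathcal P_t^\dagger(\sigma)=\sigma$) and it is full rank; $\sigma$-GNS detailed balance means $\mathcal L$ is self-adjoint for $\mathrm{Tr}(\sigma X^*Y)$. By Alicki's theorem one can write (and a choice is fixed) $$\mathcal L(X)=\sum_{j=1}^J\big(e^{-\omega_j/2}V_j^*[X,V_j]+e^{\omega_j/2}[V_j,X]V_j^*\big),$$ with $\omega_j\in\mathbb R$, $\sigma V_j\sigma^{-1}=e^{-\omega_j}V_j$, $\mathrm{Tr}(V_j)=0$, $\langle V_j,V_k\rangle=c_j\delta_{jk}$, $c_j>0$, and for each $j$ an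 index $j'$ with $V_j^*=V_{j'}$, $\omega_{j'}=-\omega_j$. Let $\partial_jX=[V_j,X]$, so $\partial_j^\dagger Y=[V_j^*,Y]$. Let $\Gamma_\sigma^s(X)=\sigma^{s/2}X\sigma^{s/2}$, $\hat p=p/(p-1)$, $\|X\|_{p,\sigma}=\mathrm{Tr}(|\Gamma_\sigma^{1/p}(X)|^p)^{1/p}$, $\mathcal F_{p,\sigma}(\rho)=\frac1{p(p-1)}\big(\|\Gamma_\sigma^{-1}(\rho)\|_{p,\sigma}^p-1\big)$, and for $X\ge0$ $$\mathcal E_{p,\mathcal L}(X)=-\frac{\hat p\,p}{4}\Big\langle \Gamma_\sigma^{-1/\hat p}\big((\Gamma_\sigma^{1/p}(X))^{p-1}\big),\mathcal L(X)\Big\rangle_{\sigma,1/2},\quad \langle X,Y\rangle_{\sigma,1/2}=\mathrm{Tr}(\sigma^{1/2}X^*\sigma^{1/2}Y).$$ For $x,y>0$ let $\theta_p(x,y)=(p-1)\frac{x-y}{x^{p-1}-y^{p-1}}$ if $x\ne y$ and $\theta_p(x,x)=x^{2-p}$. For self-adjoint $A=\sum_i\lambda_iA_i$, $B=\sum_k\mu_kB_k$ (spectral decompositions), $f(A,B)(X)=\sum_{i,k}f(\lambda_i,\mu_k)A_iXB_k$. For $\rho\in\mathcal D_+(\mathcal H)$, $\omega\in\mathbb R$, $$[\rho]_{p,\omega}=\Gamma_\sigma^{1/\hat p}\circ\theta_p\big(e^{\omega/2p}\Gamma_\sigma^{-1/\hat p}(\rho),\,e^{-\omega/2p}\Gamma_\sigma^{-1/\hat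 p}(\rho)\big)\circ\Gamma_\sigma^{1/\hat p},\qquad \mathfrak D_{p,\rho}(A)=\sum_{j=1}^J\partial_j^\dagger\big([\rho]_{p,\omega_j}\partial_jA\big).$$ On $T_\rho=\mathcal B^0_{sa}(\mathcal H)$ (traceless self-adjoint operators), the tangent space of $\mathcal D_+(\mathcal H)$ at $\rho$, $\mathfrak D_{p,\rho}$ is positive definite and $g_{p,\rho}(\nu_1,\nu_2)=\langle\mathfrak D_{p,\rho}^{-1}(\nu_1),\nu_2\rangle$ is a Riemannian metric. $\mathrm{Ric}_p(\mathcal L)\ge\kappa$ means: for every $\rho\in\mathcal D_+(\mathcal H)$ and every constant-speed geodesic $\gamma:(-\varepsilon,\varepsilon)\to\mathcal D_+(\mathcal H)$ of the Riemannian manifold $(\mathcal D_+(\mathcal H),g_{p,\rho})$ with $\gamma(0)=\rho$, one has $\frac{d^2}{ds^2}\big|_{s=0}\mathcal F_{p,\sigma}(\gamma(s))\ge\kappa\,g_{p,\gamma(0)}(\dot\gamma(0),\dot\gamma(0))$. *)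

(* Defs.v *)
From HB Require Import structures.
From mathcomp Require Import all_boot all_order all_algebra.
From mathcomp Require Import all_classical all_reals all_analysis.
From mathcomp Require Import complex.

Set Implicit Arguments.
Unset Strict Implicit.
Unset Printing Implicit Defensive.

Import Order.TTheory GRing.Theory Num.Theory.
Import numFieldTopology.Exports numFieldNormedType.Exports.

Local Open Scope classical_set_scope.
Local Open Scope ring_scope.
Local Open Scope complex_scope.
Local Open Scope sesquilinear_scope.

(* The Hilbert space is C^d with C = R[i], and B(H) is 'M[R[i]]_d.            *)

Definition hs (R : realType) (d : nat) (X Y : 'M[R[i]]_d) : R[i] :=
  \tr (X^t* *m Y).

(* Entrywise form of the adjoint for [hs]; see [hs_adj] below. *)
Definition adj (R : realType) (d : nat) (Phi : 'M[R[i]]_d -> 'M[R[i]]_d)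
    (Y : 'M[R[i]]_d) : 'M[R[i]]_d :=
  \matrix_(a, b) hs (Phi (delta_mx a b)) Y.

Definition comm (R : realType) (d : nat) (X Y : 'M[R[i]]_d) : 'M[R[i]]_d :=
  X *m Y - Y *m X.

Definition psd (R : realType) (d : nat) (A : 'M[R[i]]_d) : Prop :=
  A \is hermsymmx /\ forall v : 'rV[R[i]]_d, 0 <= (v *m A *m v^t*) 0 0.

Definition density (R : realType) (d : nat) (rho : 'M[R[i]]_d) : Prop :=
  psd rho /\ \tr rho = 1.

Definition full_density (R : realType) (d : nat) (rho : 'M[R[i]]_d) : Prop :=
  density rho /\ \rank rho = d.

Definition traceless_sa (R : realType) (d : nat) (A : 'M[R[i]]_d) : Prop :=
  A \is hermsymmx /\ \tr A = 0.

(* For self-adjoint A, A = \sum_i eigval A i *: eigproj A i, where the        *)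
(* eigenvalues are repeated with multiplicity and the projections have rank   *)
(* one; see [spectral_decomposition] below.                                   *)
Definition eigval (R : realType) (d : nat) (A : 'M[R[i]]_d) (i : 'I_d) : R :=
  complex.Re (spectral_diag A 0 i).

Definition eigproj (R : realType) (d : nat) (A : 'M[R[i]]_d) (i : 'I_d) :
    'M[R[i]]_d :=
  (row i (spectralmx A))^t* *m row i (spectralmx A).

Definition mxfun (R : realType) (d : nat) (f : R -> R) (A : 'M[R[i]]_d) :
    'M[R[i]]_d :=
  \sum_i (f (eigval A i))%:C *: eigproj A i.

Definition mxfun2 (R : realType) (d : nat) (f : R -> R -> R)
    (A B X : 'M[R[i]]_d) : 'M[R[i]]_d :=
  \sum_i \sum_k (f (eigval A i) (eigval B k))%:C
    *: (eigproj A i *m X *m eigproj B k).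

Definition mxpow (R : realType) (d : nat) (A : 'M[R[i]]_d) (s : R) :
    'M[R[i]]_d :=
  mxfun (fun x => x `^ s) A.

Definition mxabs (R : realType) (d : nat) (X : 'M[R[i]]_d) : 'M[R[i]]_d :=
  mxfun Num.sqrt (X^t* *m X).

Definition completely_positive (R : realType) (d : nat)
    (Phi : 'M[R[i]]_d -> 'M[R[i]]_d) : Prop :=
  forall (n : nat) (X : 'I_n -> 'I_n -> 'M[R[i]]_d),
    psd (\mxblock_(i < n, j < n) X i j) ->
    psd (\mxblock_(i < n, j < n) Phi (X i j)).

Definition mx_cvg (R : realType) (d : nat) (F : set_system R)
    (f : R -> 'M[R[i]]_d) (A : 'M[R[i]]_d) : Prop :=
  forall i j,
    complex.Re (f t i j) @[t --> F] --> complex.Re (A i j) /\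
    complex.Im (f t i j) @[t --> F] --> complex.Im (A i j).

Definition quantum_markov_semigroup (R : realType) (d : nat)
    (P : R -> {linear 'M[R[i]]_d -> 'M[R[i]]_d}) : Prop :=
  [/\ forall X, P 0 X = X,
      forall s t X, 0 <= s -> 0 <= t -> P (s + t) X = P s (P t X),
      forall X, mx_cvg (0 : R)^'+ (fun t => P t X) X &
      forall t, 0 <= t -> completely_positive (P t) /\ P t 1%:M = 1%:M].

Definition is_generator (R : realType) (d : nat)
    (P : R -> {linear 'M[R[i]]_d -> 'M[R[i]]_d})
    (L : 'M[R[i]]_d -> 'M[R[i]]_d) : Prop :=
  forall X, mx_cvg (0 : R)^'+ (fun t => (t^-1)%:C *: (P t X - X)) (L X).

Definition invariant_state (R : realType) (d : nat)
    (P : R -> {linear 'M[R[i]]_d -> 'M[R[i]]_d}) (rho : 'M[R[i]]_d) : Prop :=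
  density rho /\ forall t, 0 <= t -> adj (P t) rho = rho.

Definition primitive (R : realType) (d : nat)
    (P : R -> {linear 'M[R[i]]_d -> 'M[R[i]]_d}) (sigma : 'M[R[i]]_d) : Prop :=
  [/\ invariant_state P sigma,
      forall rho, invariant_state P rho -> rho = sigma &
      full_density sigma].

Definition gns_detailed_balance (R : realType) (d : nat)
    (sigma : 'M[R[i]]_d) (L : 'M[R[i]]_d -> 'M[R[i]]_d) : Prop :=
  forall X Y, \tr (sigma *m (L X)^t* *m Y) = \tr (sigma *m X^t* *m L Y).

Definition alicki_form (R : realType) (d J : nat) (sigma : 'M[R[i]]_d)
    (L : 'M[R[i]]_d -> 'M[R[i]]_d)
    (omega : 'I_J -> R) (V : 'I_J -> 'M[R[i]]_d) : Prop :=
  [/\ forall X, L X = \sum_j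
        ((expR (- (omega j / 2)))%:C *: ((V j)^t* *m comm X (V j))
         + (expR (omega j / 2))%:C *: (comm (V j) X *m (V j)^t*)),
      forall j, sigma *m V j *m invmx sigma = (expR (- omega j))%:C *: V j,
      forall j, \tr (V j) = 0,
      exists2 c : 'I_J -> R, (forall j, 0 < c j) &
        forall j k, hs (V j) (V k) = if j == k then (c j)%:C else 0 &
      forall j, exists j', (V j)^t* = V j' /\ omega j' = - omega j].

Definition Gam (R : realType) (d : nat) (sigma : 'M[R[i]]_d) (s : R)
    (X : 'M[R[i]]_d) : 'M[R[i]]_d :=
  mxpow sigma (s / 2) *m X *m mxpow sigma (s / 2).

Definition hat (R : realType) (p : R) : R := p / (p - 1).

Definition pnorm (R : realType) (d : nat) (sigma : 'M[R[i]]_d) (p : R)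
    (X : 'M[R[i]]_d) : R :=
  (complex.Re (\tr (mxpow (mxabs (Gam sigma p^-1 X)) p))) `^ p^-1.

Definition Fp (R : realType) (d : nat) (sigma : 'M[R[i]]_d) (p : R)
    (rho : 'M[R[i]]_d) : R :=
  (p * (p - 1))^-1 * (pnorm sigma p (Gam sigma (-1) rho) `^ p - 1).

Definition kms (R : realType) (d : nat) (sigma X Y : 'M[R[i]]_d) : R[i] :=
  \tr (mxpow sigma (2^-1) *m X^t* *m mxpow sigma (2^-1) *m Y).

(* The inner product below is real for X >= 0, as L preserves self-adjointness. *)
Definition Ep (R : realType) (d : nat) (sigma : 'M[R[i]]_d)
    (L : 'M[R[i]]_d -> 'M[R[i]]_d) (p : R) (X : 'M[R[i]]_d) : R :=
  - (hat p * p / 4) *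
    complex.Re (kms sigma
      (Gam sigma (- (hat p)^-1) (mxpow (Gam sigma p^-1 X) (p - 1))) (L X)).

Definition theta (R : realType) (p x y : R) : R :=
  if x == y then x `^ (2 - p)
  else (p - 1) * ((x - y) / (x `^ (p - 1) - y `^ (p - 1))).

Definition bracket (R : realType) (d : nat) (sigma : 'M[R[i]]_d) (p : R)
    (rho : 'M[R[i]]_d) (w : R) (X : 'M[R[i]]_d) : 'M[R[i]]_d :=
  let Y := Gam sigma (- (hat p)^-1) rho in
  Gam sigma (hat p)^-1
    (mxfun2 (theta p) ((expR (w / (2 * p)))%:C *: Y)
                      ((expR (- (w / (2 * p))))%:C *: Y)
      (Gam sigma (hat p)^-1 X)).

Definition Dp (R : realType) (d J : nat) (sigma : 'M[R[i]]_d)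
    (omega : 'I_J -> R) (V : 'I_J -> 'M[R[i]]_d) (p : R)
    (rho A : 'M[R[i]]_d) : 'M[R[i]]_d :=
  \sum_j adj (comm (V j)) (bracket sigma p rho (omega j) (comm (V j) A)).

(* Inverse of Dp on the traceless self-adjoint operators, where it is a       *)
(* bijection.                                                                 *)
Definition Dpinv (R : realType) (d J : nat) (sigma : 'M[R[i]]_d)
    (omega : 'I_J -> R) (V : 'I_J -> 'M[R[i]]_d) (p : R)
    (rho nu : 'M[R[i]]_d) : 'M[R[i]]_d :=
  xget 0 [set A | traceless_sa A /\ Dp sigma omega V p rho A = nu].

(* A trace of a product of two self-adjoint operators is real. *)
Definition gp (R : realType) (d J : nat) (sigma : 'M[R[i]]_d)
    (omega : 'I_J -> R) (V : 'I_J -> 'M[R[i]]_d) (p : R)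
    (rho nu1 nu2 : 'M[R[i]]_d) : R :=
  complex.Re (hs (Dpinv sigma omega V p rho nu1) nu2).

Definition mx_derivable (R : realType) (d : nat) (f : R -> 'M[R[i]]_d)
    (s : R) : Prop :=
  forall i j, derivable (fun t => complex.Re (f t i j)) s 1 /\
              derivable (fun t => complex.Im (f t i j)) s 1.

Definition mx_derive (R : realType) (d : nat) (f : R -> 'M[R[i]]_d)
    (s : R) : 'M[R[i]]_d :=
  \matrix_(i, j) (derive1 (fun t => complex.Re (f t i j)) s
                  +i* derive1 (fun t => complex.Im (f t i j)) s).

Definition dmetric (R : realType) (d : nat)
    (g : 'M[R[i]]_d -> 'M[R[i]]_d -> 'M[R[i]]_d -> R)
    (rho w u v : 'M[R[i]]_d) : R :=
  derive1 (fun t : R => g (rho + t%:C *: w) u v) 0.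

(* The full-rank densities form an open subset of an affine space directed by *)
(* the traceless self-adjoint operators, hence carry a global chart.  For the *)
(* constant vector fields u, v, w of that chart the Koszul formula of the     *)
(* Levi-Civita connection is                                                  *)
(*   2 g(nabla_u v, w) = D_u g(v, w) + D_v g(u, w) - D_w g(u, v),             *)
(* and nabla_u v is the value Gamma(u, v) of the Christoffel symbols.         *)
Definition christoffel (R : realType) (d : nat)
    (g : 'M[R[i]]_d -> 'M[R[i]]_d -> 'M[R[i]]_d -> R)
    (rho u v : 'M[R[i]]_d) : 'M[R[i]]_d :=
  xget 0 [set a | traceless_sa a /\ forall w, traceless_sa w ->
    2 * g rho a w = dmetric g rho u v w + dmetric g rho v u w
                    - dmetric g rho w u v].

(* The speed of a solution of the geodesic equation is constant.              *)
Definition geodesic (R : realType) (d : nat)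
    (g : 'M[R[i]]_d -> 'M[R[i]]_d -> 'M[R[i]]_d -> R)
    (eps : R) (gam : R -> 'M[R[i]]_d) : Prop :=
  forall s, `|s| < eps ->
    [/\ full_density (gam s),
        mx_derivable gam s,
        mx_derivable (mx_derive gam) s &
        mx_derive (mx_derive gam) s
        + christoffel g (gam s) (mx_derive gam s) (mx_derive gam s) = 0].

Definition Ric_ge (R : realType) (d J : nat) (sigma : 'M[R[i]]_d)
    (omega : 'I_J -> R) (V : 'I_J -> 'M[R[i]]_d) (p kappa : R) : Prop :=
  forall (rho : 'M[R[i]]_d) (eps : R) (gam : R -> 'M[R[i]]_d),
    full_density rho -> 0 < eps ->
    geodesic (gp sigma omega V p) eps gam -> gam 0 = rho ->
    kappa * gp sigma omega V p (gam 0) (mx_derive gam 0) (mx_derive gam 0)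
    <= derive1n 2 (fun s => Fp sigma p (gam s)) 0.

Lemma hs_adj (R : realType) (d : nat)
    (Phi : {linear 'M[R[i]]_d -> 'M[R[i]]_d}) (X Y : 'M[R[i]]_d) :
  hs (Phi X) Y = hs X (adj Phi Y).
Proof.
have hsE (A B : 'M[R[i]]_d) : hs A B = \sum_a \sum_b (A a b)^* * B a b.
  rewrite /hs /mxtrace exchange_big /=; apply: eq_bigr => b _.
  by rewrite !mxE; apply: eq_bigr => a _; rewrite !mxE.
have hsZ c (A B : 'M[R[i]]_d) : hs (c *: A) B = c^* * hs A B.
  rewrite !hsE mulr_sumr; apply: eq_bigr => a _; rewrite mulr_sumr.
  by apply: eq_bigr => b _; rewrite !mxE rmorphM mulrA.
have hsS (F : 'I_d -> 'M[R[i]]_d) (B : 'M[R[i]]_d) :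
    hs (\sum_a F a) B = \sum_a hs (F a) B.
  by rewrite /hs !(raddf_sum, mulmx_suml).
rewrite [RHS]hsE [X in Phi X]matrix_sum_delta raddf_sum hsS.
apply: eq_bigr => a _; rewrite raddf_sum hsS; apply: eq_bigr => b _.
by rewrite /= linearZ_LR hsZ !mxE.
Qed.

Lemma hs_delta (R : realType) (d : nat) (a b : 'I_d) (Y : 'M[R[i]]_d) :
  hs (delta_mx a b) Y = Y a b.
Proof.
rewrite /hs trmx_delta map_delta_mx /mxtrace (bigD1 b) //= big1 => [|k kb].
  rewrite addr0 mxE (bigD1 a) //= big1 => [|k ka].
    by rewrite mxE !eqxx mul1r addr0.
  by rewrite mxE (negbTE ka) andbF mul0r.
by rewrite mxE big1 // => l _; rewrite mxE (negbTE kb) mul0r.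
Qed.

Lemma adj_comm (R : realType) (d : nat) (V Y : 'M[R[i]]_d) :
  adj (comm V) Y = comm (V^t*) Y.
Proof.
apply/matrixP => a b; rewrite mxE -[RHS]hs_delta /hs /comm.
rewrite [(V *m _ - _)^T]raddfB /= map_mxB !trmx_mul !map_mxM mulmxBl mulmxBr.
by rewrite !raddfB /= -!mulmxA [X in _ - X = _]mxtrace_mulC -mulmxA.
Qed.

Lemma spectral_decomposition (R : realType) (d : nat) (A : 'M[R[i]]_d) :
  A \is hermsymmx -> A = \sum_i (eigval A i)%:C *: eigproj A i.
Proof.
move=> Ah; have /orthomx_spectralP {1}-> := hermitian_normalmx Ah.
rewrite invmx_unitary ?spectral_unitarymx //.
apply/matrixP => a b; rewrite summxE !mxE; apply: eq_bigr => k _.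
have /mxOverP/(_ 0 k) := hermitian_spectral_diag_real Ah.
rewrite mul_mx_diag !mxE big_ord1 !mxE /eigval => /complex_realP[x ->] /=.
by rewrite [_ * x%:C]mulrC mulrA.
Qed.

(* Main.v *)
(** The Beckner constant comes from entropy decay along the semigroup. Write
    [q = p - 1], let [A(rho)] be the differential of [Fp] at [rho] and let
    [D_rho] be the operator [Dp]. The commutation [sigma^s V_j = e^(-s omega_j)
    V_j sigma^s] gives the gradient identity [D_rho A(rho) = - adj L rho], so
    that [f(t) = Fp(rho_t)] satisfies
    [f' = - <D A, A> = - (4/p^2) Ep] along [rho_t = adj (P t) rho].
    Differentiating the gradient identity along [rho_t] shows that
    [f''(t) / 2] is the second derivative of [Fp] along the geodesic starting
    at [rho_t] with velocity [adj L rho_t]; this geodesic is obtained from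
    Hamilton's equations [gam' = D_gam a], [<a', w> = - <dD_gam(w) a, a> / 2]
    by the Picard-Lindeloef theorem. The curvature bound therefore reads
    [f'' + 2 kappa f' >= 0], i.e. [f' + 2 kappa f] is nondecreasing. As [f] is
    nonincreasing and bounded below, [f'] tends to 0 along a sequence of times;
    there [adj L rho_t -> 0], whence [rho_t -> sigma] by primitivity, and
    [f -> 0]. Hence [f' + 2 kappa f <= 0] for all [t], and [t = 0] is the claim
    with [alpha = kappa / 2].

    Smoothness of [rho |-> D_rho] is obtained from exact divided-difference
    identities: two-sided functional calculi differ by a triple sum of
    spectral projections weighted by the divided differences of the symbol. *)
Require Import Defs.
From HB Require Import structures.
From mathcomp Require Import all_boot all_order all_algebra.
From mathcomp Require Import all_classical all_reals all_analysis.
From mathcomp Require Import complex.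
From mathcomp Require Import ring lra.

Set Implicit Arguments.
Unset Strict Implicit.
Unset Printing Implicit Defensive.

Import Order.TTheory GRing.Theory Num.Theory.
Import numFieldTopology.Exports numFieldNormedType.Exports.

Local Open Scope classical_set_scope.
Local Open Scope ring_scope.
Local Open Scope complex_scope.
Local Open Scope sesquilinear_scope.

(** * Conjugate transposes, norms and inner products *)

(** [Ric_ge] speaks only of actual geodesics, whose Christoffel symbols are picked by [xget], so
    through each state a geodesic must be produced and identified. The Hamiltonian form does both
    with nothing beyond the locally Lipschitz first derivative [dD] of [D].

    Why half of [f'']: put [l = adj L rho], [A = A(rho)] and [X = <dD(l) A, A>]. The geodesic with
    velocity [l] has momentum [- A] up to a scalar, and along it [Fp'' = <dA(l), l> + <A, gam''>].
    In the last term the variation of [D] contributes [- X] and Hamilton's force [X / 2].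
    Differentiating [D A = - l] in the direction [l] and pairing with [A] gives
    [X = <dA(l), l> - <A, adj L l>], hence [Fp'' = (<dA(l), l> + <A, adj L l>) / 2].

    The diagonal case of [theta] disappears on writing [theta x y = q / m], with [m] the mean of
    [q u^(q-1)] over the segment from [x] to [y]. As [q <= 1], an upper bound on [x] and [y] alone
    bounds [m] below; so [D_rho] is bounded over all full-rank states and the dissipation controls
    [adj L rho] uniformly in time. *)

Section ConjugateTranspose.
Variable R : realType.
Local Notation C := R[i].

Lemma ctD m n (A B : 'M[C]_(m, n)) : (A + B)^t* = A^t* + B^t*.
Proof. by rewrite linearD /= map_mxD. Qed.

Lemma ctN m n (A : 'M[C]_(m, n)) : (- A)^t* = - A^t*.
Proof. by rewrite linearN /= map_mxN. Qed.

Lemma ctB m n (A B : 'M[C]_(m, n)) : (A - B)^t* = A^t* - B^t*.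
Proof. by rewrite ctD ctN. Qed.

Lemma ctZ m n (c : C) (A : 'M[C]_(m, n)) : (c *: A)^t* = c^* *: A^t*.
Proof. by rewrite linearZ /= map_mxZ. Qed.

Lemma ctZr m n (c : R) (A : 'M[C]_(m, n)) : (c%:C *: A)^t* = c%:C *: A^t*.
Proof. by rewrite ctZ; congr (_ *: _); exact: conjc_real. Qed.

Lemma ctM m n q (A : 'M[C]_(m, n)) (B : 'M[C]_(n, q)) :
  (A *m B)^t* = B^t* *m A^t*.
Proof. by rewrite trmx_mul map_mxM. Qed.

Lemma ct0 m n : (0 : 'M[C]_(m, n))^t* = 0.
Proof. by rewrite trmx0 map_mx0. Qed.

Lemma ct1 n : (1%:M : 'M[C]_n)^t* = 1%:M.
Proof. by rewrite trmx1 map_mx1. Qed.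

Lemma ct_sum m n (I : finType) (F : I -> 'M[C]_(m, n)) :
  (\sum_i F i)^t* = \sum_i (F i)^t*.
Proof. by rewrite !raddf_sum /=; under eq_bigr do rewrite /=. Qed.

Lemma ctE m n (A : 'M[C]_(m, n)) a b : (A^t*) a b = (A b a)^*.
Proof. by rewrite !mxE. Qed.

Lemma hermP n (A : 'M[C]_n) : (A \is hermsymmx) <-> (A^t* = A).
Proof.
split=> [h|h]; last by apply/is_hermitianmxP; rewrite expr0 scale1r h.
by have /is_hermitianmxP := h; rewrite expr0 scale1r => <-.
Qed.

Lemma tr_ct n (A : 'M[C]_n) : \tr (A^t*) = (\tr A)^*.
Proof. by rewrite /mxtrace rmorph_sum; apply: eq_bigr => i _; rewrite ctE. Qed.

Lemma ct_i n (X : 'M[C]_n) : ('i *: X)^t* = - 'i *: X^t*.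
Proof.
rewrite ctZ; congr (_ *: _); apply/eqP.
by rewrite eq_complex /= oppr0 !eqxx.
Qed.

End ConjugateTranspose.

(** * Entrywise norms with real values *)

Section Norm.
Variable R : realType.
Local Notation C := R[i].

(** Equivalent to the modulus, but with values in [R], so that all estimates are inequalities
    between reals; it is still submultiplicative. *)
Definition n1 (z : C) : R := `|complex.Re z| + `|complex.Im z|.

Lemma n1_ge0 z : 0 <= n1 z. Proof. by rewrite addr_ge0. Qed.

Lemma n1D x y : n1 (x + y) <= n1 x + n1 y.
Proof.
rewrite /n1; case: x y => a b [c e] /=.
by rewrite addrACA lerD // ler_normD.
Qed.

Lemma n1N x : n1 (- x) = n1 x.
Proof. by case: x => a b; rewrite /n1 /= !normrN. Qed.

Lemma n1M x y : n1 (x * y) <= n1 x * n1 y.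
Proof.
rewrite /n1; case: x y => a b [c e] /=.
have := ler_normB (a * c) (b * e); have := ler_normD (a * e) (b * c).
rewrite !normrM; lra.
Qed.

Lemma n1_real (r : R) : n1 r%:C = `|r|.
Proof. by rewrite /n1 /= normr0 addr0. Qed.

Lemma n1_realM (r : R) z : n1 (r%:C * z) = `|r| * n1 z.
Proof.
by case: z => a b; rewrite /n1 /= !mul0r subr0 addr0 !normrM mulrDr.
Qed.

Lemma n1_conj z : n1 (z^*) = n1 z.
Proof. by case: z => a b; rewrite /n1 /= normrN. Qed.

Lemma n1_0 : n1 0 = 0. Proof. by rewrite /n1 /= normr0 addr0. Qed.

Lemma n1_eq0 z : n1 z = 0 -> z = 0.
Proof.
case: z => a b; rewrite /n1 /= => h.
have := normr_ge0 a; have := normr_ge0 b => hb ha.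
have /normr0_eq0 -> : `|a| = 0 by lra.
by have /normr0_eq0 -> : `|b| = 0 by lra.
Qed.

Lemma n1_sum (I : Type) (r : seq I) (P : pred I) (F : I -> C) :
  n1 (\sum_(i <- r | P i) F i) <= \sum_(i <- r | P i) n1 (F i).
Proof.
elim/big_ind2: _ => //; first by rewrite n1_0.
by move=> x1 x2 y1 y2 h1 h2; apply: le_trans (n1D _ _) (lerD h1 h2).
Qed.

Lemma Re_le_n1 z : `|complex.Re z| <= n1 z.
Proof. by rewrite lerDl. Qed.

Lemma Im_le_n1 z : `|complex.Im z| <= n1 z.
Proof. by rewrite lerDr. Qed.

(** The entrywise sum is submultiplicative without a dimension factor, invariant under the adjoint,
    and additive on [row_mx]. *)
Definition nrm m n (X : 'M[C]_(m, n)) : R := \sum_i \sum_j n1 (X i j).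

Lemma nrm_ge0 m n (X : 'M[C]_(m, n)) : 0 <= nrm X.
Proof. by apply: sumr_ge0 => i _; apply: sumr_ge0 => j _; exact: n1_ge0. Qed.

Lemma nrmD m n (X Y : 'M[C]_(m, n)) : nrm (X + Y) <= nrm X + nrm Y.
Proof.
rewrite /nrm -big_split; apply: ler_sum => i _.
by rewrite -big_split; apply: ler_sum => j _; rewrite mxE; exact: n1D.
Qed.

Lemma nrmN m n (X : 'M[C]_(m, n)) : nrm (- X) = nrm X.
Proof. by apply: eq_bigr => i _; apply: eq_bigr => j _; rewrite mxE n1N. Qed.

Lemma nrmB m n (X Y : 'M[C]_(m, n)) : nrm (X - Y) <= nrm X + nrm Y.
Proof. by rewrite -(nrmN Y) nrmD. Qed.

Lemma nrmBC m n (X Y : 'M[C]_(m, n)) : nrm (X - Y) = nrm (Y - X).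
Proof. by rewrite -nrmN opprB. Qed.

Lemma nrm0 m n : nrm (0 : 'M[C]_(m, n)) = 0.
Proof. by rewrite /nrm big1 // => i _; rewrite big1 // => j _; rewrite mxE n1_0. Qed.

Lemma nrm_sum m n (I : Type) (r : seq I) (P : pred I) (F : I -> 'M[C]_(m, n)) :
  nrm (\sum_(i <- r | P i) F i) <= \sum_(i <- r | P i) nrm (F i).
Proof.
elim/big_ind2: _ => //; first by rewrite nrm0.
by move=> x1 x2 y1 y2 h1 h2; apply: le_trans (nrmD _ _) (lerD h1 h2).
Qed.

Lemma nrmZ m n (c : C) (X : 'M[C]_(m, n)) : nrm (c *: X) <= n1 c * nrm X.
Proof.
rewrite /nrm mulr_sumr; apply: ler_sum => i _.
by rewrite mulr_sumr; apply: ler_sum => j _; rewrite mxE; exact: n1M.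
Qed.

Lemma nrmZr m n (c : R) (X : 'M[C]_(m, n)) : nrm (c%:C *: X) = `|c| * nrm X.
Proof.
rewrite /nrm mulr_sumr; apply: eq_bigr => i _.
by rewrite mulr_sumr; apply: eq_bigr => j _; rewrite mxE n1_realM.
Qed.

Lemma n1_le_nrm m n (X : 'M[C]_(m, n)) i j : n1 (X i j) <= nrm X.
Proof.
rewrite /nrm (bigD1 i) //= (bigD1 j) //= -addrA lerDl addr_ge0 //.
  by apply: sumr_ge0 => k _; exact: n1_ge0.
by apply: sumr_ge0 => k _; apply: sumr_ge0 => l _; exact: n1_ge0.
Qed.

Lemma nrm_eq0 m n (X : 'M[C]_(m, n)) : nrm X = 0 -> X = 0.
Proof.
move=> h; apply/matrixP => i j; rewrite mxE; apply: n1_eq0.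
by apply/eqP; rewrite eq_le n1_ge0 andbT -h n1_le_nrm.
Qed.

Lemma nrm_ct m n (X : 'M[C]_(m, n)) : nrm (X^t*) = nrm X.
Proof.
rewrite /nrm exchange_big; apply: eq_bigr => i _; apply: eq_bigr => j _.
by rewrite ctE n1_conj.
Qed.

Lemma nrmM m n q (X : 'M[C]_(m, n)) (Y : 'M[C]_(n, q)) :
  nrm (X *m Y) <= nrm X * nrm Y.
Proof.
rewrite /nrm mulr_suml; apply: ler_sum => i _.
apply: (@le_trans _ _ (\sum_j \sum_k n1 (X i k) * n1 (Y k j))).
  apply: ler_sum => j _; rewrite mxE; apply: le_trans (n1_sum _ _ _) _.
  by apply: ler_sum => k _; exact: n1M.
rewrite exchange_big mulr_suml; apply: ler_sum => k _.
rewrite -mulr_sumr ler_wpM2l ?n1_ge0 // (bigD1 k) //= lerDl.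
by apply: sumr_ge0 => l _; apply: sumr_ge0 => j _; exact: n1_ge0.
Qed.

Lemma nrmM3 m n q r (X : 'M[C]_(m, n)) (Y : 'M[C]_(n, q)) (Z : 'M[C]_(q, r)) :
  nrm (X *m Y *m Z) <= nrm X * nrm Y * nrm Z.
Proof.
apply: le_trans (nrmM _ _) _; rewrite ler_wpM2r ?nrm_ge0 //; exact: nrmM.
Qed.

Lemma nrm_row_mx m n q (X : 'M[C]_(m, n)) (Y : 'M[C]_(m, q)) :
  nrm (row_mx X Y) = nrm X + nrm Y.
Proof.
rewrite /nrm -big_split; apply: eq_bigr => i _ /=; rewrite big_split_ord /=.
by congr (_ + _); apply: eq_bigr => j _; rewrite (row_mxEl, row_mxEr).
Qed.

Lemma n1_tr n (X : 'M[C]_n) : n1 (\tr X) <= nrm X.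
Proof.
apply: le_trans (n1_sum _ _ _) _; apply: ler_sum => i _.
by rewrite (bigD1 i) //= lerDl; apply: sumr_ge0 => j _; exact: n1_ge0.
Qed.

Lemma n1_hs n (X Y : 'M[C]_n) : n1 (hs X Y) <= nrm X * nrm Y.
Proof.
by apply: le_trans (n1_tr _) _; apply: le_trans (nrmM _ _) _; rewrite nrm_ct.
Qed.

Lemma nrm_delta n (i j : 'I_n) : nrm (delta_mx i j : 'M[C]_n) = 1.
Proof.
rewrite /nrm (bigD1 i) //= (bigD1 j) //= mxE !eqxx n1_real normr1.
rewrite big1 ?addr0 => [|k /negPf kj]; last by rewrite mxE kj andbF n1_0.
rewrite big1 ?addr0 // => k /negPf ki; rewrite big1 // => l _.
by rewrite mxE ki n1_0.
Qed.

(** The constant is the total norm of the images of the matrix units. Linearity is a plain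
    hypothesis because the maps met below are not bundled. *)
Lemma linear_bounded n (f : 'M[C]_n -> 'M[C]_n) :
  (forall (c : C) X Y, f (c *: X + Y) = c *: f X + f Y) ->
  exists2 K, 0 <= K & forall X, nrm (f X) <= K * nrm X.
Proof.
move=> fl; have f0 : f 0 = 0.
  have := fl (-1) 0 0; rewrite scaler0 addr0 scaleN1r => ->.
  by rewrite addrC subrr.
have fD X Y : f (X + Y) = f X + f Y by have := fl 1 X Y; rewrite !scale1r.
have fZ c X : f (c *: X) = c *: f X by have := fl c X 0; rewrite !addr0 f0 addr0.
have fs I (r : seq I) F : f (\sum_(i <- r) F i) = \sum_(i <- r) f (F i).
  by elim/big_ind2: _ => // x1 x2 y1 y2 <- <-.
exists (\sum_i \sum_j nrm (f (delta_mx i j))).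
  by apply: sumr_ge0 => i _; apply: sumr_ge0 => j _; exact: nrm_ge0.
move=> X; rewrite {1}[X]matrix_sum_delta fs.
apply: le_trans (nrm_sum _ _ _) _; rewrite mulr_suml; apply: ler_sum => i _.
rewrite fs; apply: le_trans (nrm_sum _ _ _) _; rewrite mulr_suml.
apply: ler_sum => j _; rewrite fZ; apply: le_trans (nrmZ _ _) _.
by rewrite mulrC ler_wpM2l ?nrm_ge0 // n1_le_nrm.
Qed.

End Norm.

(** * The real part of the Hilbert-Schmidt product *)

Section RealInnerProduct.
Variable R : realType.
Local Notation C := R[i].

(** A real inner product on all complex matrices. As [gp] and [Ep] are defined by real parts, they
    are values of [ip] with no argument about reality. *)
Definition ip d (X Y : 'M[C]_d) : R := complex.Re (hs X Y).

Lemma hsDr d (X Y Z : 'M[C]_d) : hs X (Y + Z) = hs X Y + hs X Z.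
Proof. by rewrite /hs mulmxDr mxtraceD. Qed.

Lemma hsDl d (X Y Z : 'M[C]_d) : hs (X + Y) Z = hs X Z + hs Y Z.
Proof. by rewrite /hs ctD mulmxDl mxtraceD. Qed.

Lemma hsZr d c (X Y : 'M[C]_d) : hs X (c *: Y) = c * hs X Y.
Proof. by rewrite /hs -scalemxAr mxtraceZ. Qed.

Lemma hsZl d c (X Y : 'M[C]_d) : hs (c *: X) Y = c^* * hs X Y.
Proof. by rewrite /hs ctZ -scalemxAl mxtraceZ. Qed.

Lemma hsC d (X Y : 'M[C]_d) : hs Y X = (hs X Y)^*.
Proof. by rewrite /hs -tr_ct ctM trmxCK. Qed.

Lemma ReD (x y : C) : complex.Re (x + y) = complex.Re x + complex.Re y.
Proof. by case: x; case: y. Qed.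

Lemma ReN (x : C) : complex.Re (- x) = - complex.Re x.
Proof. by case: x. Qed.

Lemma ReZ (r : R) (x : C) : complex.Re (r%:C * x) = r * complex.Re x.
Proof. by case: x => a b /=; rewrite mul0r subr0. Qed.

Lemma Re_conj (x : C) : complex.Re (x^*) = complex.Re x.
Proof. by case: x. Qed.

Lemma ImD (x y : C) : complex.Im (x + y) = complex.Im x + complex.Im y.
Proof. by case: x; case: y. Qed.

Lemma ImN (x : C) : complex.Im (- x) = - complex.Im x.
Proof. by case: x. Qed.

Lemma ImZ (r : R) (x : C) : complex.Im (r%:C * x) = r * complex.Im x.
Proof. by case: x => a b /=; rewrite mul0r addr0. Qed.

Lemma Re_sum I (r : seq I) (P : pred I) (F : I -> C) :
  complex.Re (\sum_(i <- r | P i) F i) = \sum_(i <- r | P i) complex.Re (F i).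
Proof. by elim/big_rec2: _ => // i y1 y2 _ <-; rewrite ReD. Qed.

Lemma ipDr d (X Y Z : 'M[C]_d) : ip X (Y + Z) = ip X Y + ip X Z.
Proof. by rewrite /ip hsDr ReD. Qed.

Lemma ipDl d (X Y Z : 'M[C]_d) : ip (X + Y) Z = ip X Z + ip Y Z.
Proof. by rewrite /ip hsDl ReD. Qed.

Lemma ipZr d (c : R) (X Y : 'M[C]_d) : ip X (c%:C *: Y) = c * ip X Y.
Proof. by rewrite /ip hsZr ReZ. Qed.

Lemma ipC d (X Y : 'M[C]_d) : ip X Y = ip Y X.
Proof. by rewrite /ip hsC Re_conj. Qed.

Lemma ipZl d (c : R) (X Y : 'M[C]_d) : ip (c%:C *: X) Y = c * ip X Y.
Proof. by rewrite ipC ipZr ipC. Qed.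

Lemma ipNr d (X Y : 'M[C]_d) : ip X (- Y) = - ip X Y.
Proof. by rewrite -scaleN1r -[-1](rmorphN1 (real_complex R)) ipZr mulN1r. Qed.

Lemma ipNl d (X Y : 'M[C]_d) : ip (- X) Y = - ip X Y.
Proof. by rewrite ipC ipNr ipC. Qed.

Lemma ipBr d (X Y Z : 'M[C]_d) : ip X (Y - Z) = ip X Y - ip X Z.
Proof. by rewrite ipDr ipNr. Qed.

Lemma ipBl d (X Y Z : 'M[C]_d) : ip (X - Y) Z = ip X Z - ip Y Z.
Proof. by rewrite ipDl ipNl. Qed.

Lemma ip0r d (X : 'M[C]_d) : ip X 0 = 0.
Proof. by rewrite -(subrr X) ipBr subrr. Qed.

Lemma ip_sumr d I (r : seq I) (X : 'M[C]_d) F :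
  ip X (\sum_(i <- r) F i) = \sum_(i <- r) ip X (F i).
Proof. by elim/big_rec2: _ => [|i y1 y2 _ <-]; rewrite ?ip0r ?ipDr. Qed.

Lemma ip_le d (X Y : 'M[C]_d) : `|ip X Y| <= nrm X * nrm Y.
Proof.
apply: le_trans (Re_le_n1 _) _; apply: le_trans (n1_tr _) _.
by apply: le_trans (nrmM _ _) _; rewrite nrm_ct.
Qed.

Lemma ip_entries d (X : 'M[C]_d) :
  ip X X = \sum_i \sum_j (complex.Re (X i j) ^+ 2 + complex.Im (X i j) ^+ 2).
Proof.
rewrite /ip /hs /mxtrace Re_sum exchange_big; apply: eq_bigr => j _.
rewrite mxE Re_sum; apply: eq_bigr => i _; rewrite ctE.
by case: (X i j) => a b /=; ring.
Qed.

Lemma ip_ge0 d (X : 'M[C]_d) : 0 <= ip X X.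
Proof.
rewrite ip_entries; apply: sumr_ge0 => i _; apply: sumr_ge0 => j _.
by rewrite addr_ge0 ?sqr_ge0.
Qed.

Lemma ip_eq0 d (X : 'M[C]_d) : ip X X = 0 -> X = 0.
Proof.
rewrite ip_entries => /eqP; rewrite psumr_eq0; last first.
  by move=> i _; apply: sumr_ge0 => j _; rewrite addr_ge0 ?sqr_ge0.
move=> /allP h; apply/matrixP => i j.
have /= := h i (mem_index_enum _); rewrite psumr_eq0; last first.
  by move=> k _; rewrite addr_ge0 ?sqr_ge0.
move=> /allP /(_ j (mem_index_enum _)) /=.
rewrite paddr_eq0 ?sqr_ge0 // !sqrf_eq0 mxE => /andP[/eqP a /eqP b].
by case: (X i j) a b => x y /= -> ->.
Qed.

Lemma n1_sqr (z : C) :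
  n1 z ^+ 2 <= 2 * (complex.Re z ^+ 2 + complex.Im z ^+ 2).
Proof.
case: z => a b; rewrite /n1 /= -(real_normK (num_real a)) -(real_normK (num_real b)).
by have := sqr_ge0 (`|a| - `|b|); nra.
Qed.

Lemma n1_sqr_ip d (X : 'M[C]_d) i j : n1 (X i j) ^+ 2 <= 2 * ip X X.
Proof.
apply: le_trans (n1_sqr _) _; rewrite ler_pM2l // ip_entries.
rewrite (bigD1 i) //= (bigD1 j) //= -addrA lerDl addr_ge0 //.
  by apply: sumr_ge0 => k _; rewrite addr_ge0 ?sqr_ge0.
apply: sumr_ge0 => k _; apply: sumr_ge0 => l _.
by rewrite addr_ge0 ?sqr_ge0.
Qed.

Lemma nrm_le_entry m n (X : 'M[C]_(m, n)) K :
  (forall i j, n1 (X i j) <= K) -> nrm X <= m%:R * n%:R * K.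
Proof.
move=> h; rewrite /nrm; apply: (@le_trans _ _ (\sum_(i < m) \sum_(j < n) K)).
  by apply: ler_sum => i _; apply: ler_sum => j _.
by rewrite -mulrA !mulr_natl !sumr_const !card_ord.
Qed.

Lemma nrm_sqr_ip d (X : 'M[C]_d) : nrm X ^+ 2 <= 2 * d%:R ^+ 4 * ip X X.
Proof.
have h : nrm X <= d%:R * d%:R * Num.sqrt (2 * ip X X).
  apply: nrm_le_entry => i j.
  rewrite -(ger0_norm (n1_ge0 _)) -sqrtr_sqr ler_wsqrtr //; exact: n1_sqr_ip.
have h0 : 0 <= d%:R * d%:R * Num.sqrt (2 * ip X X) by rewrite !mulr_ge0 ?sqrtr_ge0.
have := ler_pM (nrm_ge0 X) (nrm_ge0 X) h h; rewrite -!expr2 => /le_trans -> //.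
rewrite exprMn sqr_sqrtr ?mulr_ge0 ?ip_ge0 //.
by rewrite le_eqVlt; apply/orP; left; apply/eqP; ring.
Qed.

Lemma adj_hs d (f : 'M[C]_d -> 'M[C]_d) X Y :
  (forall (c : C) X Y, f (c *: X + Y) = c *: f X + f Y) ->
  hs (f X) Y = hs X (adj f Y).
Proof.
move=> fl.
pose g := HB.pack_for {linear 'M[C]_d -> 'M[C]_d} f
  (GRing.isLinear.Build C _ _ _ f fl).
exact: (hs_adj g).
Qed.

End RealInnerProduct.

(** * Functional calculus of self-adjoint matrices *)

Section Resolution.
Variables (R : realType) (d : nat).
Local Notation C := R[i].
Local Notation M := 'M[C]_d.

(** A spectral resolution detached from the diagonalisation chosen by [spectralmx]: [f(A)] and [c A]
    inherit the projections of [A], although their own [eigproj] may be others. *)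
Definition resolution (Y : M) (lam : 'I_d -> R) (E : 'I_d -> M) : Prop :=
  [/\ forall i j, E i *m E j = if i == j then E i else 0,
      forall i, (E i)^t* = E i, \sum_i E i = 1%:M &
      Y = \sum_i (lam i)%:C *: E i].

Lemma eigproj_mul (A : M) i j :
  eigproj A i *m eigproj A j = if i == j then eigproj A i else 0.
Proof.
rewrite /eigproj -mulmxA (mulmxA (row i _)).
have -> : row i (spectralmx A) *m (row j (spectralmx A))^t* = (i == j)%:R%:M.
  rewrite [LHS]mx11_scalar; congr (_%:M).
  have /row_unitarymxP/(_ i j) := spectral_unitarymx A.
  by rewrite dotmxE.
by rewrite mul_scalar_mx; case: eqP => [->|_]; rewrite ?scale1r ?scale0r ?mulmx0.
Qed.

Lemma eigproj_ct (A : M) i : (eigproj A i)^t* = eigproj A i.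
Proof. by rewrite /eigproj ctM trmxCK. Qed.

Lemma eigproj_sum (A : M) : \sum_i eigproj A i = 1%:M.
Proof.
have /unitarymxP h := spectral_unitarymx A.
have {}h : (spectralmx A)^t* *m spectralmx A = 1%:M by apply: mulmx1C.
rewrite -h; apply/matrixP => a b; rewrite summxE !mxE; apply: eq_bigr => k _.
by rewrite !mxE big_ord1 !mxE.
Qed.

Lemma eigproj_tr (A : M) i : \tr (eigproj A i) = 1.
Proof.
rewrite /eigproj mxtrace_mulC.
have /row_unitarymxP/(_ i i) := spectral_unitarymx A.
by rewrite dotmxE eqxx => h; rewrite [X in \tr X]mx11_scalar h mxtrace1.
Qed.

Lemma eig_resolution (A : M) : A^t* = A -> resolution A (eigval A) (eigproj A).
Proof.
move=> hA; split; [exact: eigproj_mul|exact: eigproj_ct|exact: eigproj_sum|].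
by apply: spectral_decomposition; apply/hermP.
Qed.

Definition cproj : R := d%:R * d%:R * 2.

Lemma cproj_ge0 : 0 <= cproj. Proof. by rewrite !mulr_ge0. Qed.

(** Row [a] of a projection has squared length [E a a], which forces [E a a <= 1] and bounds every
    real and imaginary part by 1; the 2 in [cproj] counts these two parts. *)
Lemma proj_nrm (E : M) : E *m E = E -> E^t* = E -> nrm E <= cproj.
Proof.
move=> EE Eh; apply: nrm_le_entry => a b.
have key : \sum_b (complex.Re (E a b) ^+ 2 + complex.Im (E a b) ^+ 2)
    = complex.Re (E a a).
  rewrite -{3}EE mxE Re_sum; apply: eq_bigr => k _.
  by rewrite -{4}Eh ctE; case: (E a k) => x y /=; ring.
have le1 k : complex.Re (E a k) ^+ 2 + complex.Im (E a k) ^+ 2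
    <= complex.Re (E a a).
  rewrite -key (bigD1 k) //= lerDl; apply: sumr_ge0 => l _.
  by rewrite addr_ge0 ?sqr_ge0.
have haa := le1 a; have hab := le1 b; rewrite /n1.
move: haa hab; move: (complex.Re (E a a)) (complex.Im (E a a)) => x y.
move: (complex.Re (E a b)) (complex.Im (E a b)) => u v h1 h2.
have x1 : x <= 1 by have := sqr_ge0 y; nra.
have hu : `|u| <= 1 by have ? := sqr_ge0 v; rewrite ler_norml; apply/andP; split; nra.
have hv : `|v| <= 1 by have ? := sqr_ge0 u; rewrite ler_norml; apply/andP; split; nra.
lra.
Qed.

Lemma resolution_nrm Y lam E : resolution Y lam E -> forall i, nrm (E i) <= cproj.
Proof. by case=> h1 h2 _ _ i; apply: proj_nrm; rewrite ?h1 ?eqxx ?h2. Qed.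

Lemma resolution_ct Y lam E : resolution Y lam E -> Y^t* = Y.
Proof.
case=> _ h2 _ ->; rewrite ct_sum; apply: eq_bigr => i _.
by rewrite ctZr h2.
Qed.

Lemma resolution_mull Y lam E i :
  resolution Y lam E -> E i *m Y = (lam i)%:C *: E i.
Proof.
case=> h1 h2 _ ->; rewrite mulmx_sumr (bigD1 i) //= big1 ?addr0.
  by rewrite -scalemxAr h1 eqxx.
by move=> j ji; rewrite -scalemxAr h1 eq_sym (negPf ji) scaler0.
Qed.

Lemma resolution_mulr Y lam E i :
  resolution Y lam E -> Y *m E i = (lam i)%:C *: E i.
Proof.
case=> h1 h2 _ ->; rewrite mulmx_suml (bigD1 i) //= big1 ?addr0.
  by rewrite -scalemxAl h1 eqxx.
by move=> j ji; rewrite -scalemxAl h1 (negPf ji) scaler0.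
Qed.

(** The source of all exact divided-difference formulas: between a projection of [A] and one of [B],
    the increment [A - B] is the scalar [lam i - mu j]. *)
Lemma resolution_cross A lam E B mu F i j :
  resolution A lam E -> resolution B mu F ->
  E i *m (A - B) *m F j = (lam i - mu j)%:C *: (E i *m F j).
Proof.
move=> rA rB; rewrite mulmxBr mulmxBl (resolution_mull i rA) -!mulmxA.
by rewrite (resolution_mulr j rB) -scalemxAl -scalemxAr -scalerBl -rmorphB.
Qed.

(** Each sum is expanded by the resolution of the identity that belongs to the other one. *)
Lemma resolution_diff A lam E B mu F (f g : 'I_d -> R) :
  resolution A lam E -> resolution B mu F ->
  \sum_i (f i)%:C *: E i - \sum_j (g j)%:C *: F j =
  \sum_i \sum_j (f i - g j)%:C *: (E i *m F j).
Proof.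
move=> [_ _ E1 _] [_ _ F1 _].
have -> : \sum_i (f i)%:C *: E i = \sum_i \sum_j (f i)%:C *: (E i *m F j).
  apply: eq_bigr => i _; rewrite -{1}[E i]mulmx1 -F1 mulmx_sumr scaler_sumr.
  by [].
have -> : \sum_j (g j)%:C *: F j = \sum_i \sum_j (g j)%:C *: (E i *m F j).
  rewrite exchange_big; apply: eq_bigr => j _.
  by rewrite -{1}[F j]mul1mx -E1 mulmx_suml scaler_sumr.
rewrite -sumrB; apply: eq_bigr => i _; rewrite -sumrB; apply: eq_bigr => j _.
by rewrite -scalerBl -rmorphB.
Qed.

Definition clip : R := d%:R * d%:R * (cproj * cproj).

Lemma clip_ge0 : 0 <= clip. Proof. by rewrite !mulr_ge0 ?cproj_ge0. Qed.

Lemma sum2_le (F : 'I_d -> 'I_d -> R) K :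
  (forall i j, F i j <= K) -> \sum_i \sum_j F i j <= d%:R * d%:R * K.
Proof.
move=> h; apply: (@le_trans _ _ (\sum_(i < d) \sum_(j < d) K)).
  by apply: ler_sum => i _; apply: ler_sum => j _.
by rewrite -mulrA !mulr_natl !sumr_const !card_ord.
Qed.

(** By [resolution_cross], [|lam i - mu j|] times the norm of [E i F j] is the norm of
    [E i (A - B) F j]. So a scalar Lipschitz bound becomes one in norm, and eigenvectors are never
    followed. *)
Lemma resolution_lip A lam E B mu F (f g : 'I_d -> R) K :
  resolution A lam E -> resolution B mu F -> 0 <= K ->
  (forall i j, `|f i - g j| <= K * `|lam i - mu j|) ->
  nrm (\sum_i (f i)%:C *: E i - \sum_j (g j)%:C *: F j)
    <= clip * K * nrm (A - B).
Proof.
move=> rA rB K0 fg; rewrite (resolution_diff f g rA rB).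
apply: le_trans (nrm_sum _ _ _) _.
apply: (@le_trans _ _ (\sum_i \sum_j (cproj * cproj * (K * nrm (A - B))))).
  apply: ler_sum => i _; apply: le_trans (nrm_sum _ _ _) _.
  apply: ler_sum => j _; rewrite nrmZr.
  apply: (@le_trans _ _ (K * (`|lam i - mu j| * nrm (E i *m F j)))).
    by rewrite mulrA ler_wpM2r ?nrm_ge0.
  rewrite -nrmZr -(resolution_cross i j rA rB) mulrCA ler_wpM2l //.
  apply: le_trans (nrmM3 _ _ _) _; rewrite mulrAC ler_wpM2r ?nrm_ge0 //.
  by rewrite ler_pM ?nrm_ge0 ?(resolution_nrm rA) ?(resolution_nrm rB).
by apply: le_trans (sum2_le (fun _ _ => lexx _)) _; rewrite /clip !mulrA.
Qed.

Lemma resolution_zero A lam E mu F i j :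
  resolution A lam E -> resolution A mu F -> lam i != mu j -> E i *m F j = 0.
Proof.
move=> rA rB ne; have := resolution_cross i j rA rB.
rewrite subrr mulmx0 mul0mx => /esym/eqP; rewrite scaler_eq0.
by case/orP => /eqP // /(@complexI _ _ 0)/eqP; rewrite subr_eq0 (negPf ne).
Qed.

(** Two resolutions of the same matrix have orthogonal projections wherever the eigenvalues differ,
    so every term of [resolution_diff] vanishes. *)
Lemma mxfun_res (f : R -> R) A lam E :
  resolution A lam E -> mxfun f A = \sum_i (f (lam i))%:C *: E i.
Proof.
move=> rA; have rB := eig_resolution (resolution_ct rA).
apply/eqP; rewrite -subr_eq0 /mxfun.
rewrite (resolution_diff (fun i => f (eigval A i)) (fun i => f (lam i)) rB rA).
apply/eqP; rewrite big1 // => i _; rewrite big1 // => j _.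
have [->|ne] := eqVneq (eigval A i) (lam j); first by rewrite subrr scale0r.
by rewrite (resolution_zero rB rA) ?scaler0.
Qed.

Lemma mxfun2_res (f : R -> R -> R) A lam E B mu F X :
  resolution A lam E -> resolution B mu F ->
  mxfun2 f A B X = \sum_i \sum_k (f (lam i) (mu k))%:C *: (E i *m X *m F k).
Proof.
move=> rA rB; have eA := eig_resolution (resolution_ct rA).
have eB := eig_resolution (resolution_ct rB).
(* The resolutions are exchanged one side at a time, the one-variable result being applied to [f]
   with its other argument frozen. *)
transitivity (\sum_i \sum_k (f (eigval A i) (mu k))%:C *:
    (eigproj A i *m X *m F k)).
  apply: eq_bigr => i _.
  have := mxfun_res (f (eigval A i)) rB; rewrite /mxfun => h.
  have sc (g : 'I_d -> R) (G : 'I_d -> M) :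
     \sum_k (g k)%:C *: (eigproj A i *m X *m G k)
     = eigproj A i *m X *m \sum_k (g k)%:C *: G k.
    by rewrite mulmx_sumr; apply: eq_bigr => k _; rewrite -scalemxAr.
  by rewrite sc h -sc.
rewrite exchange_big [RHS]exchange_big; apply: eq_bigr => k _ /=.
have := mxfun_res (f ^~ (mu k)) rA; rewrite /mxfun => h.
have sc (g : 'I_d -> R) (G : 'I_d -> M) :
   \sum_k0 (g k0)%:C *: (G k0 *m X *m F k)
   = (\sum_k (g k)%:C *: G k) *m X *m F k.
  by rewrite !mulmx_suml; apply: eq_bigr => l _; rewrite -!scalemxAl.
by rewrite sc h -sc.
Qed.

Lemma mxfun_resolution (f : R -> R) A lam E :
  resolution A lam E -> resolution (mxfun f A) (f \o lam) E.
Proof. by move=> rA; rewrite (mxfun_res f rA); case: rA. Qed.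

Lemma scale_resolution (a : R) A lam E :
  resolution A lam E -> resolution (a%:C *: A) (fun i => a * lam i) E.
Proof.
case=> h1 h2 h3 ->; split=> //; rewrite scaler_sumr; apply: eq_bigr => i _.
by rewrite scalerA -rmorphM.
Qed.

Lemma mxfun_comp (f g : R -> R) (A : M) : A^t* = A ->
  mxfun f (mxfun g A) = mxfun (f \o g) A.
Proof.
move=> /eig_resolution rA.
by rewrite (mxfun_res f (mxfun_resolution g rA)) (mxfun_res _ rA).
Qed.

Lemma mxfun_ct (f : R -> R) (A : M) : (mxfun f A)^t* = mxfun f A.
Proof.
rewrite /mxfun ct_sum; apply: eq_bigr => i _; rewrite ctZr eigproj_ct //.
Qed.

Lemma mxfunM (f g : R -> R) (A : M) :
  mxfun f A *m mxfun g A = mxfun (fun x => f x * g x) A.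
Proof.
rewrite /mxfun mulmx_suml; apply: eq_bigr => i _.
rewrite mulmx_sumr (bigD1 i) //= big1 ?addr0 => [|j ji].
  by rewrite -scalemxAl -scalemxAr eigproj_mul eqxx scalerA -rmorphM.
by rewrite -scalemxAl -scalemxAr eigproj_mul eq_sym (negPf ji) !scaler0.
Qed.

Lemma mxfun_id (A : M) : A^t* = A -> mxfun id A = A.
Proof. by move=> /eig_resolution rA; rewrite (mxfun_res _ rA); case: rA. Qed.

Lemma eq_mxfun (f g : R -> R) (A : M) :
  (forall i, f (eigval A i) = g (eigval A i)) -> mxfun f A = mxfun g A.
Proof. by move=> h; apply: eq_bigr => i _; rewrite h. Qed.

Lemma mxfun1 (A : M) : mxfun (fun=> 1) A = 1%:M.
Proof. by rewrite -(eigproj_sum A); apply: eq_bigr => i _; rewrite scale1r. Qed.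

Lemma mxtrace_mxfun f (A : M) : \tr (mxfun f A) = (\sum_i f (eigval A i))%:C.
Proof.
rewrite /mxfun raddf_sum rmorph_sum; apply: eq_bigr => i _ /=.
by rewrite mxtraceZ eigproj_tr mulr1.
Qed.

End Resolution.

(** * Positive definite matrices and spectral bounds *)

Section PositiveDefinite.
Variables (R : realType) (d : nat).
Local Notation C := R[i].
Local Notation M := 'M[C]_d.

Definition pd (A : M) : Prop := A^t* = A /\ forall i, 0 < eigval A i.

(** The self-adjoint matrices on which scalar estimates over [[m, b]] hold uniformly. *)
Definition box (m b : R) (A : M) : Prop :=
  A^t* = A /\ forall i, m <= eigval A i <= b.

Lemma ip_eigproj (A : M) i : A^t* = A -> ip (eigproj A i) A = eigval A i.
Proof.
move=> hA; rewrite /ip /hs eigproj_ct (resolution_mull i (eig_resolution hA)).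
by rewrite mxtraceZ eigproj_tr mulr1.
Qed.

Lemma ip_projs (E F : M) : E *m E = E -> E^t* = E -> F *m F = F -> F^t* = F ->
  0 <= ip E F.
Proof.
move=> EE Eh FF Fh; have -> : ip E F = ip (E *m F) (E *m F); last exact: ip_ge0.
rewrite /ip /hs ctM Eh Fh -!mulmxA (mulmxA E E) EE (mxtrace_mulC F).
by rewrite -mulmxA FF.
Qed.

(** No matching of eigenvalues: the one of [B] is [<E, B> = <E, A> + <E, B - A>] with [E] its
    projection, and [<E, A>] is a convex combination of the eigenvalues of [A]. *)
Lemma eigval_pert (A B : M) m b i : box m b A -> B^t* = B ->
  m - cproj R d * nrm (B - A) <= eigval B i <= b + cproj R d * nrm (B - A).
Proof.
move=> [hA mA] hB; rewrite -{1 2}(ip_eigproj i hB).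
have rA := eig_resolution hA.
have -> : ip (eigproj B i) B = ip (eigproj B i) A + ip (eigproj B i) (B - A).
  by rewrite -ipDr addrC subrK.
have p l : 0 <= ip (eigproj B i) (eigproj A l).
  by apply: ip_projs; rewrite ?eigproj_mul ?eqxx ?eigproj_ct.
have s1 : \sum_l ip (eigproj B i) (eigproj A l) = 1.
  rewrite -ip_sumr eigproj_sum /ip /hs mulmx1 eigproj_ct eigproj_tr //.
have eA : ip (eigproj B i) A = \sum_l eigval A l * ip (eigproj B i) (eigproj A l).
  case: rA => _ _ _ {1}->; rewrite ip_sumr; apply: eq_bigr => l _.
  by rewrite ipZr.
have lo : m <= ip (eigproj B i) A.
  rewrite eA -[m]mulr1 -s1 mulr_sumr; apply: ler_sum => l _.
  by rewrite ler_wpM2r //; case/andP: (mA l).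
have hi : ip (eigproj B i) A <= b.
  rewrite eA -[b]mulr1 -s1 mulr_sumr; apply: ler_sum => l _.
  by rewrite ler_wpM2r //; case/andP: (mA l).
have : `|ip (eigproj B i) (B - A)| <= cproj R d * nrm (B - A).
  apply: le_trans (ip_le _ _) _; rewrite ler_wpM2r ?nrm_ge0 //.
  exact: resolution_nrm (eig_resolution hB) i.
by rewrite ler_norml => /andP[h1 h2]; apply/andP; split; lra.
Qed.

Lemma pd_box (A : M) : pd A -> exists m b, [/\ 0 < m, 0 < b & box m b A].
Proof.
(* Sums stand in for the extreme eigenvalues, which would need a nonempty index set. *)
move=> [hA pA]; exists (1 + \sum_i (eigval A i)^-1)^-1, (1 + \sum_i eigval A i).
have s0 : 0 <= \sum_i (eigval A i)^-1.
  by apply: sumr_ge0 => i _; rewrite invr_ge0 ltW.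
have t0 : 0 <= \sum_i eigval A i by apply: sumr_ge0 => i _; rewrite ltW.
split; [by rewrite invr_gt0; lra|lra|split=> // i].
rewrite -[X in _ <= X <= _]invrK lef_pV2 ?posrE ?invr_gt0 //; last by lra.
rewrite (bigD1 i) //= [X in _ && (_ <= _ + X)](bigD1 i) //=; apply/andP; split.
  have : 0 <= \sum_(j | j != i) (eigval A j)^-1.
    by apply: sumr_ge0 => j _; rewrite invr_ge0 ltW.
  lra.
have : 0 <= \sum_(j | j != i) eigval A j by apply: sumr_ge0 => j _; rewrite ltW.
by rewrite invrK; lra.
Qed.

Lemma box_pd m b (A : M) : 0 < m -> box m b A -> pd A.
Proof. by move=> m0 [hA h]; split=> // i; case/andP: (h i) => /(lt_le_trans m0). Qed.

Definition rsq (v : 'rV[C]_d) : R :=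
  \sum_j (complex.Re (v 0 j) ^+ 2 + complex.Im (v 0 j) ^+ 2).

Lemma rsqE (v : 'rV[C]_d) : (v *m v^t*) 0 0 = (rsq v)%:C.
Proof.
rewrite mxE rmorph_sum; apply: eq_bigr => j _; rewrite ctE.
by case: (v 0 j) => a b; apply/eqP; rewrite eq_complex /=; apply/andP; split; apply/eqP; ring.
Qed.

Lemma rsq_ge0 v : 0 <= rsq v.
Proof. by apply: sumr_ge0 => j _; rewrite addr_ge0 ?sqr_ge0. Qed.

Lemma rsq_eq0 v : rsq v = 0 -> v = 0.
Proof.
move=> /eqP; rewrite psumr_eq0; last by move=> j _; rewrite addr_ge0 ?sqr_ge0.
move=> /allP h; apply/rowP => j; have /= := h j (mem_index_enum _).
rewrite paddr_eq0 ?sqr_ge0 // !sqrf_eq0 mxE.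
by case: (v 0 j) => x y /= /andP[/eqP -> /eqP ->].
Qed.

Lemma quad_eig (A : M) (v : 'rV[C]_d) : A^t* = A ->
  (v *m A *m v^t*) 0 0 = (\sum_i eigval A i * rsq (v *m eigproj A i))%:C.
Proof.
move=> hA; have [E2 Eh _ eA] := eig_resolution hA; rewrite {1}eA.
rewrite mulmx_sumr mulmx_suml summxE rmorph_sum; apply: eq_bigr => i _ /=.
rewrite -scalemxAr -scalemxAl mxE [RHS]rmorphM /= -rsqE ctM Eh.
by rewrite -(mulmxA v) (mulmxA (eigproj A i)) E2 eqxx !mulmxA.
Qed.

Lemma pdP (A : M) :
  pd A <-> A^t* = A /\ forall v : 'rV[C]_d, v != 0 -> 0 < (v *m A *m v^t*) 0 0.
Proof.
split=> -[hA h]; split=> //.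
  move=> v v0; rewrite quad_eig // (ltcR 0) lt_neqAle.
  rewrite sumr_ge0 ?andbT; last by move=> i _; rewrite mulr_ge0 ?rsq_ge0 // ltW.
  apply: contra v0 => /eqP/esym/eqP; rewrite psumr_eq0; last first.
    by move=> i _; rewrite mulr_ge0 ?rsq_ge0 // ltW.
  move=> /allP z; rewrite -[v]mulmx1 -(eigproj_sum A) mulmx_sumr big1 // => i _.
  apply: rsq_eq0; have /= := z i (mem_index_enum _).
  by rewrite mulf_eq0 gt_eqF //= => /eqP.
move=> i; have v0 : row i (spectralmx A) != 0.
  apply: contraTneq (oner_neq0 C) => v0; rewrite -(eigproj_tr A i) /eigproj v0.
  by rewrite mulmx0 mxtrace0 eqxx.
have := h _ v0.
have -> : row i (spectralmx A) *m A *m (row i (spectralmx A))^t*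
    = (\tr (eigproj A i *m A))%:M.
  by rewrite /eigproj -[in RHS]mulmxA mxtrace_mulC trace_mx11 -mx11_scalar.
rewrite (resolution_mull i (eig_resolution hA)) mxtraceZ eigproj_tr mulr1.
by rewrite mxE mulr1n (ltcR 0).
Qed.

Lemma full_densityP (A : M) : full_density A <-> pd A /\ \tr A = 1.
Proof.
split=> [[[[/hermP hA q] tA] rk]|[pA tA]].
  split=> //; split=> // i.
  set v := row i (spectralmx A).
  have vE : v *m A = (eigval A i)%:C *: v.
    have rA := eig_resolution hA; have := resolution_mull i rA.
    rewrite /eigproj -/v -mulmxA => /(congr1 (mulmx v)).
    have vv : v *m v^t* = 1%:M.
      rewrite [LHS]mx11_scalar; congr (_%:M).
      have /row_unitarymxP/(_ i i) := spectral_unitarymx A.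
      by rewrite dotmxE eqxx.
    by rewrite -scalemxAr !(mulmxA v (v^t*)) vv !mul1mx.
  have vv : v *m v^t* = 1%:M.
    rewrite [LHS]mx11_scalar; congr (_%:M).
    have /row_unitarymxP/(_ i i) := spectral_unitarymx A.
    by rewrite dotmxE eqxx.
  rewrite lt_neqAle; apply/andP; split.
    apply/eqP => e0; move: vE; rewrite -e0 scale0r => /eqP.
    rewrite mulmx_free_eq0; last by rewrite /row_free rk.
    move=> /eqP z; move: vv; rewrite z mul0mx => /matrixP/(_ 0 0)/eqP.
    by rewrite !mxE eqxx eq_sym oner_eq0.
  by have := q v; rewrite vE -scalemxAl vv mxE mxE mulr1 (lecR 0).
have [hA h] := (pdP A).1 pA; split.
  split=> //; split; first exact/hermP.
  move=> v; have [->|/h/ltW //] := eqVneq v 0.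
  by rewrite !mul0mx mxE.
apply/eqP/row_freeP.
exists (mxfun (fun x => x^-1) A).
rewrite -{1}(mxfun_id hA) mxfunM -(mxfun1 A); apply: eq_mxfun => i.
by rewrite divff // gt_eqF //; case: pA.
Qed.

Lemma pd_sandwich (S A : M) : S \in unitmx -> pd A -> pd (S *m A *m S^t*).
Proof.
move=> uS /pdP[hA h]; apply/pdP; split; first by rewrite !ctM trmxCK hA mulmxA.
move=> v v0; rewrite !mulmxA -mulmxA -ctM; apply: h.
apply: contra v0 => /eqP z.
by rewrite -[v](mulmxK uS) z mul0mx.
Qed.

Lemma pd_unit (A : M) : pd A -> A \in unitmx.
Proof.
move=> [hA h]; suff /mulmx1_unit[] : A *m mxfun (fun x => x^-1) A = 1%:M by [].
rewrite -{1}(mxfun_id hA) mxfunM -(mxfun1 A); apply: eq_mxfun => i.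
by rewrite divff // gt_eqF.
Qed.

Lemma mxpowD (A : M) s t : pd A -> mxpow A s *m mxpow A t = mxpow A (s + t).
Proof.
move=> [hA h]; rewrite /mxpow mxfunM; apply: eq_mxfun => i.
by rewrite powRD // (gt_eqF (h i)) implybT.
Qed.

Lemma mxpow0 (A : M) : mxpow A 0 = 1%:M.
Proof. by rewrite -(mxfun1 A); apply: eq_mxfun => i; rewrite powRr0. Qed.

Lemma mxpow1 (A : M) : pd A -> mxpow A 1 = A.
Proof.
by move=> [hA h]; rewrite -{2}(mxfun_id hA); apply: eq_mxfun => i; rewrite powRr1 // ltW.
Qed.

Lemma mxpowM (A : M) s t : pd A -> mxpow (mxpow A s) t = mxpow A (s * t).
Proof.
move=> [hA h]; rewrite /mxpow mxfun_comp //; apply: eq_mxfun => i /=.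
by rewrite powRrM.
Qed.

Lemma mxpow_ct (A : M) s : (mxpow A s)^t* = mxpow A s.
Proof. exact: mxfun_ct. Qed.

Lemma mxpow_unit (A : M) s : pd A -> mxpow A s \in unitmx.
Proof.
move=> pA; have := mxpowD s (- s) pA; rewrite subrr mxpow0.
by case/mulmx1_unit.
Qed.

End PositiveDefinite.

(** * Scalar divided differences *)

Section UnitAverage.
Variable R : realType.
Implicit Types f g : R -> R.

Local Notation mu := (@lebesgue_measure R).

Definition avg f : R := \int[mu]_(s in `[0, 1]) f s.

(** Serves as the integrability condition for [avg]: it is stable under differences, and it speaks
    only of the unit interval. *)
Definition lip01 (K : R) f := forall s t, 0 <= s <= 1 -> 0 <= t <= 1 ->
  `|f s - f t| <= K * `|s - t|.

Lemma lip_within (K a b : R) f :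
  (forall s t, a <= s <= b -> a <= t <= b -> `|f s - f t| <= K * `|s - t|) ->
  {within `[a, b], continuous f}.
Proof.
move=> h; apply/subspace_continuousP => x /=; rewrite in_itv /= => xab.
apply/cvgrPdist_le => e e0; rewrite near_withinE.
have K0 : 0 < `|K| + 1 by rewrite ltr_wpDl.
near=> y => /=; rewrite in_itv /= => yab.
apply: le_trans (h _ _ xab yab) _.
apply: (@le_trans _ _ ((`|K| + 1) * `|x - y|)).
  by rewrite ler_wpM2r // (le_trans (ler_norm _)) // lerDl.
rewrite mulrC -ler_pdivlMr //; near: y.
by apply: (@cvgr_dist_le _ _ _ (nbhs x) _ id x) => //; rewrite divr_gt0.
Unshelve. all: by end_near. Qed.

Lemma lip01_integrable K f : lip01 K f -> mu.-integrable `[0, 1] (EFin \o f).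
Proof.
move=> h; apply: continuous_compact_integrable; first exact: segment_compact.
exact: lip_within h.
Qed.

Lemma avgB K1 K2 f g : lip01 K1 f -> lip01 K2 g ->
  avg (fun s => f s - g s) = avg f - avg g.
Proof.
move=> hf hg; rewrite /avg RintegralB //; first exact: lip01_integrable hf.
exact: lip01_integrable hg.
Qed.

Lemma avgZ K c f : lip01 K f -> avg (fun s => c * f s) = c * avg f.
Proof. by move=> hf; rewrite /avg RintegralZl //; exact: lip01_integrable hf. Qed.

Lemma lip01B K1 K2 f g : lip01 K1 f -> lip01 K2 g ->
  lip01 (K1 + K2) (fun s => f s - g s).
Proof.
move=> hf hg s t hs ht; rewrite mulrDl.
have -> : f s - g s - (f t - g t) = (f s - f t) - (g s - g t) by ring.
by apply: le_trans (ler_normB _ _) _; rewrite lerD ?hf ?hg.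
Qed.

Lemma avg_cst c : avg (fun=> c) = c.
Proof.
rewrite /avg Rintegral_cst //= lebesgue_measure_itv /= lte01 /=.
by rewrite subr0 mulr1.
Qed.

Lemma lip01_cst c : lip01 0 (fun=> c).
Proof. by move=> s t _ _; rewrite subrr normr0 mul0r. Qed.

Lemma eq_avg f g : (forall s, 0 <= s <= 1 -> f s = g s) -> avg f = avg g.
Proof. by move=> h; apply: eq_Rintegral => s; rewrite inE /= in_itv /= => /h. Qed.

Lemma le_avg K1 K2 f g : lip01 K1 f -> lip01 K2 g ->
  (forall s, 0 <= s <= 1 -> f s <= g s) -> avg f <= avg g.
Proof.
move=> hf hg h; apply: le_Rintegral => //; first exact: lip01_integrable hf.
  exact: lip01_integrable hg.
Qed.

Lemma avg_bound K c f : lip01 K f ->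
  (forall s, 0 <= s <= 1 -> `|f s| <= c) -> `|avg f| <= c.
Proof.
move=> hf h; rewrite ler_norml; apply/andP; split.
  rewrite -[leLHS]avg_cst; apply: (le_avg (lip01_cst _) hf) => s /h.
  by rewrite ler_norml => /andP[].
rewrite -[leRHS]avg_cst; apply: (le_avg hf (lip01_cst _)) => s /h.
by rewrite ler_norml => /andP[].
Qed.

Lemma avg_derive K f g :
  (forall s : R, 0 <= s <= 1 -> is_derive s 1 f (g s)) -> lip01 K g ->
  avg g = f 1 - f 0.
Proof.
move=> fd gl.
have fc s : 0 <= s <= 1 -> {for s, continuous f}.
  move=> /fd h; apply: differentiable_continuous; apply/derivable1_diffP.
  exact: ex_derive.
have := @continuous_FTC2 R g f 0 1 ltr01 (lip_within gl).
rewrite /avg /Rintegral => ->.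
- by [].
- split.
  + move=> x; rewrite in_itv /= => /andP[x0 x1].
    have h := fd x; have {}h := h (_ : 0 <= x <= 1); apply: ex_derive.
    by apply: h; rewrite !ltW.
  + by apply: cvg_at_right_filter; apply: fc; rewrite lexx ler01.
  + by apply: cvg_at_left_filter; apply: fc; rewrite lexx ler01.
- move=> x; rewrite in_itv /= => /andP[x0 x1]; rewrite derive1E.
  have h := fd x; have {}h := h (_ : 0 <= x <= 1); apply: derive_val.
  by apply: h; rewrite !ltW.
Qed.

End UnitAverage.

Section DividedDifferences.
Variable R : realType.
Implicit Types f : R -> R.

Definition lipon (m b K : R) f := forall x y, m <= x <= b -> m <= y <= b ->
  `|f x - f y| <= K * `|x - y|.

(* For [f = w'] this is the divided difference [(w x - w y) / (x - y)], with no
   case distinction on the diagonal; [avg3] is the second one, for [f = w'']. *)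
Definition avg2 f (x y : R) : R := avg (fun s => f (y + s * (x - y))).

Definition avg3 f (x1 x2 y : R) : R :=
  avg (fun s => s * avg2 f (y + s * (x1 - y)) (y + s * (x2 - y))).

Lemma seg_in (m b x y s : R) : m <= x <= b -> m <= y <= b -> 0 <= s <= 1 ->
  m <= y + s * (x - y) <= b.
Proof. by move=> /andP[h1 h2] /andP[h3 h4] /andP[h5 h6]; apply/andP; split; nra. Qed.

Lemma seg_dist (x y x' y' s : R) : 0 <= s <= 1 ->
  `|y + s * (x - y) - (y' + s * (x' - y'))| <= `|x - x'| + `|y - y'|.
Proof.
move=> /andP[s0 s1].
have -> : y + s * (x - y) - (y' + s * (x' - y'))
   = s * (x - x') + (1 - s) * (y - y') by ring.
apply: le_trans (ler_normD _ _) _; rewrite !normrM (ger0_norm s0).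
rewrite (@ger0_norm _ (1 - s)) ?subr_ge0 //.
have := normr_ge0 (x - x'); have := normr_ge0 (y - y'); nra.
Qed.

Lemma lipon_seg (m b K : R) f (x y : R) : 0 <= K -> lipon m b K f ->
  m <= x <= b -> m <= y <= b ->
  lip01 (K * `|x - y|) (fun s => f (y + s * (x - y))).
Proof.
move=> K0 h hx hy s t hs ht; apply: le_trans (h _ _ _ _) _; rewrite ?seg_in //.
have -> : y + s * (x - y) - (y + t * (x - y)) = (x - y) * (s - t) by ring.
by rewrite normrM mulrA.
Qed.

Lemma avg2_lip (m b K : R) f (x y x' y' : R) : 0 <= K -> lipon m b K f ->
  m <= x <= b -> m <= y <= b -> m <= x' <= b -> m <= y' <= b ->
  `|avg2 f x y - avg2 f x' y'| <= K * (`|x - x'| + `|y - y'|).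
Proof.
move=> K0 h hx hy hx' hy'.
have l1 := lipon_seg K0 h hx hy; have l2 := lipon_seg K0 h hx' hy'.
rewrite /avg2 -(avgB l1 l2).
apply: (avg_bound (lip01B l1 l2)).
move=> s hs; apply: le_trans (h _ _ _ _) _; rewrite ?seg_in //.
by rewrite ler_wpM2l ?seg_dist.
Qed.

Lemma avg2_bound (m b K c : R) f (x y : R) : 0 <= K -> lipon m b K f ->
  (forall u, m <= u <= b -> `|f u| <= c) ->
  m <= x <= b -> m <= y <= b -> `|avg2 f x y| <= c.
Proof.
move=> K0 h hc hx hy; apply: (avg_bound (lipon_seg K0 h hx hy)) => s hs.
by apply: hc; rewrite seg_in.
Qed.

Lemma avg2_ge (m b K c : R) f (x y : R) : 0 <= K -> lipon m b K f ->
  (forall u, m <= u <= b -> c <= f u) ->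
  m <= x <= b -> m <= y <= b -> c <= avg2 f x y.
Proof.
move=> K0 h hc hx hy; rewrite -[leLHS]avg_cst.
apply: (le_avg (lip01_cst _) (lipon_seg K0 h hx hy)) => s hs.
by apply: hc; rewrite seg_in.
Qed.

Lemma avg2_xx f x : avg2 f x x = f x.
Proof.
rewrite /avg2 -[RHS]avg_cst; apply: eq_avg => s _.
by rewrite subrr mulr0 addr0.
Qed.

Lemma avg2_dd (m b K : R) f f' (x y : R) : 0 <= K -> lipon m b K f' ->
  (forall u : R, m <= u <= b -> is_derive u 1 f (f' u)) ->
  m <= x <= b -> m <= y <= b -> f x - f y = (x - y) * avg2 f' x y.
Proof.
move=> K0 h fd hx hy.
have l1 := lipon_seg K0 h hx hy.
rewrite -(avgZ (x - y) l1).
have -> : f x - f y = (fun s => f (y + s * (x - y))) 1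
                    - (fun s => f (y + s * (x - y))) 0.
  by rewrite /= mul1r mul0r addr0 subrKC.
apply/esym; apply: (@avg_derive _ (`|x - y| * (K * `|x - y|))
  (fun s => f (y + s * (x - y))) (fun s => (x - y) * f' (y + s * (x - y)))); last first.
  move=> s t hs ht; rewrite -mulrBr normrM -mulrA ler_wpM2l //; exact: l1.
move=> s hs.
have d1 : is_derive s 1 (fun s => y + s * (x - y)) (x - y).
  apply: is_derive_eq; rewrite /GRing.scale /=; ring.
have d2 := fd _ (seg_in hx hy hs).
have := @is_derive1_comp _ f (fun s => y + s * (x - y)) s _ _ d2 d1.
by move=> hc; apply: is_derive_eq; rewrite mulrC.
Qed.

Lemma avg3_lip01 (m b K : R) f (x1 x2 y : R) : 0 <= K -> lipon m b K f ->
  m <= x1 <= b -> m <= x2 <= b -> m <= y <= b ->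
  exists K', lip01 K' (fun s => s * avg2 f (y + s * (x1 - y)) (y + s * (x2 - y))).
Proof.
move=> K0 h h1 h2 hy.
pose g s := avg2 f (y + s * (x1 - y)) (y + s * (x2 - y)).
pose L := K * (`|x1 - y| + `|x2 - y|).
have gl : lip01 L g.
  move=> s t hs ht; apply: le_trans (avg2_lip K0 h _ _ _ _) _; rewrite ?seg_in //.
  rewrite /L -mulrA ler_wpM2l // mulrDl lerD //.
    have -> : y + s * (x1 - y) - (y + t * (x1 - y)) = (x1 - y) * (s - t) by ring.
    by rewrite normrM.
  have -> : y + s * (x2 - y) - (y + t * (x2 - y)) = (x2 - y) * (s - t) by ring.
  by rewrite normrM.
have L0 : 0 <= L by rewrite mulr_ge0 // addr_ge0.
exists (L + (`|g 0| + L)) => s t hs ht; rewrite -!/(g _).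
have -> : s * g s - t * g t = s * (g s - g t) + g t * (s - t) by ring.
apply: le_trans (ler_normD _ _) _; rewrite mulrDl !normrM lerD //.
  have /andP[s0 s1] := hs; rewrite (ger0_norm s0).
  have := gl s t hs ht; have := normr_ge0 (g s - g t); nra.
rewrite ler_wpM2r //.
have z : 0 <= (0 : R) <= 1 by rewrite lexx ler01.
have := gl t 0 ht z; rewrite subr0; have /andP[t0 t1] := ht.
rewrite (ger0_norm t0).
have := ler_normD (g 0) (g t - g 0); rewrite addrC subrK; nra.
Qed.

(** The factor 2 arises because [y] enters both arguments of the inner [avg2]; the weight [s <= 1]
    is bounded by 1. *)
Lemma avg3_lip (m b K : R) f (x1 x2 y x1' x2' y' : R) : 0 <= K -> lipon m b K f ->
  m <= x1 <= b -> m <= x2 <= b -> m <= y <= b ->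
  m <= x1' <= b -> m <= x2' <= b -> m <= y' <= b ->
  `|avg3 f x1 x2 y - avg3 f x1' x2' y'|
    <= 2 * K * (`|x1 - x1'| + `|x2 - x2'| + `|y - y'|).
Proof.
move=> K0 h h1 h2 hy h1' h2' hy'.
have [L1 l1] := avg3_lip01 K0 h h1 h2 hy.
have [L2 l2] := avg3_lip01 K0 h h1' h2' hy'.
rewrite /avg3 -(avgB l1 l2); apply: (avg_bound (lip01B l1 l2)).
move=> s hs; rewrite -mulrBr normrM; have /andP[s0 s1] := hs.
rewrite (ger0_norm s0).
set A := `|_ - _|.
apply: (@le_trans _ _ A); first by have := normr_ge0 (avg2 f (y + s * (x1 - y)) (y + s * (x2 - y)) - avg2 f (y' + s * (x1' - y')) (y' + s * (x2' - y'))); rewrite -/A; nra.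
apply: le_trans (avg2_lip K0 h _ _ _ _) _; rewrite ?seg_in //.
rewrite -mulrA mulrCA ler_wpM2l //.
have := seg_dist x1 y x1' y' hs; have := seg_dist x2 y x2' y' hs.
have := normr_ge0 (x1 - x1'); have := normr_ge0 (x2 - x2').
lra.
Qed.

Lemma avg3_bound (m b K c : R) f (x1 x2 y : R) : 0 <= K -> lipon m b K f ->
  (forall u, m <= u <= b -> `|f u| <= c) ->
  m <= x1 <= b -> m <= x2 <= b -> m <= y <= b -> `|avg3 f x1 x2 y| <= c.
Proof.
move=> K0 h hc h1 h2 hy; have [L l] := avg3_lip01 K0 h h1 h2 hy.
apply: (avg_bound l) => s hs; rewrite normrM.
have := avg2_bound K0 h hc (seg_in h1 hy hs) (seg_in h2 hy hs).
have /andP[s0 s1] := hs; rewrite (ger0_norm s0).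
set A := `|avg2 _ _ _|; have : 0 <= A by exact: normr_ge0.
nra.
Qed.

(** The integrands of the two averages are values of [f] at points that differ by [s (x1 - x2)].
    This explains the weight [s] in [avg3]. *)
Lemma avg3_dd (m b K K' : R) f f' (x1 x2 y : R) : 0 <= K -> lipon m b K f' ->
  0 <= K' -> lipon m b K' f ->
  (forall u : R, m <= u <= b -> is_derive u 1 f (f' u)) ->
  m <= x1 <= b -> m <= x2 <= b -> m <= y <= b ->
  avg2 f x1 y - avg2 f x2 y = (x1 - x2) * avg3 f' x1 x2 y.
Proof.
move=> K0 h K0' hf fd h1 h2 hy.
rewrite -(avgB (lipon_seg K0' hf h1 hy) (lipon_seg K0' hf h2 hy)).
have [L l] := avg3_lip01 K0 h h1 h2 hy.
rewrite -(avgZ _ l); apply: eq_avg => s hs.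
rewrite (avg2_dd K0 h fd (seg_in h1 hy hs) (seg_in h2 hy hs)); ring.
Qed.

End DividedDifferences.

(** * Divided differences of powers and the mean [theta] *)

Section PowerDividedDifferences.
Variable R : realType.

(** The power is monotone in a direction given by the sign of [r]; the sum of the endpoint values
    covers both cases. *)
Lemma powR_between (m b r x : R) : 0 < m -> m <= x <= b ->
  x `^ r <= m `^ r + b `^ r.
Proof.
move=> m0 /andP[mx xb]; have x0 := lt_le_trans m0 mx.
have [r0|/ltW r0] := leP 0 r.
  have : x `^ r <= b `^ r by rewrite ge0_ler_powR // nnegrE ltW // (lt_le_trans x0).
  by have := powR_ge0 m r; lra.
have : x `^ r <= m `^ r.
  rewrite -[r]opprK powRN [leRHS]powRN lef_pV2 ?posrE ?powR_gt0 //.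
  by rewrite ge0_ler_powR ?oppr_ge0 // nnegrE ltW.
by have := powR_ge0 b r; lra.
Qed.

Lemma powR_lipon (m b r : R) : 0 < m ->
  lipon m b (`|r| * (m `^ (r - 1) + b `^ (r - 1))) (fun x => x `^ r).
Proof.
move=> m0 x y hx hy; wlog xy : x y hx hy / x <= y.
  move=> H; have [|/ltW] := leP x y; first exact: H.
  by rewrite distrC [X in _ <= _ * X]distrC; exact: H.
have pd z : x <= z -> is_derive z 1 (fun x : R => x `^ r) (r * z `^ (r - 1)).
  by move=> xz; apply: is_derive1_powR; have /andP[h _] := hx; lra.
have [||c] := @MVT_segment R (fun x : R => x `^ r) (fun z => r * z `^ (r - 1)) x y xy.
- by move=> z; rewrite in_itv /= => /andP[/ltW h _]; exact: pd.
- apply/continuous_in_subspaceT => z; rewrite inE /= in_itv /= => /andP[h _].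
  apply: differentiable_continuous; apply/derivable1_diffP.
  have := pd z h => hh; exact: ex_derive.
rewrite in_itv /= => /andP[c1 c2] e; rewrite distrC [X in _ <= _ * X]distrC e normrM.
rewrite ler_wpM2r // normrM ler_wpM2l // ger0_norm ?powR_ge0 //.
by apply: powR_between => //; have /andP[? ?] := hx; have /andP[? ?] := hy; lra.
Qed.

Variable q : R.
Hypothesis q01 : 0 < q <= 1.

Definition pw1 (u : R) := q * u `^ (q - 1).
Definition pw2 (u : R) := q * (q - 1) * u `^ (q - 1 - 1).

Lemma lipon_scale (m b K c : R) (f : R -> R) : lipon m b K f ->
  lipon m b (`|c| * K) (fun u => c * f u).
Proof.
by move=> h x y hx hy; rewrite -mulrBr normrM -mulrA ler_wpM2l // h.
Qed.

Lemma pw1_lip (m b : R) : 0 < m -> exists2 K : R, 0 <= K & lipon m b K pw1.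
Proof.
move=> m0; exists (`|q| * (`|q - 1| * (m `^ (q - 1 - 1) + b `^ (q - 1 - 1)))); last first.
  have h := @powR_lipon m b (q - 1) m0; have := lipon_scale q h; exact.
by rewrite !mulr_ge0 // addr_ge0 ?powR_ge0.
Qed.

Lemma pw2_lip (m b : R) : 0 < m -> exists2 K : R, 0 <= K & lipon m b K pw2.
Proof.
move=> m0; exists (`|q * (q - 1)| * (`|q - 1 - 1| * (m `^ (q - 1 - 1 - 1) + b `^ (q - 1 - 1 - 1)))); last first.
  have h := @powR_lipon m b (q - 1 - 1) m0; have := lipon_scale (q * (q - 1)) h; exact.
by rewrite !mulr_ge0 // addr_ge0 ?powR_ge0.
Qed.

Lemma pw1_derive (u : R) : 0 < u -> is_derive u 1 pw1 (pw2 u).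
Proof.
move=> u0; have := is_derive1_powR (q - 1) u0 => h.
by apply: is_derive_eq; rewrite /pw2 /GRing.scale /= mulrA.
Qed.

(** First divided difference of [u |-> u^q]; [pd2] is the divided difference of [pd1] in its first
    argument. *)
Definition pd1 x y := avg2 pw1 x y.
Definition pd2 x1 x2 y := avg3 pw2 x1 x2 y.

Lemma pd1E (x y : R) : 0 < x -> 0 < y -> x `^ q - y `^ q = (x - y) * pd1 x y.
Proof.
move=> x0 y0; pose m := Num.min x y; pose b := Num.max x y.
have m0 : 0 < m by rewrite lt_min x0.
have [K K0 h] := pw1_lip b m0.
apply: (@avg2_dd _ m b K (fun x : R => x `^ q)) => //.
- by move=> u /andP[hu _]; apply: is_derive1_powR; exact: lt_le_trans hu.
- by rewrite /m /b ge_min lexx le_max lexx.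
- by rewrite /m /b ge_min lexx orbT le_max lexx orbT.
Qed.

Lemma pd2E (x1 x2 y : R) : 0 < x1 -> 0 < x2 -> 0 < y ->
  pd1 x1 y - pd1 x2 y = (x1 - x2) * pd2 x1 x2 y.
Proof.
move=> x0 z0 y0; pose m := Num.min (Num.min x1 x2) y.
pose b := Num.max (Num.max x1 x2) y.
have m0 : 0 < m by rewrite !lt_min x0 z0.
have [K K0 h] := pw1_lip b m0.
have [K' K0' h'] := pw2_lip b m0.
apply: (@avg3_dd _ m b K' K) => //.
- by move=> u /andP[hu _]; apply: pw1_derive; exact: lt_le_trans hu.
- by rewrite /m /b !ge_min lexx !le_max lexx.
- by rewrite /m /b !ge_min lexx !le_max lexx !orbT.
- by rewrite /m /b !ge_min lexx !le_max lexx !orbT.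
Qed.

Lemma pd1_lip (m b : R) : 0 < m -> exists2 K : R, 0 <= K & forall x y x' y',
  m <= x <= b -> m <= y <= b -> m <= x' <= b -> m <= y' <= b ->
  `|pd1 x y - pd1 x' y'| <= K * (`|x - x'| + `|y - y'|).
Proof.
move=> m0; have [K K0 h] := pw1_lip b m0; exists K => // x y x' y'.
exact: avg2_lip.
Qed.

Lemma pd2_lip (m b : R) : 0 < m -> exists2 K : R, 0 <= K & forall x1 x2 y x1' x2' y',
  m <= x1 <= b -> m <= x2 <= b -> m <= y <= b ->
  m <= x1' <= b -> m <= x2' <= b -> m <= y' <= b ->
  `|pd2 x1 x2 y - pd2 x1' x2' y'|
    <= K * (`|x1 - x1'| + `|x2 - x2'| + `|y - y'|).
Proof.
move=> m0; have [K K0 h] := pw2_lip b m0; exists (2 * K); first by rewrite mulr_ge0.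
by move=> x1 x2 y x1' x2' y'; exact: avg3_lip.
Qed.

Lemma pd2_bound (m b : R) : 0 < m -> exists2 K : R, 0 <= K & forall x1 x2 y,
  m <= x1 <= b -> m <= x2 <= b -> m <= y <= b -> `|pd2 x1 x2 y| <= K.
Proof.
move=> m0; have [K K0 h] := pw2_lip b m0.
exists (`|q * (q - 1)| * (m `^ (q - 1 - 1) + b `^ (q - 1 - 1))).
  by rewrite mulr_ge0 // addr_ge0 ?powR_ge0.
move=> x1 x2 y h1 h2 hy; apply: (avg3_bound K0 h) => // u hu.
by rewrite normrM ler_wpM2l // ger0_norm ?powR_ge0 // powR_between.
Qed.

Lemma pd1_bound (m b : R) : 0 < m -> exists2 K : R, 0 <= K & forall x y,
  m <= x <= b -> m <= y <= b -> `|pd1 x y| <= K.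
Proof.
move=> m0; have [K K0 h] := pw1_lip b m0.
exists (`|q| * (m `^ (q - 1) + b `^ (q - 1))).
  by rewrite mulr_ge0 // addr_ge0 ?powR_ge0.
move=> x y h1 hy; apply: (avg2_bound K0 h) => // u hu.
by rewrite normrM ler_wpM2l // ger0_norm ?powR_ge0 // powR_between.
Qed.

(** The derivative [q u^(q-1)] is nonincreasing as [q <= 1], so its mean is at least its value at
    [b], however close [x] and [y] are to 0. *)
Lemma pd1_ge (b x y : R) : 0 < x <= b -> 0 < y <= b -> q * b `^ (q - 1) <= pd1 x y.
Proof.
move=> /andP[x0 xb] /andP[y0 yb]; pose m := Num.min x y.
have m0 : 0 < m by rewrite lt_min x0.
have [K K0 h] := pw1_lip b m0.
have /andP[q0 q1] := q01.
apply: (avg2_ge K0 h).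
- move=> u /andP[mu ub]; rewrite /pw1 ler_pM2l //.
  have u0 := lt_le_trans m0 mu.
  rewrite -opprB !powRN lef_pV2 ?posrE ?powR_gt0 //; last lra.
  by rewrite ge0_ler_powR ?subr_ge0 // nnegrE ltW // (lt_le_trans u0).
- by rewrite /m ge_min lexx.
- by rewrite /m ge_min lexx orbT.
Qed.

Lemma pd1_gt0 (x y : R) : 0 < x -> 0 < y -> 0 < pd1 x y.
Proof.
move=> x0 y0; have /andP[q0 q1] := q01.
apply: lt_le_trans (@pd1_ge (Num.max x y) _ _ _ _).
- by rewrite mulr_gt0 // powR_gt0 // lt_max x0.
- by rewrite x0 le_max lexx.
- by rewrite y0 le_max lexx orbT.
Qed.

Lemma pd1C (x y : R) : 0 < x -> 0 < y -> pd1 x y = pd1 y x.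
Proof.
move=> x0 y0; have [->//|ne] := eqVneq x y.
have := pd1E x0 y0; have := pd1E y0 x0 => e1 e2.
have ne' : x - y != 0 by rewrite subr_eq0.
apply: (mulfI ne'); rewrite -e2 -opprB e1; ring.
Qed.

(** One formula for both branches of [theta]: on the diagonal [pd1 x x] is the derivative itself. *)
Lemma thetaE (x y : R) : 0 < x -> 0 < y -> theta (q + 1) x y = q / pd1 x y.
Proof.
move=> x0 y0; have /andP[q0 q1] := q01; rewrite /theta.
have -> : q + 1 - 1 = q by ring.
case: eqP => [->|/eqP ne].
  rewrite /pd1 avg2_xx /pw1 invfM mulrA divff ?gt_eqF // mul1r -powRN.
  by congr (_ `^ _); ring.
have ne' : x - y != 0 by rewrite subr_eq0.
have p0 := pd1_gt0 x0 y0.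
by rewrite (pd1E x0 y0) invfM [X in q * X]mulrA divff // mul1r.
Qed.

End PowerDividedDifferences.

(** * Two-sided functional calculus *)

Section BoundedLipschitz.
Variables (R : realType) (m b : R).
Implicit Types psi : R -> R -> R -> R.

(** Bounded and Lipschitz symbols. Three arguments are kept even for symbols of two variables, since
    double sums are treated as triple ones. *)
Definition BL psi := exists2 K : R, 0 <= K &
  (forall x y z, m <= x <= b -> m <= y <= b -> m <= z <= b ->
     `|psi x y z| <= K) /\
  (forall x y z x' y' z', m <= x <= b -> m <= y <= b -> m <= z <= b ->
     m <= x' <= b -> m <= y' <= b -> m <= z' <= b ->
     `|psi x y z - psi x' y' z'| <= K * (`|x - x'| + `|y - y'| + `|z - z'|)).

Lemma BL_mul psi1 psi2 : BL psi1 -> BL psi2 ->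
  BL (fun x y z => psi1 x y z * psi2 x y z).
Proof.
move=> [K K0 [b1 l1]] [L L0 [b2 l2]]; exists (K * L + K * L).
  by rewrite addr_ge0 // mulr_ge0.
have KL : 0 <= K * L by rewrite mulr_ge0.
split=> [x y z hx hy hz|x y z x' y' z' hx hy hz hx' hy' hz'].
  rewrite normrM; have := ler_pM _ _ (b1 x y z hx hy hz) (b2 x y z hx hy hz).
  by move=> /(_ (normr_ge0 _) (normr_ge0 _)); lra.
have -> : psi1 x y z * psi2 x y z - psi1 x' y' z' * psi2 x' y' z' =
  psi1 x y z * (psi2 x y z - psi2 x' y' z')
  + psi2 x' y' z' * (psi1 x y z - psi1 x' y' z') by ring.
apply: le_trans (ler_normD _ _) _; rewrite mulrDl lerD // normrM.
  by rewrite -mulrA ler_pM // ?b1 ?l2.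
by rewrite [K * L]mulrC -mulrA ler_pM // ?b2 ?l1.
Qed.

Lemma BL_scale c psi : BL psi -> BL (fun x y z => c * psi x y z).
Proof.
move=> [K K0 [b1 l1]]; exists (`|c| * K); first by rewrite mulr_ge0.
split=> [x y z hx hy hz|x y z x' y' z' hx hy hz hx' hy' hz'].
  by rewrite normrM ler_wpM2l // b1.
by rewrite -mulrBr normrM -mulrA ler_wpM2l // l1.
Qed.

Lemma BL_inv c psi : 0 < c ->
  (forall x y z, m <= x <= b -> m <= y <= b -> m <= z <= b -> c <= psi x y z) ->
  BL psi -> BL (fun x y z => (psi x y z)^-1).
Proof.
move=> c0 hc [K K0 [b1 l1]]; exists (c^-1 + K * c^-1 ^+ 2).
  by rewrite addr_ge0 ?invr_ge0 ?(ltW c0) // mulr_ge0 ?sqr_ge0.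
have ib x y z : m <= x <= b -> m <= y <= b -> m <= z <= b ->
   0 < (psi x y z)^-1 <= c^-1.
  move=> hx hy hz; have h := hc x y z hx hy hz.
  have h0 := lt_le_trans c0 h.
  by rewrite invr_gt0 h0 /= lef_pV2 ?posrE.
split=> [x y z hx hy hz|x y z x' y' z' hx hy hz hx' hy' hz'].
  have /andP[h1 h2] := ib x y z hx hy hz; rewrite ger0_norm ?(ltW h1) //.
  by rewrite (le_trans h2) // lerDl mulr_ge0 ?sqr_ge0.
have /andP[i1 i2] := ib x y z hx hy hz.
have /andP[j1 j2] := ib x' y' z' hx' hy' hz'.
have p1 : psi x y z != 0 by rewrite -invr_eq0 gt_eqF.
have p2 : psi x' y' z' != 0 by rewrite -invr_eq0 gt_eqF.
have -> : (psi x y z)^-1 - (psi x' y' z')^-1 =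
   (psi x' y' z' - psi x y z) * ((psi x y z)^-1 * (psi x' y' z')^-1).
  by field; rewrite p1 p2.
rewrite normrM distrC; have l := l1 x y z x' y' z' hx hy hz hx' hy' hz'.
have : `|(psi x y z)^-1 * (psi x' y' z')^-1| <= c^-1 ^+ 2.
  by rewrite normrM !gtr0_norm // expr2 ler_pM // ltW.
move=> /(ler_pM (normr_ge0 _) (normr_ge0 _) l) /le_trans -> //.
by rewrite mulrDl mulrAC lerDr mulr_ge0 ?invr_ge0 ?(ltW c0) // !addr_ge0.
Qed.

Lemma BL_ext psi1 psi2 :
  (forall x y z, m <= x <= b -> m <= y <= b -> m <= z <= b ->
     psi1 x y z = psi2 x y z) -> BL psi1 -> BL psi2.
Proof.
move=> e [K K0 [b1 l1]]; exists K => //.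
split=> [x y z hx hy hz|x y z x' y' z' hx hy hz hx' hy' hz'].
  by rewrite -e // b1.
by rewrite -!e // l1.
Qed.

End BoundedLipschitz.

(** * Divided differences of the symbol of the metric *)

Section ThetaDividedDifferences.
Variables (R : realType) (q a b : R).
Hypotheses (q01 : 0 < q <= 1) (a0 : 0 < a) (b0 : 0 < b).

(** The scalings [a] and [b] take up the two exponential weights of [bracket], so that both matrix
    arguments become the same. *)
Definition tht (x y : R) := theta (q + 1) (a * x) (b * y).
(* Divided differences of [tht] in its first and in its second argument. *)
Definition tht1 (x1 x2 y : R) :=
  - (a / q) * (tht x1 y * tht x2 y * pd2 q (a * x1) (a * x2) (b * y)).
Definition tht2 (x y1 y2 : R) :=
  - (b / q) * (tht x y1 * tht x y2 * pd2 q (b * y1) (b * y2) (a * x)).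

Lemma thtE (x y : R) : 0 < x -> 0 < y -> tht x y = q * (pd1 q (a * x) (b * y))^-1.
Proof. by move=> x0 y0; rewrite /tht thetaE // mulr_gt0. Qed.

Lemma tht_gt0 (x y : R) : 0 < x -> 0 < y -> 0 < tht x y.
Proof.
move=> x0 y0; rewrite thtE // mulr_gt0 ?invr_gt0 ?pd1_gt0 ?mulr_gt0 //.
by case/andP: q01.
Qed.

(** The divided difference of a reciprocal is minus that of the function times the two reciprocals;
    hence the shape of [tht1] and [tht2]. *)
Lemma inv_diff (c x y z u v w : R) : 0 < c -> 0 < u -> 0 < v ->
  u - v = z * (x - y) * w ->
  c * u^-1 - c * v^-1 = - (z / c) * (c * u^-1 * (c * v^-1) * w) * (x - y).
Proof.
move=> c0 u0 v0 e.
have -> : c * u^-1 - c * v^-1 = - c * (u - v) * (u^-1 * v^-1).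
  by field; rewrite !gt_eqF.
by rewrite e; field; rewrite !gt_eqF.
Qed.

Lemma tht1E (x1 x2 y : R) : 0 < x1 -> 0 < x2 -> 0 < y ->
  tht x1 y - tht x2 y = tht1 x1 x2 y * (x1 - x2).
Proof.
move=> p1 p2 p3; rewrite /tht1 !thtE //.
have e := pd2E q (mulr_gt0 a0 p1) (mulr_gt0 a0 p2) (mulr_gt0 b0 p3).
rewrite -mulrBr in e.
by apply: inv_diff => //; rewrite ?pd1_gt0 ?mulr_gt0 //; case/andP: q01.
Qed.

Lemma tht2E (x y1 y2 : R) : 0 < x -> 0 < y1 -> 0 < y2 ->
  tht x y1 - tht x y2 = tht2 x y1 y2 * (y1 - y2).
Proof.
move=> p1 p2 p3; rewrite /tht2 !thtE //.
rewrite ![pd1 q (a * x) _]pd1C ?mulr_gt0 //.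
have e := pd2E q (mulr_gt0 b0 p2) (mulr_gt0 b0 p3) (mulr_gt0 a0 p1).
rewrite -mulrBr in e.
by apply: inv_diff => //; rewrite ?pd1_gt0 ?mulr_gt0 //; case/andP: q01.
Qed.

Variables (m M : R).
Hypotheses (m0 : 0 < m) (mM : m <= M).

(** [[lo, hi]] contains both [a x] and [b x] for [x] in [[m, M]]: one interval for the differently
    scaled arguments of [pd1] and [pd2]. *)
Let lo := Num.min a b * m.
Let hi := Num.max a b * M.

Let lo0 : 0 < lo. Proof. by rewrite mulr_gt0 // lt_min a0. Qed.

Let in_a (x : R) : m <= x <= M -> lo <= a * x <= hi.
Proof.
move=> /andP[h1 h2]; have x0 := lt_le_trans m0 h1.
have M0 := lt_le_trans x0 h2.
apply/andP; split.
  by apply: (@le_trans _ _ (a * m)); rewrite ?ler_pM2l // ler_pM2r // ge_min lexx.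
by apply: (@le_trans _ _ (a * M)); rewrite ?ler_pM2l // ler_pM2r // le_max lexx.
Qed.

Let in_b (x : R) : m <= x <= M -> lo <= b * x <= hi.
Proof.
move=> /andP[h1 h2]; have x0 := lt_le_trans m0 h1.
have M0 := lt_le_trans x0 h2.
apply/andP; split.
  by apply: (@le_trans _ _ (b * m)); rewrite ?ler_pM2l // ler_pM2r // ge_min lexx orbT.
by apply: (@le_trans _ _ (b * M)); rewrite ?ler_pM2l // ler_pM2r // le_max lexx orbT.
Qed.

Let M0 : 0 < M := lt_le_trans m0 mM.

Lemma norm_scale (c x y : R) : 0 < c -> `|c * x - c * y| = c * `|x - y|.
Proof. by move=> c0; rewrite -mulrBr normrM gtr0_norm. Qed.

Lemma tht_BL : BL m M (fun x y _ => tht x y).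
Proof.
apply: (@BL_ext _ _ _ (fun x y _ => q * (pd1 q (a * x) (b * y))^-1)).
  by move=> x y z /andP[/(lt_le_trans m0) h _] /andP[/(lt_le_trans m0) h' _] _; rewrite thtE.
apply: BL_scale; apply: (@BL_inv _ _ _ (q * hi `^ (q - 1))).
- rewrite mulr_gt0 ?powR_gt0 ?mulr_gt0 ?lt_max ?a0 //; by case/andP: q01.
- move=> x y z hx hy _; apply: pd1_ge => //.
    have /andP[h1 ->] := in_a hx; by rewrite (lt_le_trans lo0 h1).
  have /andP[h1 ->] := in_b hy; by rewrite (lt_le_trans lo0 h1).
have [K K0 h] := pd1_lip q hi lo0; have [L L0 h'] := pd1_bound q hi lo0.
exists (K * (a + b) + L).
  by rewrite addr_ge0 // mulr_ge0 // addr_ge0 // ltW.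
have Kab : 0 <= K * (a + b) by rewrite mulr_ge0 // addr_ge0 // ltW.
split=> [x y z hx hy hz|x y z x' y' z' hx hy hz hx' hy' hz'].
  by apply: le_trans (h' _ _ (in_a hx) (in_b hy)) _; rewrite lerDr.
apply: le_trans (h _ _ _ _ (in_a hx) (in_b hy) (in_a hx') (in_b hy')) _.
rewrite !norm_scale //.
have := normr_ge0 (x - x'); have := normr_ge0 (y - y'); have := normr_ge0 (z - z').
move: `|x - x'| `|y - y'| `|z - z'| => u v w w0 v0 u0.
apply: (@le_trans _ _ (K * (a + b) * (u + v + w))).
  rewrite -mulrA ler_wpM2l //; have := a0; have := b0; nra.
by rewrite ler_wpM2r ?lerDl // !addr_ge0.
Qed.

Lemma BL_swap12 psi : BL m M psi -> BL m M (fun x y z => psi y x z).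
Proof.
move=> [K K0 [h1 h2]]; exists K => //; split=> [*|x y z x' y' z' *]; first exact: h1.
by rewrite [`|x - x'| + _]addrC; exact: h2.
Qed.

Lemma BL_swap23 psi : BL m M psi -> BL m M (fun x y z => psi x z y).
Proof.
move=> [K K0 [h1 h2]]; exists K => //; split=> [*|x y z x' y' z' *]; first exact: h1.
by rewrite addrAC; exact: h2.
Qed.

Lemma pd2_BL c1 c2 : 0 < c1 -> 0 < c2 ->
  (forall x : R, m <= x <= M -> lo <= c1 * x <= hi) ->
  (forall x : R, m <= x <= M -> lo <= c2 * x <= hi) ->
  BL m M (fun x1 x2 y => pd2 q (c1 * x1) (c1 * x2) (c2 * y)).
Proof.
move=> c10 c20 i1 i2.
have [K K0 h] := pd2_lip q hi lo0; have [L L0 h'] := pd2_bound q hi lo0.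
have Kc : 0 <= K * (c1 + c2) by rewrite mulr_ge0 // addr_ge0 // ltW.
exists (K * (c1 + c2) + L); first by rewrite addr_ge0.
split=> [x y z hx hy hz|x y z x' y' z' hx hy hz hx' hy' hz'].
  by apply: le_trans (h' _ _ _ (i1 _ hx) (i1 _ hy) (i2 _ hz)) _; rewrite lerDr.
apply: le_trans (h _ _ _ _ _ _ (i1 _ hx) (i1 _ hy) (i2 _ hz) (i1 _ hx') (i1 _ hy') (i2 _ hz')) _.
rewrite !norm_scale //.
have := normr_ge0 (x - x'); have := normr_ge0 (y - y'); have := normr_ge0 (z - z').
move: `|x - x'| `|y - y'| `|z - z'| => u v w w0 v0 u0.
apply: (@le_trans _ _ (K * (c1 + c2) * (u + v + w))).
  rewrite -mulrA ler_wpM2l //; nra.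
by rewrite ler_wpM2r ?lerDl // !addr_ge0.
Qed.

Lemma tht1_BL : BL m M tht1.
Proof.
apply: BL_scale; apply: BL_mul; last exact: pd2_BL.
apply: BL_mul; first by have := BL_swap23 tht_BL.
by have := BL_swap12 (BL_swap23 tht_BL).
Qed.

Lemma tht2_BL : BL m M tht2.
Proof.
apply: BL_scale; apply: BL_mul.
  by apply: BL_mul; [exact: tht_BL|have := BL_swap23 tht_BL].
have h := pd2_BL b0 a0 in_b in_a.
by have := BL_swap12 (BL_swap23 h).
Qed.

Lemma pd1_BL : BL m M (fun x y _ => pd1 q x y).
Proof.
have [K K0 h] := pd1_lip q M m0; have [L L0 h'] := pd1_bound q M m0.
exists (K + L); first by rewrite addr_ge0.
split=> [x y z hx hy hz|x y z x' y' z' hx hy hz hx' hy' hz'].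
  by apply: le_trans (h' _ _ hx hy) _; rewrite lerDr.
apply: le_trans (h _ _ _ _ hx hy hx' hy') _.
have := normr_ge0 (x - x'); have := normr_ge0 (y - y'); have := normr_ge0 (z - z').
nra.
Qed.

End ThetaDividedDifferences.

(** * Double and triple operator sums *)

HB.lock Definition eproj (R : realType) (d : nat) (A : 'M[R[i]]_d) (i : 'I_d) :=
  eigproj A i.

(** Finite-dimensional double operator integral with symbol [f]; [Op3] is the triple one. *)
HB.lock Definition Op2 (R : realType) (d : nat) (f : R -> R -> R)
    (Y Z X : 'M[R[i]]_d) : 'M[R[i]]_d :=
  \sum_i \sum_k (f (eigval Y i) (eigval Z k))%:C *:
    (eproj Y i *m X *m eproj Z k).

HB.lock Definition Op3 (R : realType) (d : nat) (psi : R -> R -> R -> R)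
    (Y Z W X1 X2 : 'M[R[i]]_d) : 'M[R[i]]_d :=
  \sum_i \sum_j \sum_k (psi (eigval Y i) (eigval Z j) (eigval W k))%:C *:
    (eproj Y i *m X1 *m eproj Z j *m X2 *m eproj W k).

Section TripleOperator.
Variables (R : realType) (d : nat).
Local Notation C := R[i].
Local Notation M := 'M[C]_d.

Lemma mxfunE (f : R -> R) (Y : M) :
  mxfun f Y = \sum_i (f (eigval Y i))%:C *: eproj Y i.
Proof. by rewrite eproj.unlock. Qed.

Lemma eproj_resolution (A : M) : A^t* = A -> resolution A (eigval A) (eproj A).
Proof. by rewrite eproj.unlock; exact: eig_resolution. Qed.

Lemma eproj_mul (A : M) i j :
  eproj A i *m eproj A j = if i == j then eproj A i else 0.
Proof. by rewrite eproj.unlock eigproj_mul. Qed.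

Lemma eproj_ct (A : M) i : (eproj A i)^t* = eproj A i.
Proof. by rewrite eproj.unlock eigproj_ct. Qed.

Lemma eproj_sum (A : M) : \sum_i eproj A i = 1%:M.
Proof. by rewrite eproj.unlock eigproj_sum. Qed.

Lemma sum3_le (F : 'I_d -> 'I_d -> 'I_d -> R) K :
  (forall i j k, F i j k <= K) ->
  \sum_i \sum_j \sum_k F i j k <= d%:R * (d%:R * d%:R * K).
Proof.
move=> h; apply: (@le_trans _ _ (\sum_(i < d) (d%:R * d%:R * K))).
  by apply: ler_sum => i _; apply: sum2_le => j k; exact: h.
by rewrite sumr_const card_ord -[leLHS]mulr_natl.
Qed.

Lemma eproj_nrm (A : M) i : nrm (eproj A i) <= cproj R d.
Proof. by apply: proj_nrm; rewrite ?eproj_mul ?eqxx ?eproj_ct. Qed.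

Lemma nrm5 (A B D E F : M) a b c x y : nrm A <= a -> nrm B <= b -> nrm D <= c ->
  nrm E <= x -> nrm F <= y -> nrm (A *m B *m D *m E *m F) <= a * b * c * x * y.
Proof.
move=> h1 h2 h3 h4 h5.
have g0 (X : M) z : nrm X <= z -> 0 <= z by apply: le_trans; exact: nrm_ge0.
do 4 (apply: le_trans (nrmM _ _) _; apply: ler_pM; rewrite ?nrm_ge0 //).
Qed.

Lemma Op3_bound (m b : R) psi : BL m b psi -> exists2 K : R, 0 <= K &
  forall (Y Z W X1 X2 : M), box m b Y -> box m b Z -> box m b W ->
   nrm (Op3 psi Y Z W X1 X2) <= K * nrm X1 * nrm X2.
Proof.
rewrite Op3.unlock => -[K K0 [hb _]]; have c0 := cproj_ge0 R d.
exists (d%:R * (d%:R * d%:R * (K * (cproj R d * cproj R d * cproj R d)))).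
  by rewrite !mulr_ge0.
move=> Y Z W X1 X2 [_ bY] [_ bZ] [_ bW].
apply: le_trans (nrm_sum _ _ _) _.
apply: (@le_trans _ _ (\sum_i \sum_j \sum_k
   nrm ((psi (eigval Y i) (eigval Z j) (eigval W k))%:C *:
    (eproj Y i *m X1 *m eproj Z j *m X2 *m eproj W k)))).
  apply: ler_sum => i _; apply: le_trans (nrm_sum _ _ _) _.
  by apply: ler_sum => j _; exact: nrm_sum.
apply: le_trans (sum3_le (K := K * (cproj R d * cproj R d * cproj R d) * nrm X1 * nrm X2) _) _.
  move=> i j k; rewrite nrmZr.
  have h := nrm5 (eproj_nrm Y i) (lexx (nrm X1)) (eproj_nrm Z j) (lexx (nrm X2)) (eproj_nrm W k).
  have := ler_pM (normr_ge0 _) (nrm_ge0 _) (hb _ _ _ (bY i) (bZ j) (bW k)) h.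
  move=> /le_trans -> //; rewrite le_eqVlt; apply/orP; left; apply/eqP; ring.
by rewrite le_eqVlt; apply/orP; left; apply/eqP; ring.
Qed.

Lemma sumdiff1 (f g : 'I_d -> R) (E F : 'I_d -> M) (A B : M) :
  \sum_i (f i)%:C *: (A *m E i *m B) - \sum_i (g i)%:C *: (A *m F i *m B)
  = A *m (\sum_i (f i)%:C *: E i - \sum_i (g i)%:C *: F i) *m B.
Proof.
rewrite mulmxBr mulmxBl !mulmx_sumr !mulmx_suml; congr (_ - _);
  by apply: eq_bigr => i _; rewrite -scalemxAr -scalemxAl.
Qed.

Definition clip3 : R := d%:R * d%:R * (clip R d * (cproj R d * cproj R d)).

Lemma clip3_ge0 : 0 <= clip3.
Proof. by rewrite !mulr_ge0 ?clip_ge0 ?cproj_ge0. Qed.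

Lemma sum2_slot (F G : 'I_d -> 'I_d -> M) K :
  (forall j k, nrm (F j k - G j k) <= K) ->
  nrm (\sum_j \sum_k F j k - \sum_j \sum_k G j k) <= d%:R * d%:R * K.
Proof.
move=> h; rewrite -sumrB; apply: le_trans (nrm_sum _ _ _) _.
apply: le_trans (sum2_le h); apply: ler_sum => j _.
by rewrite -sumrB; exact: nrm_sum.
Qed.

(** With the other two eigenvalues frozen, the inner sum over [i] is a one-variable functional
    calculus, to which [resolution_lip] applies. *)
Lemma Op3_slot1 (m b K : R) psi (Y Y' Z W X1 X2 : M) : 0 <= K ->
  (forall x x' y z, m <= x <= b -> m <= x' <= b -> m <= y <= b -> m <= z <= b ->
     `|psi x y z - psi x' y z| <= K * `|x - x'|) ->
  box m b Y -> box m b Y' -> box m b Z -> box m b W ->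
  nrm (Op3 psi Y' Z W X1 X2 - Op3 psi Y Z W X1 X2)
    <= clip3 * K * nrm (Y' - Y) * nrm X1 * nrm X2.
Proof.
move=> K0 h [hY bY] [hY' bY'] [hZ bZ] [hW bW].
have -> : clip3 * K * nrm (Y' - Y) * nrm X1 * nrm X2 =
   d%:R * d%:R * ((clip R d * K * nrm (Y' - Y)) * nrm X1 * cproj R d * nrm X2 * cproj R d).
  by rewrite /clip3; ring.
have ex (A : M) : Op3 psi A Z W X1 X2 = \sum_j \sum_k
   \sum_i (psi (eigval A i) (eigval Z j) (eigval W k))%:C *:
    (1%:M *m eproj A i *m (X1 *m eproj Z j *m X2 *m eproj W k)).
  rewrite Op3.unlock exchange_big; apply: eq_bigr => j _; rewrite exchange_big.
  apply: eq_bigr => k _; apply: eq_bigr => i _.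
  by rewrite mul1mx !mulmxA.
rewrite !ex; apply: sum2_slot => j k; rewrite sumdiff1 mul1mx !mulmxA.
apply: nrm5; rewrite ?eproj_nrm //.
apply: (resolution_lip (eproj_resolution hY') (eproj_resolution hY) K0) => i l.
exact: h.
Qed.

Lemma Op3_slot2 (m b K : R) psi (Y Z Z' W X1 X2 : M) : 0 <= K ->
  (forall x y y' z, m <= x <= b -> m <= y <= b -> m <= y' <= b -> m <= z <= b ->
     `|psi x y z - psi x y' z| <= K * `|y - y'|) ->
  box m b Y -> box m b Z -> box m b Z' -> box m b W ->
  nrm (Op3 psi Y Z' W X1 X2 - Op3 psi Y Z W X1 X2)
    <= clip3 * K * nrm (Z' - Z) * nrm X1 * nrm X2.
Proof.
move=> K0 h [hY bY] [hZ bZ] [hZ' bZ'] [hW bW].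
have -> : clip3 * K * nrm (Z' - Z) * nrm X1 * nrm X2 =
   d%:R * d%:R * (cproj R d * nrm X1 * (clip R d * K * nrm (Z' - Z)) * nrm X2 * cproj R d).
  by rewrite /clip3; ring.
have ex (A : M) : Op3 psi Y A W X1 X2 = \sum_i \sum_k
   \sum_j (psi (eigval Y i) (eigval A j) (eigval W k))%:C *:
    (eproj Y i *m X1 *m eproj A j *m (X2 *m eproj W k)).
  rewrite Op3.unlock; apply: eq_bigr => i _; rewrite exchange_big.
  apply: eq_bigr => k _; apply: eq_bigr => j _.
  by rewrite !mulmxA.
rewrite !ex; apply: sum2_slot => i k; rewrite sumdiff1 !mulmxA.
apply: nrm5; rewrite ?eproj_nrm //.
apply: (resolution_lip (eproj_resolution hZ') (eproj_resolution hZ) K0) => j l.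
exact: h.
Qed.

Lemma Op3_slot3 (m b K : R) psi (Y Z W W' X1 X2 : M) : 0 <= K ->
  (forall x y z z', m <= x <= b -> m <= y <= b -> m <= z <= b -> m <= z' <= b ->
     `|psi x y z - psi x y z'| <= K * `|z - z'|) ->
  box m b Y -> box m b Z -> box m b W -> box m b W' ->
  nrm (Op3 psi Y Z W' X1 X2 - Op3 psi Y Z W X1 X2)
    <= clip3 * K * nrm (W' - W) * nrm X1 * nrm X2.
Proof.
move=> K0 h [hY bY] [hZ bZ] [hW bW] [hW' bW'].
have -> : clip3 * K * nrm (W' - W) * nrm X1 * nrm X2 =
   d%:R * d%:R * (cproj R d * nrm X1 * cproj R d * nrm X2 * (clip R d * K * nrm (W' - W))).
  by rewrite /clip3; ring.
have ex (A : M) : Op3 psi Y Z A X1 X2 = \sum_i \sum_j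
   \sum_k (psi (eigval Y i) (eigval Z j) (eigval A k))%:C *:
    (eproj Y i *m X1 *m eproj Z j *m X2 *m eproj A k *m 1%:M).
  rewrite Op3.unlock; apply: eq_bigr => i _; apply: eq_bigr => j _.
  by apply: eq_bigr => k _; rewrite mulmx1.
rewrite !ex; apply: sum2_slot => i j; rewrite sumdiff1 mulmx1.
apply: nrm5; rewrite ?eproj_nrm //.
apply: (resolution_lip (eproj_resolution hW') (eproj_resolution hW) K0) => k l.
exact: h.
Qed.

Lemma Op3_lip (m b : R) psi : BL m b psi -> exists2 K : R, 0 <= K &
  forall (Y Z W Y' Z' W' X1 X2 : M), box m b Y -> box m b Z -> box m b W ->
   box m b Y' -> box m b Z' -> box m b W' ->
   nrm (Op3 psi Y' Z' W' X1 X2 - Op3 psi Y Z W X1 X2)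
     <= K * (nrm (Y' - Y) + nrm (Z' - Z) + nrm (W' - W)) * nrm X1 * nrm X2.
Proof.
move=> [K K0 [_ hl]]; exists (clip3 * K); first by rewrite mulr_ge0 ?clip3_ge0.
move=> Y Z W Y' Z' W' X1 X2 bY bZ bW bY' bZ' bW'.
rewrite [_ - _](_ : _ = (Op3 psi Y' Z' W' X1 X2 - Op3 psi Y Z' W' X1 X2) +
  (Op3 psi Y Z' W' X1 X2 - Op3 psi Y Z W' X1 X2) +
  (Op3 psi Y Z W' X1 X2 - Op3 psi Y Z W X1 X2)); last first.
  by rewrite !addrA !subrK.
rewrite !mulrDr !mulrDl; apply: le_trans (nrmD _ _) _; apply: lerD.
  apply: le_trans (nrmD _ _) _; apply: lerD.
    apply: (Op3_slot1 (m := m) (b := b)) => // x x' y z h1 h2 h3 h4.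
    by have := hl x y z x' y z h1 h3 h4 h2 h3 h4; rewrite !subrr normr0 !addr0.
  apply: (Op3_slot2 (m := m) (b := b)) => // x y y' z h1 h2 h3 h4.
  by have := hl x y z x y' z h1 h2 h4 h1 h3 h4; rewrite !subrr normr0 !addr0 add0r.
apply: (Op3_slot3 (m := m) (b := b)) => // x y z z' h1 h2 h3 h4.
by have := hl x y z x y z' h1 h2 h3 h1 h2 h4; rewrite !subrr normr0 !add0r.
Qed.

Lemma Op3Dl psi (Y Z W X1 X1' X2 : M) c :
  Op3 psi Y Z W (c *: X1 + X1') X2 = c *: Op3 psi Y Z W X1 X2 + Op3 psi Y Z W X1' X2.
Proof.
rewrite Op3.unlock scaler_sumr -big_split; apply: eq_bigr => i _.
rewrite /= scaler_sumr -big_split; apply: eq_bigr => j _.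
rewrite /= scaler_sumr -big_split; apply: eq_bigr => k _ /=.
rewrite mulmxDr !mulmxDl -scalemxAr -!scalemxAl scalerDr; congr (_ + _).
by rewrite !scalerA mulrC.
Qed.

Lemma Op3Dr psi (Y Z W X1 X2 X2' : M) c :
  Op3 psi Y Z W X1 (c *: X2 + X2') = c *: Op3 psi Y Z W X1 X2 + Op3 psi Y Z W X1 X2'.
Proof.
rewrite Op3.unlock scaler_sumr -big_split; apply: eq_bigr => i _.
rewrite /= scaler_sumr -big_split; apply: eq_bigr => j _.
rewrite /= scaler_sumr -big_split; apply: eq_bigr => k _ /=.
rewrite mulmxDr !mulmxDl -scalemxAr -!scalemxAl scalerDr; congr (_ + _).
by rewrite !scalerA mulrC.
Qed.

(** With the identity in the last slot, orthogonality of the projections of [Z] collapses the triple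
    sum. The bounds for [Op3] thus hold for [Op2] as well. *)
Lemma mxfun2_Op3 (f : R -> R -> R) (Y Z X : M) :
  Op2 f Y Z X = Op3 (fun x y _ => f x y) Y Z Z X 1%:M.
Proof.
rewrite Op2.unlock Op3.unlock; apply: eq_bigr => i _; apply: eq_bigr => j _.
rewrite (bigD1 j) //= big1 ?addr0 => [|k kj].
  by rewrite mulmx1 -(mulmxA _ (eproj Z j)) eproj_mul eqxx.
by rewrite mulmx1 -(mulmxA _ (eproj Z j)) eproj_mul eq_sym (negPf kj) mulmx0 scaler0.
Qed.

(** Exact, not only to first order: the factor [x' - x] of the symbol is absorbed, through
    [resolution_cross], by inserting [Y' - Y] between a projection of [Y'] and one of [Y]. *)
Lemma mxfun2_dd1 (m b : R) f (f1 : R -> R -> R -> R) (Y Y' Z X : M) :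
  (forall x x' y, m <= x <= b -> m <= x' <= b -> m <= y <= b ->
     f x' y - f x y = f1 x' x y * (x' - x)) ->
  box m b Y -> box m b Y' -> box m b Z ->
  Op2 f Y' Z X - Op2 f Y Z X = Op3 f1 Y' Y Z (Y' - Y) X.
Proof.
move=> h [hY bY] [hY' bY'] [_ bZ].
have rY := eproj_resolution hY; have rY' := eproj_resolution hY'.
have ex (A : M) : Op2 f A Z X = \sum_k (\sum_i (f (eigval A i) (eigval Z k))%:C *:
     eproj A i) *m (X *m eproj Z k).
  rewrite Op2.unlock exchange_big; apply: eq_bigr => k _; rewrite mulmx_suml.
  by apply: eq_bigr => i _; rewrite -scalemxAl !mulmxA.
rewrite !ex -sumrB Op3.unlock.
transitivity (\sum_k \sum_i \sum_j (f1 (eigval Y' i) (eigval Y j) (eigval Z k))%:C *: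
    (eproj Y' i *m (Y' - Y) *m eproj Y j *m X *m eproj Z k)); last first.
  rewrite exchange_big; apply: eq_bigr => i _; rewrite exchange_big.
  by apply: eq_bigr => j _.
apply: eq_bigr => k _; rewrite -mulmxBl.
rewrite (resolution_diff (fun i => f (eigval Y' i) (eigval Z k))
   (fun i => f (eigval Y i) (eigval Z k)) rY' rY).
rewrite mulmx_suml; apply: eq_bigr => i _; rewrite mulmx_suml.
apply: eq_bigr => j _; rewrite h // (resolution_cross i j rY' rY) -!scalemxAl.
by rewrite scalerA -rmorphM !mulmxA.
Qed.

Lemma mxfun2_dd2 (m b : R) f (f2 : R -> R -> R -> R) (Y Z Z' X : M) :
  (forall x y y', m <= x <= b -> m <= y <= b -> m <= y' <= b ->
     f x y' - f x y = f2 x y' y * (y' - y)) ->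
  box m b Y -> box m b Z -> box m b Z' ->
  Op2 f Y Z' X - Op2 f Y Z X = Op3 f2 Y Z' Z X (Z' - Z).
Proof.
move=> h [_ bY] [hZ bZ] [hZ' bZ'].
have rZ := eproj_resolution hZ; have rZ' := eproj_resolution hZ'.
have ex (A : M) : Op2 f Y A X = \sum_i eproj Y i *m X *m
   (\sum_k (f (eigval Y i) (eigval A k))%:C *: eproj A k).
  rewrite Op2.unlock; apply: eq_bigr => i _; rewrite mulmx_sumr.
  by apply: eq_bigr => k _; rewrite -scalemxAr.
rewrite !ex -sumrB Op3.unlock; apply: eq_bigr => i _; rewrite -mulmxBr.
rewrite (resolution_diff (fun k => f (eigval Y i) (eigval Z' k))
   (fun k => f (eigval Y i) (eigval Z k)) rZ' rZ).
rewrite mulmx_sumr; apply: eq_bigr => j _; rewrite mulmx_sumr.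
apply: eq_bigr => k _; rewrite h // -(mulmxA (_ *m X *m _)) -(mulmxA (_ *m X)).
rewrite (mulmxA (eproj Z' j)) (resolution_cross j k rZ' rZ).
by rewrite -!scalemxAr scalerA -rmorphM.
Qed.

Lemma mxfun_dd (m b : R) f (f1 : R -> R -> R) (Y Y' : M) :
  (forall x x', m <= x <= b -> m <= x' <= b -> f x' - f x = f1 x' x * (x' - x)) ->
  box m b Y -> box m b Y' ->
  mxfun f Y' - mxfun f Y = Op2 f1 Y' Y (Y' - Y).
Proof.
move=> h [hY bY] [hY' bY'].
have rY := eproj_resolution hY; have rY' := eproj_resolution hY'.
rewrite !mxfunE (resolution_diff (fun i => f (eigval Y' i)) (fun i => f (eigval Y i)) rY' rY).
rewrite Op2.unlock; apply: eq_bigr => i _; apply: eq_bigr => j _.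
by rewrite h // (resolution_cross i j rY' rY) scalerA -rmorphM.
Qed.

End TripleOperator.

Section DoubleOperatorCalculus.
Variables (R : realType) (d : nat) (m b : R).
Local Notation C := R[i].
Local Notation M := 'M[C]_d.
Variables (f : R -> R -> R) (f1 f2 : R -> R -> R -> R).
Hypotheses
  (fE1 : forall x x' y, m <= x <= b -> m <= x' <= b -> m <= y <= b ->
     f x' y - f x y = f1 x' x y * (x' - x))
  (fE2 : forall x y y', m <= x <= b -> m <= y <= b -> m <= y' <= b ->
     f x y' - f x y = f2 x y' y * (y' - y))
  (f1BL : BL m b f1) (f2BL : BL m b f2).

(** The exact increment is a pair of [Op3] at base points mixing [Y] and [Y']. Moving all of them to
    [Y] costs one more factor [Y' - Y], because [Op3] is Lipschitz in its base points. *)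
Lemma mxfun2_diff : exists2 K : R, 0 <= K & forall (Y Y' X : M),
  box m b Y -> box m b Y' ->
  nrm (Op2 f Y' Y' X - Op2 f Y Y X
       - (Op3 f1 Y Y Y (Y' - Y) X + Op3 f2 Y Y Y X (Y' - Y)))
   <= K * nrm (Y' - Y) ^+ 2 * nrm X.
Proof.
have [K1 K10 h1] := Op3_lip d f1BL; have [K2 K20 h2] := Op3_lip d f2BL.
exists (2 * K1 + K2); first by rewrite addr_ge0 // mulr_ge0.
move=> Y Y' X bY bY'.
have -> : Op2 f Y' Y' X - Op2 f Y Y X
   = (Op2 f Y' Y' X - Op2 f Y Y' X) + (Op2 f Y Y' X - Op2 f Y Y X).
  by rewrite addrA subrK.
rewrite (mxfun2_dd1 _ fE1 bY bY' bY') (mxfun2_dd2 _ fE2 bY bY bY').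
rewrite opprD addrACA; apply: le_trans (nrmD _ _) _.
have := h1 Y Y Y Y' Y Y' (Y' - Y) X bY bY bY bY' bY bY'.
have := h2 Y Y Y Y Y' Y X (Y' - Y) bY bY bY bY bY' bY.
rewrite !subrr !nrm0 addr0 add0r.
have := nrm_ge0 (Y' - Y); have := nrm_ge0 X.
move: (nrm (Op3 _ _ _ _ _ _ - _)) (nrm (Op3 _ _ _ _ _ _ - _)).
move: (nrm (Y' - Y)) (nrm X) => u v A B u0 v0 hA hB.
by apply: le_trans (lerD hB hA) _; rewrite le_eqVlt; apply/orP; left; apply/eqP; ring.
Qed.

Lemma dmxfun2_lip : exists2 K : R, 0 <= K & forall (Y Y' X H : M),
  box m b Y -> box m b Y' ->
  nrm ((Op3 f1 Y' Y' Y' H X + Op3 f2 Y' Y' Y' X H)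
       - (Op3 f1 Y Y Y H X + Op3 f2 Y Y Y X H))
   <= K * nrm (Y' - Y) * nrm H * nrm X.
Proof.
have [K1 K10 h1] := Op3_lip d f1BL; have [K2 K20 h2] := Op3_lip d f2BL.
exists (3 * K1 + 3 * K2); first by rewrite addr_ge0 // mulr_ge0.
move=> Y Y' X H bY bY'.
rewrite opprD addrACA; apply: le_trans (nrmD _ _) _.
have hB := h1 Y Y Y Y' Y' Y' H X bY bY bY bY' bY' bY'.
have hA := h2 Y Y Y Y' Y' Y' X H bY bY bY bY' bY' bY'.
by apply: le_trans (lerD hB hA) _; rewrite le_eqVlt; apply/orP; left; apply/eqP; ring.
Qed.

Lemma dmxfun2_bound : exists2 K : R, 0 <= K & forall (Y X H : M), box m b Y ->
  nrm (Op3 f1 Y Y Y H X + Op3 f2 Y Y Y X H) <= K * nrm H * nrm X.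
Proof.
have [K1 K10 h1] := Op3_bound d f1BL; have [K2 K20 h2] := Op3_bound d f2BL.
exists (K1 + K2); first by rewrite addr_ge0.
move=> Y X H bY; apply: le_trans (nrmD _ _) _.
have hB := h1 Y Y Y H X bY bY bY.
have hA := h2 Y Y Y X H bY bY bY.
by apply: le_trans (lerD hB hA) _; rewrite le_eqVlt; apply/orP; left; apply/eqP; ring.
Qed.

End DoubleOperatorCalculus.

(** * Derivatives of matrix-valued curves *)

Section MatrixDerivative.
Variable R : realType.
Local Notation C := R[i].

Lemma is_deriveP (g : R -> R) (s D : R) : is_derive s 1 g D <->
  forall e : R, 0 < e -> \forall h \near (0 : R), `|g (s + h) - g s - h * D| <= e * `|h|.
Proof.
split=> [[dg gD] e e0|H].
  have : (fun h : R => h^-1 *: ((g \o shift s) (h *: 1) - g s)) @ 0^' --> D.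
    by rewrite -gD; exact: dg.
  move=> /cvgrPdist_le/(_ e e0); rewrite near_withinE => hn.
  near=> h; have [->|h0] := eqVneq h 0.
    by rewrite addr0 subrr mul0r subr0 normr0 mulr0.
  have hh : h != 0 -> `|D - h^-1 *: ((g \o shift s) (h *: 1) - g s)| <= e.
    by near: h; apply: filterS hn => h.
  have {}hh := hh h0; rewrite /= /GRing.scale /= mulr1 in hh.
  have -> : g (s + h) - g s - h * D = - h * (D - h^-1 * (g (h + s) - g s)).
    by rewrite [s + h]addrC; field.
  by rewrite normrM normrN mulrC ler_wpM2r.
have cv : (fun h : R => h^-1 *: ((g \o shift s) (h *: 1) - g s)) @ 0^' --> D.
  apply/cvgrPdist_le => e e0; rewrite near_withinE.
  have := H e e0; apply: filterS => h hh h0.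
  rewrite /= /GRing.scale /= mulr1.
  have -> : D - h^-1 * (g (h + s) - g s) = - h^-1 * (g (s + h) - g s - h * D).
    by rewrite [s + h]addrC; field.
  rewrite normrM normrN normfV mulrC ler_pdivrMr ?normr_gt0 //.
split; first by apply/cvg_ex; exists D.
by apply/cvg_lim.
Unshelve. all: by end_near. Qed.

Lemma near0I (P Q : R -> Prop) : (\forall h \near (0 : R), P h) ->
  (\forall h \near (0 : R), Q h) -> \forall h \near (0 : R), P h /\ Q h.
Proof. by move=> hP hQ; apply: filterS2 hP hQ. Qed.

Lemma near0W (P : R -> Prop) : (forall h, P h) -> \forall h \near (0 : R), P h.
Proof. by move=> h; exact: filterE. Qed.

(** Little-o form of the derivative in [nrm], which handles real and imaginary parts together;
    [mxD_mx_derive] goes back to the entrywise notion. *)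
Definition mxD m n (f : R -> 'M[C]_(m, n)) (s : R) (D : 'M[C]_(m, n)) : Prop :=
  forall e : R, 0 < e ->
    \forall h \near (0 : R), nrm (f (s + h) - f s - h%:C *: D) <= e * `|h|.

Definition mxC m n (f : R -> 'M[C]_(m, n)) (s : R) : Prop :=
  forall e : R, 0 < e -> \forall h \near (0 : R), nrm (f (s + h) - f s) <= e.

Lemma Re_entry m n (X Y D : 'M[C]_(m, n)) (h : R) i j :
  complex.Re ((X - Y - h%:C *: D) i j) =
  complex.Re (X i j) - complex.Re (Y i j) - h * complex.Re (D i j).
Proof. by rewrite !mxE !ReD !ReN ReZ. Qed.

Lemma Im_entry m n (X Y D : 'M[C]_(m, n)) (h : R) i j :
  complex.Im ((X - Y - h%:C *: D) i j) =
  complex.Im (X i j) - complex.Im (Y i j) - h * complex.Im (D i j).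
Proof. by rewrite !mxE !ImD !ImN ImZ. Qed.

Lemma mxD_Re m n (f : R -> 'M[C]_(m, n)) (s : R) (D : 'M[C]_(m, n)) i j : mxD f s D ->
  is_derive s 1 (fun t => complex.Re (f t i j)) (complex.Re (D i j)).
Proof.
move=> H; apply/is_deriveP => e e0; have := H e e0; apply: filterS => h hh.
rewrite -Re_entry; apply: le_trans (Re_le_n1 _) _.
by apply: le_trans hh; exact: n1_le_nrm.
Qed.

Lemma mxD_Im m n (f : R -> 'M[C]_(m, n)) (s : R) (D : 'M[C]_(m, n)) i j : mxD f s D ->
  is_derive s 1 (fun t => complex.Im (f t i j)) (complex.Im (D i j)).
Proof.
move=> H; apply/is_deriveP => e e0; have := H e e0; apply: filterS => h hh.
rewrite -Im_entry; apply: le_trans (Im_le_n1 _) _.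
by apply: le_trans hh; exact: n1_le_nrm.
Qed.

Lemma near_all (I : finType) (P : I -> R -> Prop) :
  (forall i, \forall h \near (0 : R), P i h) ->
  \forall h \near (0 : R), forall i, P i h.
Proof.
move=> H; suff : \forall h \near (0 : R), forall i, i \in enum I -> P i h.
  by apply: filterS => h hh i; apply: hh; rewrite mem_enum.
elim: (enum I) => [|a s IH]; first exact: near0W.
by apply: filterS2 (H a) IH => h h1 h2 i; rewrite inE => /orP[/eqP -> //|]; exact: h2.
Qed.

Lemma mxD_of_entries m n (f : R -> 'M[C]_(m, n)) (s : R) (D : 'M[C]_(m, n)) :
  (forall i j, is_derive s 1 (fun t => complex.Re (f t i j)) (complex.Re (D i j))
   /\ is_derive s 1 (fun t => complex.Im (f t i j)) (complex.Im (D i j))) ->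
  mxD f s D.
Proof.
move=> H e e0; pose k : R := m%:R * n%:R * 2 + 1.
have k0 : 0 < k by rewrite ltr_wpDl // !mulr_ge0.
have ek : 0 < e / k by rewrite divr_gt0.
have : \forall h \near (0 : R), forall ij : 'I_m * 'I_n,
   n1 ((f (s + h) - f s - h%:C *: D) ij.1 ij.2) <= 2 * (e / k * `|h|).
  apply: (@near_all _ (fun ij h => n1 ((f (s + h) - f s - h%:C *: D) ij.1 ij.2) <= 2 * (e / k * `|h|))).
  move=> -[i j] /=; have [/is_deriveP h1 /is_deriveP h2] := H i j.
  apply: filterS2 (h1 _ ek) (h2 _ ek) => h a b.
  by rewrite /n1 Re_entry Im_entry mulr_natl mulr2n lerD.
apply: filterS => h hh; apply: le_trans (nrm_le_entry (fun i j => hh (i, j))) _.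
have -> : m%:R * n%:R * (2 * (e / k * `|h|)) = m%:R * n%:R * 2 * (e * `|h|) / k.
  by field; rewrite gt_eqF.
rewrite ler_pdivrMr // /k.
have : 0 <= e * `|h| by rewrite mulr_ge0 // ltW.
nra.
Qed.

Lemma mxD_mx_derive d (f : R -> 'M[C]_d) (s : R) (D : 'M[C]_d) : mxD f s D ->
  mx_derivable f s /\ mx_derive f s = D.
Proof.
move=> H; split.
  move=> i j; split.
    by have [] := mxD_Re i j H.
  by have [] := mxD_Im i j H.
apply/matrixP => i j; rewrite mxE !derive1E.
have /@derive_val -> := mxD_Re i j H; have /@derive_val -> := mxD_Im i j H.
by case: (D i j).
Qed.

Lemma mxD_near m n (f g : R -> 'M[C]_(m, n)) (s : R) (D : 'M[C]_(m, n)) :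
  (\forall h \near (0 : R), f (s + h) = g (s + h)) -> mxD f s D -> mxD g s D.
Proof.
move=> H hf e e0; have := nbhs_singleton H; rewrite addr0 => e1.
by apply: filterS2 H (hf e e0) => h <-; rewrite e1.
Qed.

Lemma mxD_lip m n (f : R -> 'M[C]_(m, n)) (s : R) (D : 'M[C]_(m, n)) : mxD f s D ->
  \forall h \near (0 : R), nrm (f (s + h) - f s) <= (nrm D + 1) * `|h|.
Proof.
move=> H; apply: filterS (H 1 ltr01) => h hh.
rewrite -[X in nrm X](subrK (h%:C *: D)); apply: le_trans (nrmD _ _) _.
by rewrite nrmZr mulrDl addrC mulrC lerD.
Qed.

Lemma near0_small (K e : R) : 0 <= K -> 0 < e -> \forall h \near (0 : R), K * `|h| <= e.
Proof.
move=> K0 e0; have K1 : 0 < K + 1 by rewrite ltr_wpDl.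
have : \forall h \near (0 : R), `|0 - h| <= e / (K + 1).
  by apply: (@cvgr_dist_le _ _ _ (nbhs (0:R)) _ id 0) => //; rewrite divr_gt0.
apply: filterS => h; rewrite sub0r normrN ler_pdivlMr // => hh.
by have := normr_ge0 h; nra.
Qed.

Lemma mxD_cont m n (f : R -> 'M[C]_(m, n)) (s : R) (D : 'M[C]_(m, n)) : mxD f s D -> mxC f s.
Proof.
move=> H e e0; have K0 : 0 <= nrm D + 1 by rewrite addr_ge0 ?nrm_ge0.
by apply: filterS2 (mxD_lip H) (near0_small K0 e0) => h; exact: le_trans.
Qed.

Lemma mxD_cst m n (X : 'M[C]_(m, n)) (s : R) : mxD (fun=> X) s 0.
Proof.
move=> e e0; apply: near0W => h; rewrite subrr scaler0 subr0 nrm0.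
by rewrite mulr_ge0 // ltW.
Qed.

Lemma mxD_line m n (X W : 'M[C]_(m, n)) (s : R) : mxD (fun t => X + t%:C *: W) s W.
Proof.
move=> e e0; apply: near0W => h; rewrite rmorphD scalerDl addrA.
rewrite [X in nrm (X - _)]addrAC subrr add0r subrr nrm0.
by rewrite mulr_ge0 // ltW.
Qed.

Lemma mxD_add m n (f g : R -> 'M[C]_(m, n)) (s : R) (D E : 'M[C]_(m, n)) : mxD f s D -> mxD g s E ->
  mxD (fun t => f t + g t) s (D + E).
Proof.
move=> hf hg e e0; have e2 : 0 < e / 2 by rewrite divr_gt0.
apply: filterS2 (hf _ e2) (hg _ e2) => h a b.
rewrite [X in nrm X](_ : _ = (f (s + h) - f s - h%:C *: D) + (g (s + h) - g s - h%:C *: E)).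
  by apply: le_trans (nrmD _ _) _; rewrite [e]splitr mulrDl lerD.
by rewrite scalerDr !opprD [in RHS]addrACA [f (s + h) - f s + _]addrACA.
Qed.

(** Homogeneity is asked for real scalars only, so that the rule covers [ip]. *)
Lemma mxD_bilin m n m1 n1 m2 n2
    (B : 'M[C]_(m1, n1) -> 'M[C]_(m2, n2) -> 'M[C]_(m, n)) (K : R) f g (s : R) D E :
  (forall X X' Y, B (X + X') Y = B X Y + B X' Y) ->
  (forall X Y Y', B X (Y + Y') = B X Y + B X Y') ->
  (forall (c : R) X Y, B (c%:C *: X) Y = c%:C *: B X Y) ->
  (forall (c : R) X Y, B X (c%:C *: Y) = c%:C *: B X Y) ->
  0 <= K -> (forall X Y, nrm (B X Y) <= K * nrm X * nrm Y) ->
  mxD f s D -> mxD g s E ->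
  mxD (fun t => B (f t) (g t)) s (B D (g s) + B (f s) E).
Proof.
move=> BDl BDr BZl BZr K0 bB hf hg e e0.
have BNl X Y : B (- X) Y = - B X Y.
  by rewrite -scaleN1r -(rmorphN1 (real_complex R)) BZl rmorphN1 scaleN1r.
have BNr X Y : B X (- Y) = - B X Y.
  by rewrite -scaleN1r -(rmorphN1 (real_complex R)) BZr rmorphN1 scaleN1r.
have e3 : 0 < e / 3 by rewrite divr_gt0.
have p1 : 0 < e / 3 / (K * nrm (g s) + 1).
  by rewrite divr_gt0 // ltr_wpDl // mulr_ge0 ?nrm_ge0.
have p2 : 0 < e / 3 / (K * nrm (f s) + 1).
  by rewrite divr_gt0 // ltr_wpDl // mulr_ge0 ?nrm_ge0.
have p3 : 0 <= K * (nrm D + 1) * (nrm E + 1).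
  by rewrite !mulr_ge0 ?addr_ge0 ?nrm_ge0.
have c1 := near0_small p3 e3.
have a1 := near0I (hf _ p1) (hg _ p2).
have a2 := near0I (mxD_lip hf) (mxD_lip hg).
apply: filterS2 (near0I a1 a2) c1 => h [[h1 h2] [h3 h4]] h5.
rewrite [X in nrm X](_ : _ = B (f (s + h) - f s - h%:C *: D) (g s)
  + B (f s) (g (s + h) - g s - h%:C *: E)
  + B (f (s + h) - f s) (g (s + h) - g s)); last first.
  rewrite !(BDl, BDr, BNl, BNr, BZl, BZr) scalerDr.
  move: (B (f (s + h)) (g (s + h))) (B (f (s + h)) (g s)) (B (f s) (g (s + h))).
  move: (B (f s) (g s)) (h%:C *: B D (g s)) (h%:C *: B (f s) E) => u v w x y z.
  by apply/matrixP => i j; rewrite !mxE; ring.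
have n3 (X Y Z : 'M[C]_(m, n)) : nrm (X + Y + Z) <= nrm X + nrm Y + nrm Z.
  by apply: le_trans (nrmD _ _) _; rewrite lerD2r nrmD.
apply: le_trans (n3 _ _ _) _.
have -> : e * `|h| = e / 3 * `|h| + e / 3 * `|h| + e / 3 * `|h| by field.
have h0 := normr_ge0 h.
apply: lerD; first apply: lerD.
- apply: le_trans (bB _ _) _.
  have k1 : 0 < K * nrm (g s) + 1 by rewrite ltr_wpDl // mulr_ge0 ?nrm_ge0.
  rewrite mulrAC in h1; rewrite ler_pdivlMr // in h1.
  have := nrm_ge0 (f (s + h) - f s - h%:C *: D); nra.
- apply: le_trans (bB _ _) _.
  have k1 : 0 < K * nrm (f s) + 1 by rewrite ltr_wpDl // mulr_ge0 ?nrm_ge0.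
  rewrite mulrAC in h2; rewrite ler_pdivlMr // in h2.
  have := nrm_ge0 (g (s + h) - g s - h%:C *: E); nra.
apply: le_trans (bB _ _) _.
apply: (@le_trans _ _ (K * ((nrm D + 1) * `|h|) * ((nrm E + 1) * `|h|))).
  by rewrite ler_pM ?mulr_ge0 ?nrm_ge0 // ler_wpM2l.
by rewrite [leLHS](_ : _ = K * (nrm D + 1) * (nrm E + 1) * `|h| * `|h|);
  [rewrite ler_wpM2r|ring].
Qed.

(** The quadratic expansion of [G] is required only along the curve: for spectral functions it is
    available among self-adjoint matrices, not on a full neighbourhood. *)
Lemma mxD_comp m n m1 n1 (G T : 'M[C]_(m, n) -> 'M[C]_(m1, n1)) (K KT : R) f (s : R) D :
  (forall X Y, T (X + Y) = T X + T Y) ->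
  (forall (c : R) X, T (c%:C *: X) = c%:C *: T X) ->
  0 <= KT -> (forall X, nrm (T X) <= KT * nrm X) -> 0 <= K ->
  (\forall h \near (0 : R), nrm (G (f (s + h)) - G (f s) - T (f (s + h) - f s))
      <= K * nrm (f (s + h) - f s) ^+ 2) ->
  mxD f s D -> mxD (G \o f) s (T D).
Proof.
move=> TD TZ KT0 bT K0 hG hf e e0.
have TN X : T (- X) = - T X.
  by rewrite -scaleN1r -(rmorphN1 (real_complex R)) TZ rmorphN1 scaleN1r.
have e2 : 0 < e / 2 by rewrite divr_gt0.
have p1 : 0 < e / 2 / (KT + 1) by rewrite divr_gt0 // ltr_wpDl.
have p2 : 0 <= K * (nrm D + 1) ^+ 2 by rewrite mulr_ge0 ?sqr_ge0.
have a1 := near0I (hf _ p1) (mxD_lip hf).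
have a2 := near0I hG (near0_small p2 e2).
apply: filterS2 a1 a2 => h [h1 h2] [h3 h4] /=.
rewrite [X in nrm X](_ : _ = (G (f (s + h)) - G (f s) - T (f (s + h) - f s))
   + T (f (s + h) - f s - h%:C *: D)); last first.
  by rewrite !TD !TN TZ; apply/matrixP => i j; rewrite !mxE; ring.
apply: le_trans (nrmD _ _) _; rewrite [e]splitr mulrDl; apply: lerD.
  apply: le_trans h3 _; apply: (@le_trans _ _ (K * ((nrm D + 1) * `|h|) ^+ 2)).
    by rewrite ler_wpM2l // !expr2 ler_pM ?nrm_ge0.
  by rewrite exprMn mulrA [`|h| ^+ 2]expr2 mulrA ler_wpM2r.
apply: le_trans (bT _) _.
have k1 : 0 < KT + 1 by rewrite ltr_wpDl.
rewrite mulrAC in h1; rewrite ler_pdivlMr // in h1.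
have := nrm_ge0 (f (s + h) - f s - h%:C *: D); nra.
Qed.

Lemma mxD_linear m n m1 n1 (T : 'M[C]_(m, n) -> 'M[C]_(m1, n1)) (KT : R) f (s : R) D :
  (forall X Y, T (X + Y) = T X + T Y) ->
  (forall (c : R) X, T (c%:C *: X) = c%:C *: T X) ->
  0 <= KT -> (forall X, nrm (T X) <= KT * nrm X) ->
  mxD f s D -> mxD (fun t => T (f t)) s (T D).
Proof.
move=> TD TZ KT0 bT; apply: (@mxD_comp _ _ _ _ T T 0 KT) => //.
apply: near0W => h; have TN X : T (- X) = - T X.
  by rewrite -scaleN1r -(rmorphN1 (real_complex R)) TZ rmorphN1 scaleN1r.
by rewrite TD TN subrr nrm0 mul0r.
Qed.

Lemma mxD_ip d (f g : R -> 'M[C]_d) (s : R) (D E : 'M[C]_d) : mxD f s D -> mxD g s E ->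
  is_derive s 1 (fun t => ip (f t) (g t)) (ip D (g s) + ip (f s) E).
Proof.
move=> hf hg.
(* The real number is read as a 1 by 1 matrix to fit the product rule. *)
have := @mxD_bilin 1 1 d d d d (fun X Y => (ip X Y)%:C%:M) 1 f g s D E.
move=> /(_ _ _ _ _ _ _ hf hg) H.
have {}H : mxD (fun t => (ip (f t) (g t))%:C%:M : 'M[C]_1) s
   ((ip D (g s))%:C%:M + (ip (f s) E)%:C%:M).
  apply: H => //.
  - by move=> X X' Y; rewrite ipDl rmorphD raddfD.
  - by move=> X Y Y'; rewrite ipDr rmorphD raddfD.
  - by move=> c X Y; rewrite ipZl rmorphM scale_scalar_mx.
  - by move=> c X Y; rewrite ipZr rmorphM scale_scalar_mx.
  - move=> X Y; rewrite /nrm !big_ord1 mxE eqxx mulr1n n1_real mul1r.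
    exact: ip_le.
have := mxD_Re 0 0 H.
have -> : complex.Re (((ip D (g s))%:C%:M + (ip (f s) E)%:C%:M : 'M[C]_1) 0 0)
   = ip D (g s) + ip (f s) E by rewrite !mxE.
have -> // : (fun t => complex.Re (((ip (f t) (g t))%:C%:M : 'M[C]_1) 0 0))
   = (fun t => ip (f t) (g t)).
by apply/funext => t; rewrite mxE.
Qed.

Lemma mxD_unique m n (f : R -> 'M[C]_(m, n)) (s : R) (D E : 'M[C]_(m, n)) :
  mxD f s D -> mxD f s E -> D = E.
Proof.
move=> h1 h2; apply/matrixP => i j.
have /@derive_val a := mxD_Re i j h1; have /@derive_val a' := mxD_Re i j h2.
have /@derive_val b := mxD_Im i j h1; have /@derive_val b' := mxD_Im i j h2.
case: (D i j) (E i j) a a' b b' => x y [u v] /=.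
by move=> -> -> -> ->.
Qed.

End MatrixDerivative.

(** * The Picard-Lindeloef theorem *)

Section Picard.
Variable R : realType.
Local Notation C := R[i].

Lemma near_shift (t : R) (P : R -> Prop) :
  (\forall h \near (0 : R), P (t + h)) -> \forall y \near t, P y.
Proof.
move=> /nbhs_ballP[e /= e0 H]; apply/nbhs_ballP; exists e => //= y yt.
have := H (y - t); rewrite subrKC; apply.
by move: yt; rewrite /ball /= sub0r opprB.
Qed.

Lemma shift_near (t : R) (P : R -> Prop) :
  (\forall y \near t, P y) -> \forall h \near (0 : R), P (t + h).
Proof.
move=> /nbhs_ballP[e /= e0 H]; apply/nbhs_ballP; exists e => //= h h0.
by apply: H; move: h0; rewrite /ball /= sub0r normrN opprD addrA subrr sub0r normrN.
Qed.

(** The integral starts at -2 so that the primitive is differentiable on a neighbourhood of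
    [[-1, 1]], which contains every time interval used by [picard]. *)
Lemma primitive_exists (f : R -> R) : (forall t : R, {for t, continuous f}) ->
  exists F : R -> R, F 0 = 0 /\ forall t : R, - 2 < t -> is_derive t 1 F (f t).
Proof.
move=> fc; pose G (x : R) := (\int[lebesgue_measure]_(t in [set` `[(-2 : R), x]]) (f t))%R.
exists (fun x => G x - G 0); split; first by rewrite subrr.
move=> t t2.
have fi : lebesgue_measure.-integrable `[-2, t + 1] (EFin \o f).
  apply: continuous_compact_integrable; first exact: segment_compact.
  by apply/continuous_in_subspaceT => x _; exact: fc.
have tt : t < t + 1 by rewrite ltrDl.
have [dG eG] := @continuous_FTC1_closed R f (-2) t (t + 1) tt fi t2 (fc t).
have H : is_derive t 1 G (f t) by split; rewrite -?derive1E.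
by apply: is_derive_eq; rewrite subr0.
Qed.

Lemma mxC_Re m n (f : R -> 'M[C]_(m, n)) (t : R) i j : mxC f t ->
  {for t, continuous (fun s => complex.Re (f s i j))}.
Proof.
move=> H; apply/cvgrPdist_le => e e0; apply: near_shift.
apply: filterS (H e e0) => h hh; rewrite distrC.
have -> : complex.Re (f (t + h) i j) - complex.Re (f t i j) =
   complex.Re ((f (t + h) - f t) i j) by rewrite !mxE ReD ReN.
by apply: le_trans (Re_le_n1 _) _; apply: le_trans hh; exact: n1_le_nrm.
Qed.

Lemma mxC_Im m n (f : R -> 'M[C]_(m, n)) (t : R) i j : mxC f t ->
  {for t, continuous (fun s => complex.Im (f s i j))}.
Proof.
move=> H; apply/cvgrPdist_le => e e0; apply: near_shift.
apply: filterS (H e e0) => h hh; rewrite distrC.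
have -> : complex.Im (f (t + h) i j) - complex.Im (f t i j) =
   complex.Im ((f (t + h) - f t) i j) by rewrite !mxE ImD ImN.
by apply: le_trans (Im_le_n1 _) _; apply: le_trans hh; exact: n1_le_nrm.
Qed.

Lemma mx_primitive m n (f : R -> 'M[C]_(m, n)) : (forall t, mxC f t) ->
  exists F : R -> 'M[C]_(m, n), F 0 = 0 /\ forall t : R, - 2 < t -> mxD F t (f t).
Proof.
move=> fc.
pose re i j := cid (primitive_exists (fun t => @mxC_Re m n f t i j (fc t))).
pose im i j := cid (primitive_exists (fun t => @mxC_Im m n f t i j (fc t))).
exists (fun t => \matrix_(i, j) (sval (re i j) t +i* sval (im i j) t)); split.
  apply/matrixP => i j; rewrite !mxE.
  by have [-> _] := svalP (re i j); have [-> _] := svalP (im i j).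
move=> t t2; apply: mxD_of_entries => i j.
have [_ /(_ t t2) h1] := svalP (re i j); have [_ /(_ t t2) h2] := svalP (im i j).
split.
  by have -> // : (fun s => complex.Re ((\matrix_(i, j) (sval (re i j) s
     +i* sval (im i j) s)) i j)) = sval (re i j) by apply/funext => s; rewrite mxE.
by have -> // : (fun s => complex.Im ((\matrix_(i, j) (sval (re i j) s
     +i* sval (im i j) s)) i j)) = sval (im i j) by apply/funext => s; rewrite mxE.
Qed.

Lemma mean_value (u du : R -> R) (a b : R) : a <= b ->
  (forall s : R, a <= s <= b -> is_derive s 1 u (du s)) ->
  exists2 c : R, a <= c <= b & u b - u a = du c * (b - a).
Proof.
move=> ab ud; have [||c] := @MVT_segment R u du a b ab.
- by move=> s; rewrite in_itv /= => /andP[h1 h2]; apply: ud; rewrite !ltW.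
- apply/continuous_in_subspaceT => s; rewrite inE /= in_itv /= => /ud h.
  apply: differentiable_continuous; apply/derivable1_diffP.
  exact: ex_derive.
by rewrite in_itv /= => hc e; exists c.
Qed.

Lemma real_mean (u du : R -> R) (a b k : R) : a <= b ->
  (forall s : R, a <= s <= b -> is_derive s 1 u (du s)) ->
  (forall s, a <= s <= b -> `|du s| <= k) -> `|u b - u a| <= k * (b - a).
Proof.
move=> ab ud bd; have [c cab ->] := mean_value ab ud.
rewrite normrM (@ger0_norm _ (b - a)) ?subr_ge0 //.
by rewrite ler_wpM2r ?subr_ge0 // bd.
Qed.

(** The real mean value theorem is applied to each real and imaginary part, which accounts for the
    factor [2 m n]. *)
Lemma mx_mean m n (G g : R -> 'M[C]_(m, n)) (a b k : R) :
  (forall s : R, a <= s <= b -> mxD G s (g s)) ->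
  (forall s, a <= s <= b -> nrm (g s) <= k) ->
  forall s t, a <= s <= b -> a <= t <= b ->
  nrm (G s - G t) <= m%:R * n%:R * (2 * k) * `|s - t|.
Proof.
move=> Gd gb s t; wlog ts : s t / t <= s.
  move=> H hs ht; have [|/ltW st] := leP t s; first by move=> ?; exact: H.
  by rewrite nrmBC distrC; exact: H.
move=> /andP[as_ sb] /andP[at_ tb].
have h i j : n1 ((G s - G t) i j) <= 2 * k * `|s - t|.
  rewrite ger0_norm ?subr_ge0 // -mulrA mulr_natl mulr2n /n1 !mxE ReD ReN ImD ImN.
  have sub u : t <= u <= s -> a <= u <= b.
    by move=> /andP[h1 h2]; rewrite (le_trans at_ h1) (le_trans h2 sb).
  apply: lerD.
    apply: (@real_mean (fun s => complex.Re (G s i j)) (fun s => complex.Re (g s i j))) => // u hu.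
      by apply: mxD_Re; apply: Gd; exact: sub.
    apply: le_trans (Re_le_n1 _) _; apply: le_trans (n1_le_nrm _ _ _) _.
    by apply: gb; exact: sub.
  apply: (@real_mean (fun s => complex.Im (G s i j)) (fun s => complex.Im (g s i j))) => // u hu.
    by apply: mxD_Im; apply: Gd; exact: sub.
  apply: le_trans (Im_le_n1 _) _; apply: le_trans (n1_le_nrm _ _ _) _.
  by apply: gb; exact: sub.
by apply: le_trans (nrm_le_entry h) _; rewrite !mulrA.
Qed.

Lemma geo_small (K e : R) : 0 < e -> exists n : nat, K * 2^-1 ^+ n <= e.
Proof.
move=> e0; exists (Num.bound `|K / e|); set N := Num.bound _.
have h : K / e < N%:R.
  by apply: le_lt_trans (ler_norm _) _; exact: archi_boundP.
have h2 : N%:R <= 2 ^+ N :> R.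
  by rewrite -natrX ler_nat ltnW // ltn_expl.
rewrite exprVn ler_pdivrMr ?exprn_gt0 //.
by rewrite ltr_pdivrMr // in h; nra.
Qed.

Lemma le_geo (x y K : R) : (forall n : nat, x <= y + K * 2^-1 ^+ n) -> x <= y.
Proof.
move=> h; rewrite leNgt; apply/negP => yx.
have e0 : 0 < (x - y) / 2 by rewrite divr_gt0 // subr_gt0.
have [n hn] := geo_small K e0.
by have := h n; lra.
Qed.

(** With [g n] the sum of the remaining steps, [u n - g n] increases and [u n + g n] decreases; the
    supremum of the former is the limit, with its error bound. *)
Lemma geo_limit (u : nat -> R) (K : R) : 
  (forall n, `|u n.+1 - u n| <= K * 2^-1 ^+ n) ->
  exists l, forall n, `|l - u n| <= 2 * K * 2^-1 ^+ n.
Proof.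
move=> h; pose g n : R := 2 * K * 2^-1 ^+ n.
have gS n : g n - g n.+1 = K * 2^-1 ^+ n by rewrite /g exprS; field.
have K0 : 0 <= K by have := le_trans (normr_ge0 _) (h 0%N); rewrite expr0 mulr1.
have g0 n : 0 <= g n by rewrite /g !mulr_ge0 // exprn_ge0 ?invr_ge0.
have inc n k : u n - g n <= u (n + k)%N - g (n + k)%N.
  elim: k => [|k IH]; first by rewrite addn0.
  apply: le_trans IH _; rewrite addnS; have := h (n + k)%N; rewrite -gS ler_norml.
  by move=> /andP[]; lra.
have dec n k : u (n + k)%N + g (n + k)%N <= u n + g n.
  elim: k => [|k IH]; first by rewrite addn0.
  apply: le_trans IH; rewrite addnS; have := h (n + k)%N; rewrite -gS ler_norml.
  by move=> /andP[]; lra.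
have ub k n : u k - g k <= u n + g n.
  have := inc k n; have := dec n k; rewrite [(n + k)%N]addnC.
  have := g0 (k + n)%N; lra.
pose A := range (fun n => u n - g n).
have A0 : A !=set0 by exists (u 0%N - g 0%N), 0%N.
exists (sup A) => n; rewrite ler_norml; apply/andP; split.
  have : u n - g n <= sup A.
    apply: ub_le_sup; last by exists n.
    by exists (u 0%N + g 0%N) => _ [k _ <-].
  by rewrite /g; lra.
have : sup A <= u n + g n by apply: ge_sup => // _ [k _ <-].
by rewrite /g; lra.
Qed.

Lemma mx_geo_limit m n (u : nat -> 'M[C]_(m, n)) (K : R) :
  (forall k, nrm (u k.+1 - u k) <= K * 2^-1 ^+ k) ->
  exists l, forall k, nrm (l - u k) <= m%:R * n%:R * (4 * K) * 2^-1 ^+ k.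
Proof.
move=> h.
have hre i j : exists l, forall k, `|l - complex.Re (u k i j)| <= 2 * K * 2^-1 ^+ k.
  apply: geo_limit => k; apply: le_trans (h k).
  have -> : complex.Re (u k.+1 i j) - complex.Re (u k i j) =
     complex.Re ((u k.+1 - u k) i j) by rewrite !mxE ReD ReN.
  by apply: le_trans (Re_le_n1 _) _; exact: n1_le_nrm.
have him i j : exists l, forall k, `|l - complex.Im (u k i j)| <= 2 * K * 2^-1 ^+ k.
  apply: geo_limit => k; apply: le_trans (h k).
  have -> : complex.Im (u k.+1 i j) - complex.Im (u k i j) =
     complex.Im ((u k.+1 - u k) i j) by rewrite !mxE ImD ImN.
  by apply: le_trans (Im_le_n1 _) _; exact: n1_le_nrm.
exists (\matrix_(i, j) (sval (cid (hre i j)) +i* sval (cid (him i j)))) => k.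
have hk i j : n1 ((\matrix_(i, j) (sval (cid (hre i j)) +i* sval (cid (him i j)))
     - u k) i j) <= 4 * K * 2^-1 ^+ k.
  rewrite /n1 !mxE ReD ReN ImD ImN /=.
  have := svalP (cid (hre i j)) k; have := svalP (cid (him i j)) k; lra.
by apply: le_trans (nrm_le_entry hk) _; rewrite !mulrA.
Qed.

Lemma max_lip (a x y : R) : `|Num.max a x - Num.max a y| <= `|x - y|.
Proof.
have h1 := ler_norm (x - y); have := ler_norm (y - x); rewrite distrC => h2.
by case: (leP a x) => h3; case: (leP a y) => h4; rewrite ler_norml; lra.
Qed.

Lemma min_lip (a x y : R) : `|Num.min a x - Num.min a y| <= `|x - y|.
Proof.
have h1 := ler_norm (x - y); have := ler_norm (y - x); rewrite distrC => h2.
by case: (leP a x) => h3; case: (leP a y) => h4; rewrite ler_norml; lra.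
Qed.

Theorem picard m n (F : 'M[C]_(m, n) -> 'M[C]_(m, n)) y0 (r L : R) :
  0 < r -> 0 <= L ->
  (forall x y, nrm (x - y0) <= r -> nrm (y - y0) <= r ->
     nrm (F x - F y) <= L * nrm (x - y)) ->
  exists2 e : R, 0 < e & exists y : R -> 'M[C]_(m, n), y 0 = y0 /\
    forall t : R, `|t| < e -> nrm (y t - y0) <= r /\ mxD y t (F (y t)).
Proof.
move=> r0 L0 Flip.
pose cc : R := m%:R * n%:R * 2.
have cc0 : 0 <= cc by rewrite !mulr_ge0.
pose B := nrm (F y0) + L * r.
have B0 : 0 <= B by rewrite addr_ge0 ?nrm_ge0 // mulr_ge0 // ltW.
have FB x : nrm (x - y0) <= r -> nrm (F x) <= B.
  move=> hx; rewrite -[F x](subrK (F y0)) addrC; apply: le_trans (nrmD _ _) _.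
  rewrite lerD2l; apply: le_trans (Flip _ _ hx _) _; first by rewrite subrr nrm0 ltW.
  by rewrite ler_wpM2l.
(* Each summand enforces one property of [e = 1 / q]: [e <= 1], iterates stay in the ball of radius
   [r], and the iteration contracts by one half. *)
pose q := 1 + cc * B / r + 2 * cc * L.
have q1 : 1 <= q.
  by rewrite /q -addrA lerDl addr_ge0 ?divr_ge0 ?mulr_ge0 // ltW.
have q0 : 0 < q by lra.
pose e := q^-1.
have e0 : 0 < e by rewrite invr_gt0.
have e1 : e <= 1 by rewrite invf_le1.
have eB : cc * B * e <= r.
  rewrite /e ler_pdivrMr // /q.
  have -> : r * (1 + cc * B / r + 2 * cc * L) = r + cc * B + r * (2 * cc * L).
    by field; rewrite gt_eqF.
  have : 0 <= r * (2 * cc * L) by rewrite !mulr_ge0 // ltW.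
  lra.
have eL : cc * L * e <= 2^-1.
  rewrite /e ler_pdivrMr // /q.
  have : 0 <= cc * B / r by rewrite divr_ge0 ?mulr_ge0 // ltW.
  lra.
(* Freezing time outside [-e, e] makes the iterates total functions. *)
pose c (t : R) := Num.max (- e) (Num.min e t).
have cin t : - e <= c t <= e.
  by rewrite /c le_max lexx /= ge_max ge_min lexx /= andbT; lra.
have cid_ t : `|t| <= e -> c t = t.
  rewrite ler_norml => /andP[h1 h2]; rewrite /c.
  by rewrite (min_idPr h2) (max_idPr h1).
have clip_ s t : `|c s - c t| <= `|s - t|.
  exact: le_trans (max_lip _ _ _) (min_lip _ _ _).
pose good (y : R -> 'M[C]_(m, n)) :=
  (forall t, nrm (y t - y0) <= r) /\ (forall t, mxC y t).
have goodF y : good y -> forall t, mxC (F \o y) t.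
  move=> [yb yc] t d d0; have d1 : 0 < d / (L + 1) by rewrite divr_gt0 // ltr_wpDl.
  apply: filterS (yc t _ d1) => h hh; apply: le_trans (Flip _ _ _ _) _ => //.
  have l1 : 0 < L + 1 by rewrite ltr_wpDl.
  by rewrite ler_pdivlMr // in hh; have := nrm_ge0 (y (t + h) - y t); nra.
(* The integral operator must be total to be iterated; the default 0 only concerns curves that leave
   the ball, and no iterate does. *)
pose P (y : R -> 'M[C]_(m, n)) : R -> 'M[C]_(m, n) :=
  match pselect (good y) with
  | left gy => sval (cid (mx_primitive (goodF y gy)))
  | right _ => fun=> 0
  end.
have P0 y : P y 0 = 0.
  by rewrite /P; case: pselect => // gy; case: (svalP (cid (mx_primitive (goodF y gy)))).
have PD y : good y -> forall t : R, - e <= t <= e -> mxD (P y) t (F (y t)).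
  move=> gy t /andP[te _]; rewrite /P; case: pselect => // gy'.
  by case: (svalP (cid (mx_primitive (goodF y gy')))) => _; apply; lra.
pose S y t := y0 + P y (c t).
have PL y : good y -> forall s t, - e <= s <= e -> - e <= t <= e ->
   nrm (P y s - P y t) <= cc * B * `|s - t|.
  move=> gy s t hs ht; have gb u : - e <= u <= e -> nrm (F (y u)) <= B.
    by move=> _; apply: FB; case: gy.
  by have := mx_mean (PD y gy) gb hs ht; rewrite /cc !mulrA.
have z_in : - e <= 0 <= e by lra.
have goodS y : good y -> good (S y).
  move=> gy; split=> t.
    rewrite /S addrC addKr -[P y _]subr0 -(P0 y).
    apply: le_trans (PL y gy _ _ (cin t) z_in) _; apply: le_trans eB.
    by rewrite ler_wpM2l ?mulr_ge0 // subr0 ler_norml.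
  move=> d d0; apply: filterS (near0_small (mulr_ge0 cc0 B0) d0) => h; apply: le_trans.
  rewrite /S opprD addrACA subrr add0r; apply: le_trans (PL y gy _ _ (cin _) (cin _)) _.
  rewrite ler_wpM2l ?mulr_ge0 //; apply: le_trans (clip_ _ _) _.
  by rewrite [t + h]addrC addrK.
have contr y z k : good y -> good z -> (forall t, nrm (y t - z t) <= k) ->
   forall t, nrm (S y t - S z t) <= k / 2.
  move=> gy gz yz t; have k0 : 0 <= k := le_trans (nrm_ge0 _) (yz 0).
  rewrite /S opprD addrACA subrr add0r.
  have Dd s : - e <= s <= e -> mxD (fun u => P y u - P z u) s (F (y s) - F (z s)).
    move=> hs; apply: mxD_add; first exact: PD.
    have := @mxD_linear R m n m n -%R 1 (P z) s (F (z s)).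
    apply => //; [by move=> *; rewrite opprD|by move=> *; rewrite scalerN|
      by move=> X; rewrite nrmN mul1r|exact: PD].
  have Db s : - e <= s <= e -> nrm (F (y s) - F (z s)) <= L * k.
    move=> _; apply: le_trans (Flip _ _ _ _) _; [by case: gy|by case: gz|].
    by rewrite ler_wpM2l.
  have := mx_mean Dd Db (cin t) z_in; rewrite !P0 subrr subr0 => /le_trans; apply.
  rewrite subr0; apply: (@le_trans _ _ (cc * L * k * e)).
    have -> : m%:R * n%:R * (2 * (L * k)) = cc * L * k by rewrite /cc; ring.
    by rewrite ler_wpM2l ?mulr_ge0 // ler_norml.
  by rewrite mulrAC mulrC ler_wpM2l.
pose Y k := iter k S (fun=> y0).
have goodY k : good (Y k).
  elim: k => [|k IH]; last by rewrite /Y iterS; exact: goodS.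
  split=> t; first by rewrite /Y /= subrr nrm0 ltW.
  by move=> d d0; apply: near0W => h; rewrite /Y /= subrr nrm0 ltW.
have Ystep k t : nrm (Y k.+1 t - Y k t) <= r * 2^-1 ^+ k.
  elim: k t => [|k IH] t.
    by rewrite expr0 mulr1 /Y /=; case: (goodS _ (goodY 0%N)).
  have := contr _ _ _ (goodY k.+1) (goodY k) IH t.
  by rewrite exprSr mulrA.
pose K := m%:R * n%:R * (4 * r).
pose Yl t := sval (cid (mx_geo_limit (Ystep^~ t))).
have Yk k t : nrm (Yl t - Y k t) <= K * 2^-1 ^+ k.
  exact: (svalP (cid (mx_geo_limit (Ystep^~ t))) k).
have gYl : good Yl.
  split=> t.
    apply: (@le_geo _ _ K) => k.
    rewrite -[Yl t](subrK (Y k t)) -addrA; apply: le_trans (nrmD _ _) _.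
    by rewrite [leRHS]addrC lerD //; case: (goodY k).
  move=> d d0; have d3 : 0 < d / 3 by rewrite divr_gt0.
  have [k hk] := geo_small K d3.
  have [_ /(_ t _ d3)] := goodY k; apply: filterS => h hh.
  have -> : Yl (t + h) - Yl t = (Yl (t + h) - Y k (t + h)) + (Y k (t + h) - Y k t)
     + (Y k t - Yl t) by rewrite !addrA !subrK.
  apply: le_trans (nrmD _ _) _; have := nrmD (Yl (t + h) - Y k (t + h)) (Y k (t + h) - Y k t).
  have := Yk k t; have := Yk k (t + h); rewrite (nrmBC (Y k t)); lra.
(* Both sides are within a geometric error of the iterate [Y k.+1], for every [k]. *)
have fixY t : S Yl t = Yl t.
  apply/eqP; rewrite -subr_eq0; apply/eqP; apply: nrm_eq0.
  apply/eqP; rewrite eq_le nrm_ge0 andbT.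
  apply: (@le_geo _ _ K) => k; rewrite add0r.
  have -> : S Yl t - Yl t = (S Yl t - Y k.+1 t) + (Y k.+1 t - Yl t) by rewrite addrA subrK.
  apply: le_trans (nrmD _ _) _; rewrite (nrmBC (Y k.+1 t)).
  have := contr _ _ _ gYl (goodY k) (Yk k) t; have := Yk k.+1 t.
  rewrite exprS; move: (2^-1 ^+ k) => g; rewrite /Y iterS.
  move: (nrm _) (nrm _) => a b; lra.
exists e => //; exists Yl; split.
  by rewrite -fixY /S cid_ ?normr0 ?(ltW e0) // P0 addr0.
move=> t te; split; first by case: gYl.
have tin : - e <= t <= e by rewrite -ler_norml ltW.
apply: (@mxD_near _ _ _ (fun t => y0 + P Yl t)).
  have : \forall y \near t, `|y| < e.
    apply: (@cvgr_lt _ _ (nbhs t) _ (fun y : R => `|y|) `|t|) => //.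
    by apply: cvg_norm.
  move=> /shift_near; apply: filterS => h hh.
  by rewrite -[RHS]fixY /S cid_ // ltW.
rewrite -[F _]add0r; apply: mxD_add; first exact: mxD_cst.
exact: PD.
Qed.

End Picard.

(** * The gradient identity *)

Section Operators.
Variables (R : realType) (d : nat).
Local Notation C := R[i].
Local Notation M := 'M[C]_d.

Lemma commZ (V : M) (c : C) X Y : comm V (c *: X + Y) = c *: comm V X + comm V Y.
Proof.
rewrite /comm mulmxDr mulmxDl -scalemxAr -scalemxAl scalerBr opprD.
by rewrite addrACA.
Qed.

Lemma comm_ct (V X : M) : (comm V X)^t* = - comm (V^t*) (X^t*).
Proof. by rewrite /comm ctB !ctM opprB. Qed.

Lemma hs_comm (V X Y : M) : hs (comm V X) Y = hs X (comm (V^t*) Y).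
Proof. by rewrite -adj_comm; apply: adj_hs => c A B; exact: commZ. Qed.

Lemma tr_comm (V X : M) : \tr (comm V X) = 0.
Proof. by rewrite /comm mxtraceD raddfN /= mxtrace_mulC subrr. Qed.

Lemma comm_scalar (V : M) (c : C) : comm V c%:M = 0.
Proof. by rewrite /comm mul_mx_scalar mul_scalar_mx subrr. Qed.

Lemma Op2Z (f : R -> R -> R) (Y Z : M) (c : C) X X' :
  Op2 f Y Z (c *: X + X') = c *: Op2 f Y Z X + Op2 f Y Z X'.
Proof.
rewrite Op2.unlock scaler_sumr -big_split; apply: eq_bigr => i _.
rewrite /= scaler_sumr -big_split; apply: eq_bigr => k _ /=.
rewrite mulmxDr mulmxDl -scalemxAr -scalemxAl scalerDr; congr (_ + _).
by rewrite !scalerA mulrC.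
Qed.

Lemma hsNr (X Y : M) : hs X (- Y) = - hs X Y.
Proof. by rewrite -scaleN1r hsZr mulN1r. Qed.

Lemma hs0r (X : M) : hs X 0 = 0.
Proof. by rewrite -(scale0r 0) hsZr mul0r. Qed.

Lemma hs0l (X : M) : hs 0 X = 0.
Proof. by rewrite hsC hs0r conjc0. Qed.

Lemma hs_sumr (I : finType) (X : M) (F : I -> M) : hs X (\sum_i F i) = \sum_i hs X (F i).
Proof. by rewrite /hs mulmx_sumr raddf_sum. Qed.

Lemma hs_suml (I : finType) (X : M) (F : I -> M) : hs (\sum_i F i) X = \sum_i hs (F i) X.
Proof. by rewrite /hs ct_sum mulmx_suml raddf_sum. Qed.

Lemma hs_sandwich (E F X X' : M) : E^t* = E -> F^t* = F ->
  hs (E *m X *m F) X' = hs X (E *m X' *m F).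
Proof.
move=> hE hF; rewrite /hs !ctM hE hF -!mulmxA mxtrace_mulC.
by rewrite -!mulmxA.
Qed.

Lemma ip_sandwich (E F X : M) : E^t* = E -> F^t* = F -> E *m E = E -> F *m F = F ->
  ip X (E *m X *m F) = ip (E *m X *m F) (E *m X *m F).
Proof.
move=> hE hF EE FF; rewrite /ip (hs_sandwich X (E *m X *m F) hE hF).
have -> // : E *m (E *m X *m F) *m F = E *m X *m F.
by rewrite (mulmxA E) (mulmxA E E) EE -(mulmxA _ F F) FF.
Qed.

Lemma eproj_expand (Y Z X : M) : X = \sum_i \sum_k eproj Y i *m X *m eproj Z k.
Proof.
rewrite -{1}[X]mul1mx -(eproj_sum Y) -[LHS]mulmx1 -(eproj_sum Z).
by rewrite !mulmx_suml; apply: eq_bigr => i _; rewrite mulmx_sumr.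
Qed.

Lemma hs_Op2 (f : R -> R -> R) (Y Z X X' : M) :
  hs (Op2 f Y Z X) X' = hs X (Op2 f Y Z X').
Proof.
rewrite Op2.unlock hs_suml hs_sumr; apply: eq_bigr => i _.
rewrite hs_suml hs_sumr; apply: eq_bigr => k _.
rewrite hsZl hsZr hs_sandwich ?eproj_ct //; congr (_ * _); exact: conjc_real.
Qed.

Lemma Op2_ct (f : R -> R -> R) (Y Z X : M) :
  (Op2 f Y Z X)^t* = Op2 (fun x y => f y x) Z Y (X^t*).
Proof.
rewrite Op2.unlock exchange_big ct_sum; apply: eq_bigr => k _.
rewrite ct_sum; apply: eq_bigr => i _.
by rewrite ctZr !ctM !eproj_ct mulmxA.
Qed.

Lemma eq_Op2 (f g : R -> R -> R) (Y Z X : M) :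
  (forall i k, f (eigval Y i) (eigval Z k) = g (eigval Y i) (eigval Z k)) ->
  Op2 f Y Z X = Op2 g Y Z X.
Proof.
move=> h; rewrite Op2.unlock; apply: eq_bigr => i _; apply: eq_bigr => k _.
by rewrite h.
Qed.

Lemma ip_Op2 (f : R -> R -> R) (Y Z X : M) :
  ip (Op2 f Y Z X) X = \sum_i \sum_k f (eigval Y i) (eigval Z k) *
     ip (eproj Y i *m X *m eproj Z k) (eproj Y i *m X *m eproj Z k).
Proof.
rewrite ipC Op2.unlock ip_sumr; apply: eq_bigr => i _.
rewrite ip_sumr; apply: eq_bigr => k _; rewrite ipZr; congr (_ * _).
by apply: ip_sandwich; rewrite ?eproj_ct ?eproj_mul ?eqxx.
Qed.

Lemma Op2_pos (f : R -> R -> R) (Y Z X : M) :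
  (forall i k, 0 < f (eigval Y i) (eigval Z k)) ->
  0 <= ip (Op2 f Y Z X) X /\ (ip (Op2 f Y Z X) X = 0 -> X = 0).
Proof.
move=> f0; rewrite ip_Op2; split.
  apply: sumr_ge0 => i _; apply: sumr_ge0 => k _.
  by rewrite mulr_ge0 ?ip_ge0 // ltW.
move=> /eqP; rewrite psumr_eq0; last first.
  by move=> i _; apply: sumr_ge0 => k _; rewrite mulr_ge0 ?ip_ge0 // ltW.
move=> /allP h.
have {}h i k : eproj Y i *m X *m eproj Z k = 0.
  have /= := h i (mem_index_enum _); rewrite psumr_eq0; last first.
    by move=> l _; rewrite mulr_ge0 ?ip_ge0 // ltW.
  move=> /allP /(_ k (mem_index_enum _)) /=.
  by rewrite mulf_eq0 gt_eqF //= => /eqP/ip_eq0.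
rewrite -[X]mul1mx -(eproj_sum Y) -[_ *m X]mulmx1 -(eproj_sum Z).
rewrite mulmx_suml mulmx_suml big1 // => i _; rewrite mulmx_sumr big1 //.
Qed.

Lemma Op2_upper (f : R -> R -> R) (Y Z X : M) K :
  (forall i k, f (eigval Y i) (eigval Z k) <= K) -> ip (Op2 f Y Z X) X <= K * ip X X.
Proof.
move=> fK; rewrite ip_Op2.
have -> : ip X X = \sum_i \sum_k
     ip (eproj Y i *m X *m eproj Z k) (eproj Y i *m X *m eproj Z k).
  have := ip_Op2 (fun _ _ => 1) Y Z X.
  have -> : Op2 (fun _ _ => 1) Y Z X = X.
    rewrite Op2.unlock [RHS](eproj_expand Y Z); apply: eq_bigr => i _.
    by apply: eq_bigr => k _; rewrite scale1r.
  by move=> ->; apply: eq_bigr => i _; apply: eq_bigr => k _; rewrite mul1r.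
rewrite mulr_sumr; apply: ler_sum => i _; rewrite mulr_sumr; apply: ler_sum => k _.
by rewrite ler_wpM2r ?ip_ge0.
Qed.

Lemma GamZ (sigma : M) s (c : C) X X' :
  Gam sigma s (c *: X + X') = c *: Gam sigma s X + Gam sigma s X'.
Proof. by rewrite /Gam mulmxDr mulmxDl -scalemxAr -scalemxAl. Qed.

Lemma Gam_ct (sigma : M) s X : (Gam sigma s X)^t* = Gam sigma s (X^t*).
Proof. by rewrite /Gam !ctM mxpow_ct mulmxA. Qed.

Lemma hs_Gam (sigma : M) s X X' : hs (Gam sigma s X) X' = hs X (Gam sigma s X').
Proof. by apply: hs_sandwich; exact: mxpow_ct. Qed.

Lemma GamD (sigma : M) s t X : pd sigma -> Gam sigma s (Gam sigma t X) = Gam sigma (s + t) X.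
Proof.
move=> sp; rewrite /Gam !mulmxA mxpowD // -mulmxA mxpowD //.
by rewrite mulrDl [t / 2 + _]addrC.
Qed.

Lemma Gam0 (sigma : M) X : Gam sigma 0 X = X.
Proof. by rewrite /Gam mul0r mxpow0 mul1mx mulmx1. Qed.

Lemma Gam_pd (sigma : M) s X : pd sigma -> pd X -> pd (Gam sigma s X).
Proof.
move=> sp /(pd_sandwich (mxpow_unit (s / 2) sp)).
by rewrite mxpow_ct.
Qed.

Lemma hsBr (X Y Z : M) : hs X (Y - Z) = hs X Y - hs X Z.
Proof. by rewrite hsDr hsNr. Qed.

Lemma hsBl (X Y Z : M) : hs (X - Y) Z = hs X Z - hs Y Z.
Proof. by rewrite hsC hsBr raddfB /= -!hsC. Qed.

Lemma hs_mull (A X Y : M) : hs (A *m X) Y = hs X (A^t* *m Y).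
Proof. by rewrite /hs ctM mulmxA. Qed.

Lemma hs_mulr (A X Y : M) : hs (X *m A) Y = hs X (Y *m A^t*).
Proof. by rewrite /hs ctM -mulmxA mxtrace_mulC mulmxA. Qed.

Lemma sandwich_comm (E F Q X : M) (x y u v : C) : E *m Q = u *: E -> Q *m F = v *: F ->
  E *m (x *: (Q *m X) - y *: (X *m Q)) *m F = (x * u - y * v) *: (E *m X *m F).
Proof.
move=> EQ QF; rewrite mulmxBr mulmxBl scalerBl -!scalemxAr -!scalemxAl.
rewrite mulmxA EQ -scalemxAl -scalemxAl scalerA; congr (_ - _).
by rewrite mulmxA -(mulmxA _ Q F) QF -scalemxAr scalerA.
Qed.

(** [S] and [T] will be opposite powers of [sigma], which commute with [V] up to scalars: the
    sandwich turns a commutator into a weighted one. [conj_comm2] is the way back. *)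
Lemma conj_comm (S T V Q : M) (x y : C) : S *m T = 1%:M -> T *m S = 1%:M ->
  V *m T = x *: (T *m V) -> T *m V = y *: (V *m T) ->
  S *m (V *m (T *m Q *m T) - T *m Q *m T *m V) *m S = x *: (V *m Q) - y *: (Q *m V).
Proof.
move=> ST TS VT TV; rewrite mulmxBr mulmxBl; congr (_ - _).
  rewrite !mulmxA -(mulmxA S V T) VT -scalemxAr -!scalemxAl !mulmxA ST mul1mx.
  by rewrite -(mulmxA _ T S) TS mulmx1.
rewrite !mulmxA ST mul1mx -(mulmxA _ T V) TV -scalemxAr -!scalemxAl.
by rewrite mulmxA -(mulmxA _ T S) TS mulmx1.
Qed.

Lemma conj_comm2 (S T V Q : M) (a b x y : C) : S *m T = 1%:M -> T *m S = 1%:M ->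
  S *m V = x *: (V *m S) -> V *m S = y *: (S *m V) ->
  S *m (b *: (V *m (T *m Q *m T)) - a *: (T *m Q *m T *m V)) *m S
    = (b * x) *: (V *m Q) - (a * y) *: (Q *m V).
Proof.
move=> ST TS SV VS; rewrite mulmxBr mulmxBl -!scalemxAr -!scalemxAl.
congr (_ - _).
  rewrite !mulmxA SV -!scalemxAl -(mulmxA _ S T) ST mulmx1 -(mulmxA _ T S) TS mulmx1.
  by rewrite scalerA.
rewrite !mulmxA ST mul1mx -(mulmxA _ V S) VS -scalemxAr mulmxA -(mulmxA _ T S) TS.
by rewrite mulmx1 scalerA.
Qed.

Lemma thetaC (p x y : R) : theta p x y = theta p y x.
Proof.
rewrite /theta eq_sym; case: eqP => [->//|_].
by rewrite -[x - y]opprB -[x `^ _ - _]opprB invrN mulrNN.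
Qed.

Lemma thtC (q a b x y : R) : tht q a b x y = tht q b a y x.
Proof. exact: thetaC. Qed.

Lemma linear_of (f : M -> M) :
  (forall (c : C) X Y, f (c *: X + Y) = c *: f X + f Y) ->
  [/\ f 0 = 0, forall X Y, f (X + Y) = f X + f Y,
      forall c X, f (c *: X) = c *: f X & forall X, f (- X) = - f X].
Proof.
move=> fl; have f0 : f 0 = 0.
  have := fl (-1) 0 0; rewrite scaler0 addr0 scaleN1r => ->.
  by rewrite addrC subrr.
have fZ c X : f (c *: X) = c *: f X by have := fl c X 0; rewrite !addr0 f0 addr0.
split=> // [X Y|X]; first by have := fl 1 X Y; rewrite !scale1r.
by rewrite -scaleN1r fZ scaleN1r.
Qed.

End Operators.

(** * The metric in the variable [q = p - 1] *)

Definition sh (R : realType) (q : R) : R := (hat (q + 1))^-1.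
Definition aw (R : realType) (q w : R) : R := expR (w / (2 * (q + 1))).
Definition bw (R : realType) (q w : R) : R := expR (- (w / (2 * (q + 1)))).

(** Since [1/p - 1 = - 1/hat p], the same matrix is the argument of [theta] in the metric and the
    one whose [p]-th moment appears in [Fp]. *)
HB.lock Definition Yof (R : realType) (d : nat) (sigma : 'M[R[i]]_d) (q : R)
    (rho : 'M[R[i]]_d) : 'M[R[i]]_d :=
  Gam sigma (- sh q) rho.

HB.lock Definition br (R : realType) (d : nat) (sigma : 'M[R[i]]_d) (q : R)
    (rho : 'M[R[i]]_d) (w : R) (X : 'M[R[i]]_d) : 'M[R[i]]_d :=
  Gam sigma (sh q) (Op2 (tht q (aw q w) (bw q w)) (Yof sigma q rho)
    (Yof sigma q rho) (Gam sigma (sh q) X)).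

HB.lock Definition DD (R : realType) (d J : nat) (sigma : 'M[R[i]]_d)
    (omega : 'I_J -> R) (V : 'I_J -> 'M[R[i]]_d) (q : R)
    (rho A : 'M[R[i]]_d) : 'M[R[i]]_d :=
  \sum_j comm ((V j)^t*) (br sigma q rho (omega j) (comm (V j) A)).

(* The differential of [Fp] at [rho], where [q = p - 1]. *)
HB.lock Definition Aof (R : realType) (d : nat) (sigma : 'M[R[i]]_d) (q : R)
    (rho : 'M[R[i]]_d) : 'M[R[i]]_d :=
  (q^-1)%:C *: Gam sigma (- sh q) (mxpow (Yof sigma q rho) q).

Section Metric.
Variables (R : realType) (d J : nat).
Local Notation C := R[i].
Local Notation M := 'M[C]_d.
Variables (sigma : M) (omega : 'I_J -> R) (V : 'I_J -> M) (q : R).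
Hypotheses (q01 : 0 < q <= 1) (sp : pd sigma).

Local Notation p := (q + 1).
Local Notation sh := (sh q).
Local Notation aw := (aw q).
Local Notation bw := (bw q).
Local Notation Yof := (Yof sigma q).
Local Notation br := (br sigma q).
Local Notation DD := (DD sigma omega V q).
Local Notation Aof := (Aof sigma q).

Lemma aw0 w : 0 < aw w. Proof. exact: expR_gt0. Qed.
Lemma bw0 w : 0 < bw w. Proof. exact: expR_gt0. Qed.

Lemma awN w : aw (- w) = bw w.
Proof. by rewrite /aw /bw mulNr. Qed.

Lemma bwN w : bw (- w) = aw w.
Proof. by rewrite /aw /bw mulNr opprK. Qed.

Lemma shE : sh = q / p.
Proof. by rewrite /sh /hat invf_div addrK. Qed.

Lemma Yof_ct rho : rho^t* = rho -> (Yof rho)^t* = Yof rho.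
Proof. by move=> h; rewrite Yof.unlock Gam_ct h. Qed.

Lemma Yof_pd rho : pd rho -> pd (Yof rho).
Proof. by rewrite Yof.unlock => h; exact: Gam_pd. Qed.

Lemma bracketE rho w X : rho^t* = rho -> bracket sigma p rho w X = br rho w X.
Proof.
move=> h; have e : Gam sigma (- (hat p)^-1) rho = Yof rho by rewrite Yof.unlock.
rewrite /bracket e br.unlock; congr (Gam _ _ _).
have rY := eproj_resolution (Yof_ct h).
rewrite (mxfun2_res _ _ (scale_resolution (aw w) rY) (scale_resolution (bw w) rY)).
by rewrite Op2.unlock.
Qed.

Lemma DpE rho A : rho^t* = rho -> Dp sigma omega V p rho A = DD rho A.
Proof.
move=> h; rewrite DD.unlock; apply: eq_bigr => j _; rewrite adj_comm bracketE //.
Qed.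

Lemma brZ rho w (c : C) X Y : br rho w (c *: X + Y) = c *: br rho w X + br rho w Y.
Proof. by rewrite br.unlock GamZ Op2Z GamZ. Qed.

Lemma DDZ rho (c : C) X Y : DD rho (c *: X + Y) = c *: DD rho X + DD rho Y.
Proof.
rewrite DD.unlock scaler_sumr -big_split; apply: eq_bigr => j _ /=.
by rewrite commZ brZ commZ.
Qed.

Lemma hs_br rho w X X' : hs (br rho w X) X' = hs X (br rho w X').
Proof. by rewrite br.unlock hs_Gam hs_Op2 hs_Gam. Qed.

Lemma hs_DD rho A B : hs (DD rho A) B = hs A (DD rho B).
Proof.
rewrite DD.unlock hs_suml hs_sumr; apply: eq_bigr => j _.
by rewrite hs_comm trmxCK hs_br hs_comm.
Qed.

Lemma tr_DD rho A : \tr (DD rho A) = 0.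
Proof. by rewrite DD.unlock raddf_sum big1 // => j _; rewrite /= tr_comm. Qed.

Lemma br_ct rho w X : (br rho w X)^t* = br rho (- w) (X^t*).
Proof.
rewrite br.unlock Gam_ct Op2_ct Gam_ct awN bwN; congr (Gam _ _ _).
by apply: eq_Op2 => i k; rewrite thtC.
Qed.

Lemma ip_DD rho A : ip (DD rho A) A =
  \sum_j ip (br rho (omega j) (comm (V j) A)) (comm (V j) A).
Proof.
rewrite ipC DD.unlock ip_sumr; apply: eq_bigr => j _.
by rewrite ipC /ip hs_comm trmxCK.
Qed.

Lemma ip_br rho w X : ip (br rho w X) X =
  ip (Op2 (tht q (aw w) (bw w)) (Yof rho) (Yof rho) (Gam sigma sh X)) (Gam sigma sh X).
Proof. by rewrite /ip br.unlock hs_Gam. Qed.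

Lemma br_pos rho w X : pd rho ->
  0 <= ip (br rho w X) X /\ (ip (br rho w X) X = 0 -> X = 0).
Proof.
move=> /Yof_pd[_ h]; rewrite ip_br.
have [h1 h2] := @Op2_pos R d (tht q (aw w) (bw w)) (Yof rho) (Yof rho)
   (Gam sigma sh X) (fun i k => tht_gt0 q01 (aw0 w) (bw0 w) (h i) (h k)).
split=> // /h2 e; rewrite -[X](Gam0 sigma) -(addNr sh) -GamD // e.
by rewrite /Gam mulmx0 mul0mx.
Qed.

Lemma DD_pos rho A : pd rho ->
  0 <= ip (DD rho A) A /\ (ip (DD rho A) A = 0 -> forall j, comm (V j) A = 0).
Proof.
move=> hr; rewrite ip_DD; split.
  by apply: sumr_ge0 => j _; case: (br_pos (omega j) (comm (V j) A) hr).
move=> /eqP; rewrite psumr_eq0; last first.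
  by move=> j _; case: (br_pos (omega j) (comm (V j) A) hr).
move=> /allP h j; have /= /eqP := h j (mem_index_enum _).
by case: (br_pos (omega j) (comm (V j) A) hr) => _; apply.
Qed.

Variable L : M -> M.
Hypothesis hV : alicki_form sigma L omega V.

(** Taking adjoints sends the term of [j] to that of the index [j'] of the adjoint of [V j]; the
    frequency changes sign, which the symmetry of [theta] compensates. *)
Lemma DD_ct rho A : (DD rho A)^t* = DD rho (A^t*).
Proof.
case: hV => _ _ _ [c c0 hc] hj.
have [jp hjp] : exists jp : 'I_J -> 'I_J,
    forall j, (V j)^t* = V (jp j) /\ omega (jp j) = - omega j.
  by have [f hf] := choice hj; exists f.
(* Two indices with the same image would have equal [V], against orthogonality and [c j > 0]. *)
have inj : injective jp.
  move=> j k e; apply/eqP/negPn/negP => jk.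
  have Vjk : V j = V k.
    by have := (hjp j).1; rewrite e -(hjp k).1 => /(congr1 (fun X : M => X^t*)); rewrite !trmxCK.
  have := hc j k; rewrite (negPf jk) -Vjk hc eqxx => /(@complexI _ _ 0) cj.
  by have := c0 j; rewrite cj ltxx.
rewrite DD.unlock ct_sum [RHS](reindex_inj inj); apply: eq_bigr => j _.
have [h1 h2] := hjp j; rewrite comm_ct trmxCK br_ct comm_ct -h1 h2 trmxCK.
have [_ _ _ bN] := linear_of (brZ rho (- omega j)).
have [_ _ _ cN] := linear_of (commZ (V j)).
by rewrite bN cN opprK.
Qed.

Lemma generator_lin (c : C) X Y : L (c *: X + Y) = c *: L X + L Y.
Proof.
case: hV => hL _ _ _ _.
rewrite !hL scaler_sumr -big_split; apply: eq_bigr => j _ /=.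
have e1 : comm (c *: X + Y) (V j) = c *: comm X (V j) + comm Y (V j).
  by rewrite /comm mulmxDr mulmxDl -scalemxAr -scalemxAl scalerBr opprD addrACA.
rewrite e1 commZ mulmxDl mulmxDr -scalemxAr -scalemxAl.
move: (_ *m _) (_ *m _) (_ *m _) (_ *m _) => A1 A2 A3 A4.
move: (_)%:C (_)%:C => x y.
by rewrite !scalerDr !scalerA !(mulrC c) addrACA.
Qed.

Lemma adjL_E rho : adj L rho = \sum_j
  ((expR (- (omega j / 2)))%:C *: (V j *m rho *m (V j)^t* - (V j)^t* *m V j *m rho)
  + (expR (omega j / 2))%:C *: ((V j)^t* *m rho *m V j - rho *m V j *m (V j)^t*)).
Proof.
case: hV => hL _ _ _ _.
apply/matrixP => a b; rewrite -!hs_delta -(adj_hs _ _ generator_lin) hL hs_suml hs_sumr.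
apply: eq_bigr => j _; rewrite [LHS]hsDl [RHS]hsDr 2![in LHS]hsZl 2![in RHS]hsZr.
congr (_ + _); congr (_ * _); try exact: conjc_real.
  rewrite hs_mull trmxCK /comm hsBl (hs_mulr (V j) (delta_mx a b)).
  by rewrite (hs_mull (V j) (delta_mx a b)) -hsBr !mulmxA.
rewrite hs_mulr trmxCK /comm hsBl (hs_mulr (V j) (delta_mx a b)).
by rewrite (hs_mull (V j) (delta_mx a b)) -hsBr !mulmxA.
Qed.

(** In the spectral blocks of [sigma], the relation with [sigma] kills the block [(i, k)] of [V j]
    unless the eigenvalues have ratio [expR (- omega j)]; on the remaining blocks it can be raised
    to the power [s]. *)
Lemma mxpow_comm j (s : R) :
  mxpow sigma s *m V j = (expR (- (s * omega j)))%:C *: (V j *m mxpow sigma s).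
Proof.
case: hV => _ hs _ _ _.
have us := pd_unit sp.
have e0 : sigma *m V j = (expR (- omega j))%:C *: (V j *m sigma).
  by rewrite -(mulmxKV us (sigma *m V j)) hs scalemxAl.
have [h0 hpos] := sp; have rs := eproj_resolution h0.
have e1 i k : eigval sigma i != expR (- omega j) * eigval sigma k ->
   eproj sigma i *m V j *m eproj sigma k = 0.
  move=> ne; have := congr1 (fun X => eproj sigma i *m X *m eproj sigma k) e0.
  rewrite mulmxA (resolution_mull i rs) -!scalemxAl -scalemxAr -scalemxAl.
  rewrite -!mulmxA (resolution_mulr k rs) -!scalemxAr scalerA -rmorphM => /eqP.
  rewrite -subr_eq0 -scalerBl -rmorphB scaler_eq0 => /orP[|/eqP//].
  by move=> /eqP/(@complexI _ _ 0)/eqP; rewrite subr_eq0 (negPf ne).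
rewrite /mxpow mxfunE mulmx_suml mulmx_sumr scaler_sumr.
transitivity (\sum_i \sum_k (eigval sigma i `^ s)%:C *: (eproj sigma i *m V j *m eproj sigma k)).
  apply: eq_bigr => i _; rewrite -scaler_sumr -mulmx_sumr eproj_sum mulmx1.
  by rewrite -scalemxAl.
rewrite exchange_big; apply: eq_bigr => k _.
rewrite -scalemxAr scalerA -rmorphM.
rewrite -[V j in RHS]mul1mx -(eproj_sum sigma) !mulmx_suml scaler_sumr.
apply: eq_bigr => i _; have [e|ne] := eqVneq (eigval sigma i) (expR (- omega j) * eigval sigma k).
  congr (_%:C *: _); rewrite e powRM ?expR_ge0 ?(ltW (hpos k)) //.
  by rewrite -expRM mulNr [s * _]mulrC.
by rewrite e1 // !scaler0.
Qed.

Lemma comm_mxpow j (s : R) :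
  V j *m mxpow sigma s = (expR (s * omega j))%:C *: (mxpow sigma s *m V j).
Proof. by rewrite mxpow_comm scalerA -rmorphM -expRD subrr expR0 scale1r. Qed.

(** A noncommutative chain rule: blockwise, the difference of [q]-th powers is [pd1] times the
    difference of the arguments, and [theta = q / pd1] cancels it. *)
Lemma Op2_powers (Y : M) (a b : R) X : pd Y -> 0 < a -> 0 < b ->
  Op2 (tht q a b) Y Y ((q^-1)%:C *: (((a `^ q)%:C *: (mxpow Y q *m X))
     - (b `^ q)%:C *: (X *m mxpow Y q))) = a%:C *: (Y *m X) - b%:C *: (X *m Y).
Proof.
move=> [hY pY] a0 b0.
have rY := eproj_resolution hY; have rQ := mxfun_resolution (fun x => x `^ q) rY.
rewrite Op2.unlock [RHS](eproj_expand Y Y).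
apply: eq_bigr => i _; apply: eq_bigr => k _.
rewrite -scalemxAr -scalemxAl scalerA -rmorphM.
have e1 : eproj Y i *m mxpow Y q = (eigval Y i `^ q)%:C *: eproj Y i.
  exact: (resolution_mull i rQ).
have e2 : mxpow Y q *m eproj Y k = (eigval Y k `^ q)%:C *: eproj Y k.
  exact: (resolution_mulr k rQ).
rewrite [X in _ *: X = _](sandwich_comm X _ _ e1 e2).
rewrite [RHS](sandwich_comm X _ _ (resolution_mull i rY) (resolution_mulr k rY)).
rewrite scalerA -!rmorphM -!rmorphB -rmorphM; congr (_%:C *: _).
have := pd1E q (mulr_gt0 a0 (pY i)) (mulr_gt0 b0 (pY k)).
rewrite !powRM ?(ltW a0) ?(ltW b0) ?(ltW (pY _)) // => ->.
rewrite thtE //; have := pd1_gt0 q01 (mulr_gt0 a0 (pY i)) (mulr_gt0 b0 (pY k)).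
have : 0 < q by case/andP: q01.
move: (pd1 _ _ _) => u q0 u0; field; by rewrite !gt_eqF.
Qed.

(** Term by term: the inner [Gam] makes of [[V, A]] a weighted commutator of [V] with [Y^q],
    [Op2_powers] replaces [Y^q] by [Y], and the outer [Gam] leaves [e^(-w/2) V rho - e^(w/2) rho V],
    whose commutator with the adjoint of [V] is minus a jump term. *)
Lemma gradient_identity rho : pd rho -> DD rho (Aof rho) = - adj L rho.
Proof.
move=> hr; have pY := Yof_pd hr; have [q0 q1] := andP q01.
have p0 : p != 0 by rewrite gt_eqF //; lra.
rewrite adjL_E -sumrN DD.unlock; apply: eq_bigr => j _.
set w := omega j; set S := mxpow sigma (sh / 2); set T := mxpow sigma (- sh / 2).
have ST : S *m T = 1%:M by rewrite /S /T mxpowD // mulNr subrr mxpow0.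
have TS : T *m S = 1%:M by rewrite /S /T mxpowD // mulNr addNr mxpow0.
have VT : V j *m T = (expR (- (sh / 2 * w)))%:C *: (T *m V j).
  by rewrite /T comm_mxpow !mulNr.
have TV : T *m V j = (expR (sh / 2 * w))%:C *: (V j *m T).
  by rewrite /T mxpow_comm !mulNr opprK.
set Q := mxpow (Yof rho) q.
have cA : Gam sigma sh (comm (V j) (Aof rho)) =
   - ((q^-1)%:C *: (((aw w `^ q)%:C *: (Q *m V j)) - (bw w `^ q)%:C *: (V j *m Q))).
  rewrite Aof.unlock -/Q /Gam -/S -/T /comm -scalemxAr -scalemxAl -scalerBr -scalemxAr.
  rewrite -scalemxAl -scalerN opprB; congr (_ *: _).
  rewrite (conj_comm Q ST TS VT TV); congr (_%:C *: _ - _%:C *: _).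
    by rewrite /bw -expRM shE; congr expR; field.
  by rewrite /aw -expRM shE; congr expR; field.
rewrite br.unlock cA.
have [_ _ _ ON] := linear_of (Op2Z (tht q (aw w) (bw w)) (Yof rho) (Yof rho)).
rewrite ON Op2_powers ?aw0 ?bw0 // opprB /Gam -/S Yof.unlock /Gam -/T.
have SV : S *m V j = (expR (- (sh / 2 * w)))%:C *: (V j *m S) by rewrite /S mxpow_comm.
have VS : V j *m S = (expR (sh / 2 * w))%:C *: (S *m V j) by rewrite /S comm_mxpow.
have -> : S *m ((bw w)%:C *: (V j *m (T *m rho *m T)) -
    (aw w)%:C *: (T *m rho *m T *m V j)) *m S
   = (expR (- (w / 2)))%:C *: (V j *m rho) - (expR (w / 2))%:C *: (rho *m V j).
  rewrite (conj_comm2 rho _ _ ST TS SV VS) -!rmorphM -!expRD shE.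
  by congr (_%:C *: _ - _%:C *: _); congr expR; field.
rewrite /comm !mulmxBr !mulmxBl -!scalemxAr -!scalemxAl !mulmxA opprD !scalerBr.
move: (_ *: _) (_ *: _) (_ *: _) (_ *: _) => x y z t.
by apply/matrixP => a b; rewrite !mxE; ring.
Qed.

End Metric.

(** * Differentiability of the metric *)

Section Estimates.
Variables (R : realType) (d : nat).
Local Notation C := R[i].
Local Notation M := 'M[C]_d.

Definition lin (f : M -> M) := forall (c : C) X Y, f (c *: X + Y) = c *: f X + f Y.

Lemma lin_comp (f g : M -> M) : lin f -> lin g -> lin (f \o g).
Proof. by move=> hf hg c X Y; rewrite /= hg hf. Qed.

Lemma linB (f : M -> M) : lin f -> forall X Y, f (X - Y) = f X - f Y.
Proof. by move=> /linear_of[_ fD _ fN] X Y; rewrite fD fN. Qed.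

(* [df rho H X] is the derivative at [rho], in the direction [H], of
   [rho |-> f rho X], where [f rho] is linear; the bounds are uniform on [U]. *)
Record Est (U : M -> Prop) (K : R) (f : M -> M -> M) (df : M -> M -> M -> M) : Prop :=
  MkEst {
  est0 : 0 <= K;
  est1 : forall rho X, U rho -> nrm (f rho X) <= K * nrm X;
  est2 : forall rho rho' X, U rho -> U rho' ->
    nrm (f rho' X - f rho X) <= K * nrm (rho' - rho) * nrm X;
  est3 : forall rho rho' X, U rho -> U rho' ->
    nrm (f rho' X - f rho X - df rho (rho' - rho) X)
      <= K * nrm (rho' - rho) ^+ 2 * nrm X;
  est4 : forall rho H X, U rho -> nrm (df rho H X) <= K * nrm H * nrm X;
  est5 : forall rho rho' H X, U rho -> U rho' ->
    nrm (df rho' H X - df rho H X) <= K * nrm (rho' - rho) * nrm H * nrm X }.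

Lemma Est_comp U K f df (A B : M -> M) : lin A -> lin B -> Est U K f df ->
  exists K', Est U K' (fun rho X => A (f rho (B X))) (fun rho H X => A (df rho H (B X))).
Proof.
move=> lA lB [h0 h1 h2 h3 h4 h5].
have [KA KA0 hA] := linear_bounded lA; have [KB KB0 hB] := linear_bounded lB.
have go (Z X : M) k : nrm Z <= k * nrm (B X) -> 0 <= k -> nrm (A Z) <= KA * KB * k * nrm X.
  move=> hz k0; apply: le_trans (hA _) _; rewrite -!mulrA ler_wpM2l //.
  apply: le_trans hz _; rewrite [leRHS](_ : _ = k * (KB * nrm X)); last ring.
  by rewrite ler_wpM2l.
exists (KA * KB * K); split; first by rewrite !mulr_ge0.
- by move=> rho X hr; apply: go => //; exact: h1.
- move=> rho rho' X hr hr'; rewrite -linB // -(mulrA _ K); apply: go; first exact: h2.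
  by rewrite mulr_ge0 ?nrm_ge0.
- move=> rho rho' X hr hr'; rewrite -!linB // -(mulrA _ K); apply: go; first exact: h3.
  by rewrite mulr_ge0 ?exprn_ge0 ?nrm_ge0.
- move=> rho H X hr; rewrite -(mulrA _ K); apply: go; first exact: h4.
  by rewrite mulr_ge0 ?nrm_ge0.
- move=> rho rho' H X hr hr'; rewrite -linB //.
  rewrite [leRHS](_ : _ = KA * KB * (K * nrm (rho' - rho) * nrm H) * nrm X); last ring.
  by apply: go; rewrite ?h5 // !mulr_ge0 ?nrm_ge0.
Qed.

Lemma Est_base U U' K f df (A : M -> M) : lin A -> (forall rho, U' rho -> U (A rho)) ->
  Est U K f df ->
  exists K', Est U' K' (fun rho X => f (A rho) X) (fun rho H X => df (A rho) (A H) X).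
Proof.
move=> lA UU [h0 h1 h2 h3 h4 h5]; have [c c0 hA] := linear_bounded lA.
(* The square dominates 1, [c] and [c ^+ 2], the factors that the various estimates acquire. *)
exists (K * (1 + c) ^+ 2).
have c1 : 1 <= (1 + c) ^+ 2 by rewrite expr2; nra.
have cc : c <= (1 + c) ^+ 2 by have := sqr_ge0 c; nra.
have c2 : c ^+ 2 <= (1 + c) ^+ 2 by nra.
split; first by rewrite mulr_ge0 ?sqr_ge0.
- move=> rho X /UU hr; apply: le_trans (h1 _ _ hr) _; rewrite ler_wpM2r ?nrm_ge0 //.
  by rewrite ler_peMr.
- move=> rho rho' X /UU hr /UU hr'; apply: le_trans (h2 _ _ _ hr hr') _.
  rewrite ler_wpM2r ?nrm_ge0 // -mulrA ler_wpM2l // -linB //.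
  by apply: le_trans (hA _) _; rewrite ler_wpM2r ?nrm_ge0.
- move=> rho rho' X /UU hr /UU hr'; rewrite linB //.
  apply: le_trans (h3 _ _ _ hr hr') _.
  rewrite ler_wpM2r ?nrm_ge0 // -mulrA ler_wpM2l // -linB //.
  apply: (@le_trans _ _ ((c * nrm (rho' - rho)) ^+ 2)).
    by rewrite !expr2 ler_pM ?nrm_ge0.
  by rewrite exprMn ler_wpM2r ?sqr_ge0.
- move=> rho H X /UU hr; apply: le_trans (h4 _ _ _ hr) _.
  rewrite ler_wpM2r ?nrm_ge0 // -mulrA ler_wpM2l //.
  by apply: le_trans (hA _) _; rewrite ler_wpM2r ?nrm_ge0.
- move=> rho rho' H X /UU hr /UU hr'; apply: le_trans (h5 _ _ _ _ hr hr') _.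
  rewrite ler_wpM2r ?nrm_ge0 // -!mulrA ler_wpM2l // -linB //.
  apply: (@le_trans _ _ ((c * nrm (rho' - rho)) * (c * nrm H))).
    by rewrite ler_pM ?nrm_ge0.
  have n0 : 0 <= nrm (rho' - rho) * nrm H by rewrite mulr_ge0 ?nrm_ge0.
  by have := ler_wpM2r n0 c2; rewrite !expr2; lra.
Qed.

Lemma Est_sum (I : finType) U (f : I -> M -> M -> M) (df : I -> M -> M -> M -> M) :
  (forall i, exists K, Est U K (f i) (df i)) ->
  exists K, Est U K (fun rho X => \sum_i f i rho X) (fun rho H X => \sum_i df i rho H X).
Proof.
move=> /choice[K hK]; exists (\sum_i K i); split.
- by apply: sumr_ge0 => i _; exact: est0 (hK i).
- move=> rho X hr; apply: le_trans (nrm_sum _ _ _) _; rewrite mulr_suml.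
  by apply: ler_sum => i _; exact: est1 (hK i) _ _ hr.
- move=> rho rho' X hr hr'; rewrite -sumrB; apply: le_trans (nrm_sum _ _ _) _.
  by rewrite !mulr_suml; apply: ler_sum => i _; exact: est2 (hK i) _ _ _ hr hr'.
- move=> rho rho' X hr hr'; rewrite -!sumrB; apply: le_trans (nrm_sum _ _ _) _.
  by rewrite !mulr_suml; apply: ler_sum => i _; exact: est3 (hK i) _ _ _ hr hr'.
- move=> rho H X hr; apply: le_trans (nrm_sum _ _ _) _.
  by rewrite !mulr_suml; apply: ler_sum => i _; exact: est4 (hK i) _ _ _ hr.
- move=> rho rho' H X hr hr'; rewrite -sumrB; apply: le_trans (nrm_sum _ _ _) _.
  by rewrite !mulr_suml; apply: ler_sum => i _; exact: est5 (hK i) _ _ _ _ hr hr'.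
Qed.

Lemma Op3_pairl psi1 psi2 (Y U U' Z : M) (c : C) :
  Op3 psi1 Y Y Y (c *: U + U') Z + Op3 psi2 Y Y Y Z (c *: U + U') =
  c *: (Op3 psi1 Y Y Y U Z + Op3 psi2 Y Y Y Z U)
  + (Op3 psi1 Y Y Y U' Z + Op3 psi2 Y Y Y Z U').
Proof.
by rewrite (Op3Dl psi1 Y Y Y U U' Z c) (Op3Dr psi2 Y Y Y Z U U' c) scalerDr addrACA.
Qed.

Lemma Op3_pairr psi1 psi2 (Y U U' Z : M) (c : C) :
  Op3 psi1 Y Y Y Z (c *: U + U') + Op3 psi2 Y Y Y (c *: U + U') Z =
  c *: (Op3 psi1 Y Y Y Z U + Op3 psi2 Y Y Y U Z)
  + (Op3 psi1 Y Y Y Z U' + Op3 psi2 Y Y Y U' Z).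
Proof.
by rewrite (Op3Dr psi1 Y Y Y Z U U' c) (Op3Dl psi2 Y Y Y U U' Z c) scalerDr addrACA.
Qed.

Lemma Op2_bound (m b : R) f : BL m b (fun x y _ => f x y) -> exists2 K : R, 0 <= K &
  forall (Y Z X : M), box m b Y -> box m b Z -> nrm (Op2 f Y Z X) <= K * nrm X.
Proof.
move=> /(Op3_bound d)[K K0 h]; exists (K * nrm (1%:M : M)); first by rewrite mulr_ge0 ?nrm_ge0.
move=> Y Z X bY bZ; rewrite mxfun2_Op3; apply: le_trans (h _ _ _ _ _ bY bZ bZ) _.
by rewrite mulrAC.
Qed.

Lemma Op2_lip (m b : R) f : BL m b (fun x y _ => f x y) -> exists2 K : R, 0 <= K &
  forall (Y Z Y' Z' X : M), box m b Y -> box m b Z -> box m b Y' -> box m b Z' ->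
  nrm (Op2 f Y' Z' X - Op2 f Y Z X) <= K * (nrm (Y' - Y) + nrm (Z' - Z)) * nrm X.
Proof.
move=> /(Op3_lip d)[K K0 h]; exists (2 * K * nrm (1%:M : M)).
  by rewrite !mulr_ge0 ?nrm_ge0.
move=> Y Z Y' Z' X bY bZ bY' bZ'; rewrite !mxfun2_Op3.
apply: le_trans (h _ _ _ _ _ _ _ _ bY bZ bZ bY' bZ' bZ') _.
have := nrm_ge0 (Y' - Y); have := nrm_ge0 (Z' - Z).
have g0 : 0 <= K * nrm X * nrm (1%:M : M) by rewrite !mulr_ge0 ?nrm_ge0.
move: (nrm (Y' - Y)) (nrm (Z' - Z)) (nrm X) (nrm 1%:M) g0 => u v x i g0 v0 u0.
have : K * x * i * (u + v + v) <= K * x * i * (2 * (u + v)) by apply: ler_wpM2l; lra.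
have -> : K * (u + v + v) * x * i = K * x * i * (u + v + v) by ring.
by have -> : 2 * K * i * (u + v) * x = K * x * i * (2 * (u + v)) by ring.
Qed.

Lemma Op2_tht_Est (q a b m B : R) : 0 < q <= 1 -> 0 < a -> 0 < b -> 0 < m -> m <= B ->
  exists K, Est (box m B) K (fun Y X : M => Op2 (tht q a b) Y Y X)
    (fun Y H X => Op3 (tht1 q a b) Y Y Y H X + Op3 (tht2 q a b) Y Y Y X H).
Proof.
move=> q01 a0 b0 m0 mB.
have h := tht_BL q01 a0 b0 m0 mB; have h1 := tht1_BL q01 a0 b0 m0 mB.
have h2 := tht2_BL q01 a0 b0 m0 mB.
have pos x : m <= x <= B -> 0 < x by case/andP => /(lt_le_trans m0).
have E1 x x' y : m <= x <= B -> m <= x' <= B -> m <= y <= B ->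
   tht q a b x' y - tht q a b x y = tht1 q a b x' x y * (x' - x).
  by move=> /pos ? /pos ? /pos ?; exact: tht1E.
have E2 x y y' : m <= x <= B -> m <= y <= B -> m <= y' <= B ->
   tht q a b x y' - tht q a b x y = tht2 q a b x y' y * (y' - y).
  by move=> /pos ? /pos ? /pos ?; exact: tht2E.
have [K1 K10 e1] := Op2_bound h; have [K2 K20 e2] := Op2_lip h.
have [K3 K30 e3] := mxfun2_diff d E1 E2 h1 h2.
have [K4 K40 e4] := dmxfun2_bound d h1 h2.
have [K5 K50 e5] := dmxfun2_lip d h1 h2.
exists (K1 + 2 * K2 + K3 + K4 + K5); split; first by rewrite !addr_ge0 ?mulr_ge0.
- move=> Y X hY; apply: le_trans (e1 _ _ _ hY hY) _; rewrite ler_wpM2r ?nrm_ge0 //; lra.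
- move=> Y Y' X hY hY'; apply: le_trans (e2 _ _ _ _ _ hY hY hY' hY') _.
  rewrite ler_wpM2r ?nrm_ge0 //; have := nrm_ge0 (Y' - Y) => n0.
  rewrite -mulr2n -[_ *+ 2]mulr_natl mulrA ler_wpM2r //; lra.
- move=> Y Y' X hY hY'; apply: le_trans (e3 _ _ _ hY hY') _.
  by rewrite !ler_wpM2r ?nrm_ge0 ?exprn_ge0 ?nrm_ge0 //; lra.
- move=> Y H X hY; apply: le_trans (e4 _ _ _ hY) _.
  by rewrite !ler_wpM2r ?nrm_ge0 //; lra.
- move=> Y Y' H X hY hY'; apply: le_trans (e5 _ _ _ _ hY hY') _.
  by rewrite !ler_wpM2r ?nrm_ge0 //; lra.
Qed.

End Estimates.

HB.lock Definition dbr (R : realType) (d : nat) (sigma : 'M[R[i]]_d) (q : R)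
    (rho H : 'M[R[i]]_d) (w : R) (X : 'M[R[i]]_d) : 'M[R[i]]_d :=
  Gam sigma (sh q) (Op3 (tht1 q (aw q w) (bw q w)) (Yof sigma q rho)
      (Yof sigma q rho) (Yof sigma q rho) (Yof sigma q H) (Gam sigma (sh q) X)
   + Op3 (tht2 q (aw q w) (bw q w)) (Yof sigma q rho) (Yof sigma q rho)
      (Yof sigma q rho) (Gam sigma (sh q) X) (Yof sigma q H)).

HB.lock Definition dDD (R : realType) (d J : nat) (sigma : 'M[R[i]]_d)
    (omega : 'I_J -> R) (V : 'I_J -> 'M[R[i]]_d) (q : R)
    (rho H A : 'M[R[i]]_d) : 'M[R[i]]_d :=
  \sum_j comm ((V j)^t*) (dbr sigma q rho H (omega j) (comm (V j) A)).

HB.lock Definition dAof (R : realType) (d : nat) (sigma : 'M[R[i]]_d) (q : R)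
    (rho H : 'M[R[i]]_d) : 'M[R[i]]_d :=
  (q^-1)%:C *: Gam sigma (- sh q)
    (Op2 (pd1 q) (Yof sigma q rho) (Yof sigma q rho) (Yof sigma q H)).

Section MetricEstimates.
Variables (R : realType) (d J : nat).
Local Notation C := R[i].
Local Notation M := 'M[C]_d.
Variables (sigma : M) (omega : 'I_J -> R) (V : 'I_J -> M) (q : R).
Hypotheses (q01 : 0 < q <= 1) (sp : pd sigma).

Local Notation p := (q + 1).
Local Notation sh := (sh q).
Local Notation Yof := (Yof sigma q).
Local Notation DD := (DD sigma omega V q).
Local Notation Aof := (Aof sigma q).
Local Notation dbr := (dbr sigma q).
Local Notation dDD := (dDD sigma omega V q).
Local Notation dAof := (dAof sigma q).

Lemma Yof_lin : lin Yof. Proof. by move=> c X Y; rewrite Yof.unlock GamZ. Qed.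

(** Only self-adjoint perturbations, as the spectral estimates demand; the trace is left free. *)
Definition nearby (rho0 : M) (r : R) (rho : M) : Prop :=
  rho^t* = rho /\ nrm (rho - rho0) <= r.

Lemma Yof_inv rho : Gam sigma sh (Yof rho) = rho.
Proof. by rewrite Yof.unlock GamD // subrr Gam0. Qed.

Lemma nearby_box rho0 : pd rho0 -> exists r m b, [/\ 0 < r, 0 < m, m <= b &
  forall rho, nearby rho0 r rho -> box m b (Yof rho) /\ pd rho].
Proof.
move=> h0; have [m [b [m0 b0 hb]]] := pd_box (Yof_pd q sp h0).
have [K K0 hK] := linear_bounded Yof_lin.
have c0 := cproj_ge0 R d; have k0 : 0 < cproj R d * K + 1 by rewrite ltr_wpDl // mulr_ge0.
(* The radius lets the eigenvalues of [Yof rho] move by at most [m / 2], by [eigval_pert]. *)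
exists (m / 2 / (cproj R d * K + 1)), (m / 2), (b + m).
split; [by rewrite !divr_gt0|by rewrite divr_gt0|lra|].
move=> rho [hr nr]; have hY := Yof_ct sigma q hr.
have bx : box (m / 2) (b + m) (Yof rho).
  split=> // i; have := eigval_pert i hb hY; rewrite -(linB Yof_lin).
  have := hK (rho - rho0); rewrite ler_pdivlMr // in nr.
  have := nrm_ge0 (rho - rho0); have := nrm_ge0 (Yof (rho - rho0)).
  move: (nrm _) (nrm _) nr => u v nr u0 v0 uv /andP[h1 h2].
  have : cproj R d * u <= m / 2 by nra.
  by move=> h3; apply/andP; split; lra.
split=> //; rewrite -(Yof_inv rho); apply: Gam_pd => //.
by apply: box_pd bx; rewrite divr_gt0.
Qed.

Lemma comm_lin (X : M) : lin (comm X). Proof. by move=> c A B; exact: commZ. Qed.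

Lemma Gam_lin s : lin (Gam sigma s). Proof. by move=> c A B; exact: GamZ. Qed.

Lemma DD_Est rho0 : pd rho0 -> exists r K, [/\ 0 < r,
  forall rho, nearby rho0 r rho -> pd rho & Est (nearby rho0 r) K DD dDD].
Proof.
move=> h0; have [r [m [b [r0 m0 mb hb]]]] := nearby_box h0.
have [K hK] : exists K, Est (nearby rho0 r) K DD dDD.
  rewrite dDD.unlock DD.unlock; apply: Est_sum => j.
  have [K1 e1] := Op2_tht_Est d q01 (aw0 q (omega j)) (bw0 q (omega j)) m0 mb.
  have [K2 e2] := Est_base Yof_lin (fun rho h => (hb rho h).1) e1.
  have l1 : lin (comm ((V j)^t*) \o Gam sigma sh) := lin_comp (comm_lin _) (Gam_lin _).
  have l2 : lin (Gam sigma sh \o comm (V j)) := lin_comp (Gam_lin _) (comm_lin _).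
  by rewrite dbr.unlock br.unlock; exact: (Est_comp l1 l2 e2).
by exists r, K; split=> // rho /hb[].
Qed.

Lemma dbr_linl rho w X c H H' :
  dbr rho (c *: H + H') w X = c *: dbr rho H w X + dbr rho H' w X.
Proof.
rewrite dbr.unlock (Yof_lin c H H').
exact: etrans (congr1 (Gam sigma sh) (Op3_pairl _ _ _ _ _ _ _)) (GamZ _ _ _ _ _).
Qed.

Lemma dbr_linr rho H w c X X' :
  dbr rho H w (c *: X + X') = c *: dbr rho H w X + dbr rho H w X'.
Proof.
rewrite dbr.unlock (Gam_lin sh c X X').
exact: etrans (congr1 (Gam sigma sh) (Op3_pairr _ _ _ _ _ _ _)) (GamZ _ _ _ _ _).
Qed.

Lemma dDD_linl rho A : lin (fun H => dDD rho H A).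
Proof.
move=> c H H'; rewrite dDD.unlock scaler_sumr -big_split; apply: eq_bigr => j _ /=.
rewrite dbr_linl; exact: comm_lin.
Qed.

Lemma dDD_linr rho H : lin (fun A => dDD rho H A).
Proof.
move=> c A A'; rewrite dDD.unlock scaler_sumr -big_split; apply: eq_bigr => j _ /=.
rewrite (comm_lin (V j) c A A') dbr_linr; exact: comm_lin.
Qed.

Lemma DD_lin rho : lin (DD rho). Proof. by move=> c X Y; exact: DDZ. Qed.

Lemma tr_dDD rho H A : \tr (dDD rho H A) = 0.
Proof. by rewrite dDD.unlock raddf_sum big1 // => j _; rewrite /= tr_comm. Qed.

Lemma mxD_nearby (gam : R -> M) (s : R) D r : 0 < r -> mxD gam s D ->
  (\forall h \near (0 : R), (gam (s + h))^t* = gam (s + h)) ->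
  \forall h \near (0 : R), nearby (gam s) r (gam (s + h)).
Proof.
move=> r0 hg hh; have := mxD_cont hg r0.
by apply: filterS2 hh => h h1 h2; split.
Qed.

Lemma mxD_DD (gam A : R -> M) (s : R) D E : pd (gam s) -> mxD gam s D -> mxD A s E ->
  (\forall h \near (0 : R), (gam (s + h))^t* = gam (s + h)) ->
  mxD (fun t => DD (gam t) (A t)) s (dDD (gam s) D (A s) + DD (gam s) E).
Proof.
move=> hp hg hA hh; have [r [K [r0 _ [K0 e1 e2 e3 e4 e5]]]] := DD_Est hp.
have ng := mxD_nearby r0 hg hh; move=> e e0.
have n0 : nearby (gam s) r (gam s).
  by split; [case: hp|rewrite subrr nrm0 ltW].
pose a := nrm (A s); have a0 : 0 <= a := nrm_ge0 _.
pose c := nrm D + 1; pose c' := nrm E + 1.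
have c0 : 0 <= c by rewrite addr_ge0 ?nrm_ge0.
have c0' : 0 <= c' by rewrite addr_ge0 ?nrm_ge0.
have k0 : 0 < K * (a + 1) + 1 by rewrite ltr_wpDl // mulr_ge0 // addr_ge0.
have p1 : 0 < e / 4 / (K * (a + 1) + 1) by rewrite !divr_gt0.
have p2 : 0 <= K * c * (c * a + c') by rewrite !mulr_ge0 // addr_ge0 // mulr_ge0.
have e20 : 0 < e / 2 by rewrite divr_gt0.
have b1 := near0I (hg _ p1) (hA _ p1).
have b2 := near0I (mxD_lip hg) (mxD_lip hA).
have b3 := near0I ng (near0_small p2 e20).
have b4 := near0I b2 b3.
apply: filterS2 b1 b4 => h [h1 h2] [[h3 h4] [h5 h6]].
set G := gam (s + h); set B := A (s + h).
have [_ dD _ dN] := linear_of (dDD_linl (gam s) (A s)).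
have [_ _ dZ _] := linear_of (dDD_linl (gam s) (A s)).
have [_ DDD DDz DN] := linear_of (DD_lin (gam s)).
have [_ DDD' _ DN'] := linear_of (DD_lin G).
(* Four errors: the second order in [rho] at fixed [A s], the remainders of [gam] and of [A] under
   linear maps, and a mixed term quadratic in [h]. *)
have -> : DD G B - DD (gam s) (A s) - h%:C *: (dDD (gam s) D (A s) + DD (gam s) E) =
  (DD G (A s) - DD (gam s) (A s) - dDD (gam s) (G - gam s) (A s))
  + dDD (gam s) (G - gam s - h%:C *: D) (A s)
  + DD (gam s) (B - A s - h%:C *: E)
  + (DD G (B - A s) - DD (gam s) (B - A s)).
  rewrite !dD !dN dZ !DDD !DN DDz !DDD' !DN' scalerDr.
  move: (h%:C *: _) (h%:C *: _) (DD G B) (DD G (A s)) (DD (gam s) B) (DD (gam s) (A s)).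
  move: (dDD (gam s) G (A s)) (dDD (gam s) (gam s) (A s)) => x1 x2 x3 x4 x5 x6 x7 x8.
  by apply/matrixP => i j; rewrite !mxE; ring.
apply: le_trans (nrmD _ _) _.
apply: le_trans (lerD (nrmD _ _) (lexx _)) _.
apply: le_trans (lerD (lerD (nrmD _ _) (lexx _)) (lexx _)) _.
have t1 := e3 _ _ (A s) n0 h5; have t2 := e4 _ (G - gam s - h%:C *: D) (A s) n0.
have t3 := e1 _ (B - A s - h%:C *: E) n0; have t4 := e2 _ _ (B - A s) n0 h5.
rewrite -/a -/G in t1 t2 t3 t4 *.
have u0 : 0 <= `|h| := normr_ge0 h.
have x0 := nrm_ge0 (G - gam s); have y0 := nrm_ge0 (B - A s).
have z0 := nrm_ge0 (G - gam s - h%:C *: D); have w0 := nrm_ge0 (B - A s - h%:C *: E).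
rewrite -/c -/c' -/G -/B in h1 h2 h3 h4.
have g1 : (K * (a + 1) + 1) * nrm (G - gam s - h%:C *: D) <= e / 4 * `|h|.
  by move: h1; rewrite -[_ / _ * _]mulrAC ler_pdivlMr // mulrC.
have g2 : (K * (a + 1) + 1) * nrm (B - A s - h%:C *: E) <= e / 4 * `|h|.
  by move: h2; rewrite -[_ / _ * _]mulrAC ler_pdivlMr // mulrC.
have f1 : K * nrm (G - gam s) ^+ 2 * a <= K * (c * `|h| * (c * `|h|)) * a.
  by rewrite ler_wpM2r // ler_wpM2l // expr2 ler_pM.
have f2 : K * (nrm (G - gam s) * nrm (B - A s)) <= K * (c * `|h| * (c' * `|h|)).
  by rewrite ler_wpM2l // ler_pM.
have f3 : K * (c * `|h| * (c * `|h|)) * a + K * (c * `|h| * (c' * `|h|))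
   <= e / 2 * `|h|.
  rewrite [leLHS](_ : _ = K * c * (c * a + c') * `|h| * `|h|); last by ring.
  by rewrite ler_wpM2r.
rewrite mulrA in f2.
move: z0 w0 g1 g2 t2 t3 t1 t4 f1 f2 f3.
move: (nrm (G - gam s - h%:C *: D)) (nrm (B - A s - h%:C *: E)) => z w z0 w0 g1 g2.
have k1 : K * z * a <= e / 4 * `|h| by have := mulr_ge0 K0 z0; nra.
have k2 : K * w <= e / 4 * `|h| by have := mulr_ge0 (mulr_ge0 K0 a0) w0; nra.
lra.
Qed.

Lemma dDD_line rho W A : pd rho -> W^t* = W ->
  mxD (fun t => DD (rho + t%:C *: W) A) 0 (dDD rho W A).
Proof.
move=> hr hW; have e0 : rho + (0 : R)%:C *: W = rho by rewrite scale0r addr0.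
have := @mxD_DD (fun t => rho + t%:C *: W) (fun=> A) 0 W 0.
rewrite e0 => /(_ hr (mxD_line _ _ _) (mxD_cst _ _)).
have [D0 _ _ _] := linear_of (DD_lin rho); rewrite D0 addr0; apply.
apply: near0W => h; rewrite add0r ctD ctZr hW.
by case: hr => ->.
Qed.

Variable L : M -> M.
Hypothesis hV : alicki_form sigma L omega V.

(** Inherited from [DD_ct] along the line in direction [W], by uniqueness of derivatives. *)
Lemma dDD_ct rho W A : pd rho -> W^t* = W -> (dDD rho W A)^t* = dDD rho W (A^t*).
Proof.
move=> hr hW; apply: (mxD_unique _ (dDD_line (A^t*) hr hW)).
have := @mxD_linear R d d d d (fun X => X^t*) 1 _ _ _ _ _ _ _ (dDD_line A hr hW).
have -> : (fun t : R => (DD (rho + t%:C *: W) A)^t*) = fun t => DD (rho + t%:C *: W) (A^t*).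
  by apply/funext => t; rewrite (DD_ct q hV).
apply=> //; [by move=> *; rewrite ctD|by move=> *; rewrite ctZr|by move=> X; rewrite nrm_ct mul1r].
Qed.

Lemma dAof_lin rho : lin (dAof rho).
Proof.
move=> c X Y; rewrite dAof.unlock Yof_lin Op2Z Gam_lin scalerDr; congr (_ + _).
by rewrite !scalerA mulrC.
Qed.

(** The increment of [Y^q] is exactly [Op2 (pd1 q)] at the pair [(Y', Y)]; boundedness of [Op2]
    gives the first estimate, its Lipschitz continuity the second. *)
Lemma Aof_diff rho0 : pd rho0 -> exists r K, [/\ 0 < r, 0 <= K,
  forall rho rho', nearby rho0 r rho -> nearby rho0 r rho' ->
    nrm (Aof rho' - Aof rho) <= K * nrm (rho' - rho) &
  forall rho rho', nearby rho0 r rho -> nearby rho0 r rho' ->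
    nrm (Aof rho' - Aof rho - dAof rho (rho' - rho)) <= K * nrm (rho' - rho) ^+ 2].
Proof.
move=> h0; have [r [m [b [r0 m0 mb hb]]]] := nearby_box h0.
have BLp := pd1_BL q b m0.
have [K1 K10 e1] := Op2_bound d BLp; have [K2 K20 e2] := Op2_lip d BLp.
have [KY KY0 hY] := linear_bounded Yof_lin.
have [KG KG0 hG] := linear_bounded (Gam_lin (- sh)).
have pos x : m <= x <= b -> 0 < x by case/andP => /(lt_le_trans m0).
have E1 x x' : m <= x <= b -> m <= x' <= b ->
   x' `^ q - x `^ q = pd1 q x' x * (x' - x).
  by move=> /pos ? /pos ?; rewrite pd1E // mulrC.
have qi : 0 <= q^-1 by rewrite invr_ge0 ltW //; case/andP: q01.
have AB rho rho' : nearby rho0 r rho -> nearby rho0 r rho' ->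
   Aof rho' - Aof rho = (q^-1)%:C *: Gam sigma (- sh)
       (Op2 (pd1 q) (Yof rho') (Yof rho) (Yof (rho' - rho))).
  move=> /hb[b1 _] /hb[b2 _]; rewrite Aof.unlock -scalerBr -(linB (Gam_lin _)).
  by rewrite /mxpow (mxfun_dd E1 b1 b2) (linB Yof_lin).
exists r, (q^-1 * KG * (K1 + K2 * KY) * KY); split => //.
- by rewrite !mulr_ge0 // addr_ge0 // mulr_ge0.
- move=> rho rho' hr hr'; rewrite AB // nrmZr ger0_norm // -!mulrA ler_wpM2l //.
  apply: le_trans (hG _) _; rewrite ler_wpM2l //.
  apply: le_trans (e1 _ _ _ (hb _ hr').1 (hb _ hr).1) _.
  apply: (@le_trans _ _ (K1 * (KY * nrm (rho' - rho)))); first by rewrite ler_wpM2l.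
  rewrite ler_wpM2r ?mulr_ge0 ?nrm_ge0 // lerDl mulr_ge0 //.
move=> rho rho' hr hr'; rewrite AB // dAof.unlock -scalerBr -(linB (Gam_lin _)).
rewrite nrmZr ger0_norm // -!mulrA ler_wpM2l //.
apply: le_trans (hG _) _; rewrite ler_wpM2l //.
have b1 := (hb _ hr').1; have b2 := (hb _ hr).1.
apply: le_trans (e2 _ _ _ _ _ b2 b2 b1 b2) _.
rewrite subrr nrm0 addr0 -(linB Yof_lin).
apply: (@le_trans _ _ (K2 * (KY * nrm (rho' - rho)) * (KY * nrm (rho' - rho)))).
  by rewrite ler_pM ?mulr_ge0 ?nrm_ge0 // ler_wpM2l.
rewrite expr2 mulrDl; have n0 := nrm_ge0 (rho' - rho).
rewrite [leLHS](_ : _ = K2 * KY * (KY * (nrm (rho' - rho) * nrm (rho' - rho)))); last by ring.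
by rewrite lerDr !mulr_ge0.
Qed.

Lemma mxD_Aof (gam : R -> M) (s : R) D : pd (gam s) -> mxD gam s D ->
  (\forall h \near (0 : R), (gam (s + h))^t* = gam (s + h)) ->
  mxD (fun t => Aof (gam t)) s (dAof (gam s) D).
Proof.
move=> hp hg hh; have [r [K [r0 K0 _ e2]]] := Aof_diff hp.
have ng := mxD_nearby r0 hg hh.
have n0 : nearby (gam s) r (gam s) by split; [case: hp|rewrite subrr nrm0 ltW].
have [KT KT0 hT] := linear_bounded (dAof_lin (gam s)).
have [_ TD TZ _] := linear_of (dAof_lin (gam s)).
apply: (@mxD_comp _ _ _ _ _ Aof (dAof (gam s)) K KT) => //.
by apply: filterS ng => h h1; exact: e2.
Qed.

(** A state is a convex combination of its spectral projections. *)
Lemma full_density_nrm (rho : M) : full_density rho -> nrm rho <= cproj R d.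
Proof.
move=> /full_densityP[[hr pr] tr1]; have rE := eproj_resolution hr.
have s1 : \sum_i eigval rho i = 1.
  have := mxtrace_mxfun id rho; rewrite mxfun_id // tr1 => h.
  by apply: (@complexI R); rewrite -h.
case: (rE) => _ _ _ {1}->; apply: le_trans (nrm_sum _ _ _) _.
rewrite -[leRHS]mul1r -s1 mulr_suml; apply: ler_sum => i _.
by rewrite nrmZr gtr0_norm // ler_wpM2l ?eproj_nrm // ltW.
Qed.

(** Uniform up to the boundary of the state space: by [pd1_ge] the symbol is bounded above as soon
    as the eigenvalues of [Yof rho] are, and states are bounded. *)
Lemma DD_upper : exists2 K : R, 0 <= K & forall rho B, full_density rho ->
  ip (DD rho B) B <= K * nrm B ^+ 2.
Proof.
have [KY KY0 hY] := linear_bounded Yof_lin; have c0 := cproj_ge0 R d.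
pose m := cproj R d * (KY * cproj R d) + 1.
have m0 : 0 < m by rewrite ltr_wpDl // !mulr_ge0.
have [q0 q1] := andP q01.
suff h j : exists2 K : R, 0 <= K & forall rho B, full_density rho ->
    ip (br sigma q rho (omega j) (comm (V j) B)) (comm (V j) B) <= K * nrm B ^+ 2.
  pose K j := sval (cid2 (h j)).
  have hK j : 0 <= K j /\ forall rho B, full_density rho ->
    ip (br sigma q rho (omega j) (comm (V j) B)) (comm (V j) B) <= K j * nrm B ^+ 2.
    by rewrite /K; case: cid2.
  exists (\sum_j K j); first by apply: sumr_ge0 => j _; case: (hK j).
  move=> rho B hr; rewrite ip_DD mulr_suml; apply: ler_sum => j _.
  by case: (hK j) => _; apply.
set w := omega j; have [Kc Kc0 hc] := linear_bounded (comm_lin (V j)).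
have [KG KG0 hG] := linear_bounded (Gam_lin sh).
pose T := Num.max (aw q w) (bw q w) * m.
have T0 : 0 < T by rewrite mulr_gt0 // lt_max aw0.
pose k := q / (q * T `^ (q - 1)).
have k0 : 0 <= k by rewrite divr_ge0 ?mulr_ge0 ?powR_ge0 // ltW.
exists (k * (KG * Kc) ^+ 2); first by rewrite mulr_ge0 ?sqr_ge0.
move=> rho B hr; have [hp _] := (full_densityP rho).1 hr; rewrite ip_br.
have [hYr pY] := Yof_pd q sp hp.
have upY i : eigval (Yof rho) i <= m.
  rewrite -(ip_eigproj i hYr); apply: le_trans (ler_norm _) _.
  apply: le_trans (ip_le _ _) _; apply: (@le_trans _ _ (cproj R d * (KY * cproj R d))).
    rewrite ler_pM ?nrm_ge0 ?eigproj_nrm //.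
      exact: resolution_nrm (eig_resolution hYr) i.
    apply: le_trans (hY _) _; rewrite ler_wpM2l //; exact: full_density_nrm.
  by rewrite lerDl.
have a0 := aw0 q w; have b0 := bw0 q w.
have mx (c x : R) : 0 < c -> c <= Num.max (aw q w) (bw q w) -> 0 < x -> x <= m ->
    0 < c * x <= T.
  by move=> h1 h2 h3 h4; rewrite mulr_gt0 //= ler_pM // ltW.
apply: le_trans (Op2_upper (K := k) _ _) _.
  move=> i l; move: (eigval _ i) (eigval _ l) (upY i) (upY l) (pY i) (pY l).
  move=> x y xm ym x0 y0; rewrite (thtE q01 a0 b0 x0 y0).
  have hx : 0 < aw q w * x <= T by apply: mx => //; rewrite le_max lexx.
  have hy : 0 < bw q w * y <= T by apply: mx => //; rewrite le_max lexx orbT.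
  have h := pd1_ge q01 hx hy; have h0 : 0 < q * T `^ (q - 1) by rewrite mulr_gt0 ?powR_gt0.
  by rewrite /k ler_wpM2l ?(ltW q0) // lef_pV2 ?posrE // (lt_le_trans h0).
rewrite -mulrA ler_wpM2l //; apply: le_trans (ler_norm _) _.
apply: le_trans (ip_le _ _) _.
have g : nrm (Gam sigma sh (comm (V j) B)) <= KG * Kc * nrm B.
  by apply: le_trans (hG _) _; rewrite -mulrA ler_wpM2l.
by rewrite -exprMn expr2 ler_pM ?nrm_ge0.
Qed.

End MetricEstimates.

(** * Christoffel symbols and geodesics *)

Section TracelessSelfAdjoint.
Variables (R : realType) (d : nat).
Hypothesis d0 : (0 < d)%N.
Local Notation C := R[i].
Local Notation M := 'M[C]_d.

(* The orthogonal projection onto the traceless self-adjoint matrices. *)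
Definition pT (X : M) : M :=
  (2^-1)%:C *: (X + X^t*) - (complex.Re (\tr X) / d%:R)%:C%:M.

Lemma dR0 : (d%:R : R) != 0. Proof. by rewrite pnatr_eq0 -lt0n. Qed.

Lemma scal_ct (r : R) : (r%:C%:M : M)^t* = r%:C%:M.
Proof. by rewrite tr_scalar_mx map_scalar_mx; congr (_%:M); exact: conjc_real. Qed.

Lemma traceless_saP (X : M) : traceless_sa X <-> X^t* = X /\ \tr X = 0.
Proof. by split=> -[h1 h2]; split=> //; apply/hermP. Qed.

Lemma addC_conj (z : C) : z + z^* = (2 * complex.Re z)%:C.
Proof. by case: z => a b; apply/eqP; rewrite eq_complex /=; apply/andP; split; apply/eqP; ring. Qed.

Lemma pT_in X : traceless_sa (pT X).
Proof.
apply/traceless_saP; split.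
  by rewrite /pT ctB ctZr ctD trmxCK scal_ct addrC [X^t* + _]addrC addrC.
rewrite /pT mxtraceD raddfN /= mxtraceZ mxtraceD tr_ct addC_conj mxtrace_scalar.
rewrite -rmorphM -rmorphMn -rmorphB -[(_ / _) *+ d]mulr_natr divfK ?dR0 //.
by rewrite mulrA mulVf // mul1r subrr.
Qed.

Lemma pT_id X : traceless_sa X -> pT X = X.
Proof.
move=> /traceless_saP[h t]; rewrite /pT h t /= mul0r raddf0 subr0 scalerDr -scalerDl -rmorphD.
have -> : (2^-1 + 2^-1 : R) = 1 by lra.
by rewrite rmorph1 scale1r.
Qed.

Lemma pTD X Y : pT (X + Y) = pT X + pT Y.
Proof.
have sD (a b : R) : ((a + b)%:C%:M : M) = a%:C%:M + b%:C%:M by rewrite rmorphD raddfD.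
by rewrite /pT ctD mxtraceD ReD mulrDl sD [X + Y + _]addrACA scalerDr opprD [LHS]addrACA.
Qed.

Lemma pTZ (c : R) X : pT (c%:C *: X) = c%:C *: pT X.
Proof.
rewrite /pT ctZr mxtraceZ ReZ -scalerDr scalerBr !scalerA mulrC; congr (_ - _).
by rewrite scale_scalar_mx -rmorphM mulrA.
Qed.

Lemma ip_scalar (r : R) W : ip (r%:C%:M : M) W = r * complex.Re (\tr W).
Proof. by rewrite /ip /hs scal_ct mul_scalar_mx mxtraceZ ReZ. Qed.

Lemma pTN X : pT (- X) = - pT X.
Proof. by rewrite -scaleN1r -(rmorphN1 (real_complex R)) pTZ rmorphN1 scaleN1r. Qed.

Lemma ip_pT X W : traceless_sa W -> ip (pT X) W = ip X W.
Proof.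
move=> /traceless_saP[h t]; rewrite /pT ipBl ip_scalar t mulr0 subr0 ipZl ipDl.
have -> : ip (X^t*) W = ip X W.
  rewrite -{1}h /ip /hs trmxCK -[LHS]Re_conj -tr_ct ctM trmxCK mxtrace_mulC.
  by [].
by move: (ip X W) => x; lra.
Qed.

Lemma pT_bounded : exists2 K : R, 0 <= K & forall X, nrm (pT X) <= K * nrm X.
Proof.
exists (1 + nrm (1%:M : M)); first by rewrite addr_ge0 ?nrm_ge0.
move=> X; rewrite /pT; apply: le_trans (nrmB _ _) _; rewrite mulrDl mul1r lerD //.
  rewrite nrmZr ger0_norm ?invr_ge0 //.
  have := nrmD X (X^t*); rewrite nrm_ct; lra.
rewrite -[X in nrm X]scalemx1 nrmZr mulrC ler_wpM2l ?nrm_ge0 //.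
rewrite normrM; apply: (@le_trans _ _ (nrm X * 1)); last by rewrite mulr1.
rewrite ler_pM //.
  by apply: le_trans (Re_le_n1 _) _; exact: n1_tr.
rewrite normfV ger0_norm // invf_le1 ?ltr0n //.
by rewrite ler1n.
Qed.

Lemma lin_inverse (f : M -> M) : lin f -> (forall X, f X = 0 -> X = 0) ->
  exists g, [/\ lin g, cancel f g & cancel g f].
Proof.
move=> fl fi.
pose F := HB.pack_for {linear M -> M} f (GRing.isLinear.Build C _ _ _ f fl).
pose A := lin_mx F.
have fA X : mxvec (f X) = mxvec X *m A by rewrite mul_vec_lin.
have uA : A \in unitmx.
  rewrite -row_free_unit -kermx_eq0; apply/eqP/row_matrixP => i; rewrite row0.
  have : row i (kermx A) *m A = 0 by rewrite -row_mul mulmx_ker row0.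
  rewrite -{1}[row i (kermx A)]vec_mxK -fA => /(congr1 vec_mx).
  rewrite mxvecK linear0 => /fi /(congr1 mxvec).
  by rewrite vec_mxK linear0.
exists (fun Y => vec_mx (mxvec Y *m invmx A)); split.
- by move=> c X Y; rewrite linearP mulmxDl -scalemxAl linearP.
- by move=> X; rewrite fA mulmxK // mxvecK.
- by move=> Y; apply: (can_inj mxvecK); rewrite fA vec_mxK mulmxKV.
Qed.

End TracelessSelfAdjoint.

(* The gradient of [w |-> ip (dDD rho w A) A], see [ip_Kmx]: the force term of
   Hamilton's equations. *)
HB.lock Definition Kmx (R : realType) (d J : nat) (sigma : 'M[R[i]]_d)
    (omega : 'I_J -> R) (V : 'I_J -> 'M[R[i]]_d) (q : R)
    (rho A : 'M[R[i]]_d) : 'M[R[i]]_d :=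
  \matrix_(a, b) (hs A (dDD sigma omega V q rho (delta_mx a b) A))^*.

Section Geodesics.
Variables (R : realType) (d J : nat).
Hypothesis d0 : (0 < d)%N.
Local Notation C := R[i].
Local Notation M := 'M[C]_d.
Variables (sigma : M) (omega : 'I_J -> R) (V : 'I_J -> M) (q : R) (L : M -> M).
Hypotheses (q01 : 0 < q <= 1) (sp : pd sigma) (hV : alicki_form sigma L omega V).
Hypothesis hker : forall A, A^t* = A -> (forall j, comm (V j) A = 0) ->
  exists c : C, A = c%:M.

Local Notation p := (q + 1).
Local Notation DD := (DD sigma omega V q).
Local Notation dDD := (dDD sigma omega V q).
Local Notation Kmx := (Kmx sigma omega V q).
Local Notation Gp := (Dpinv sigma omega V p).
Local Notation g := (gp sigma omega V p).

(** The family [V] is closed under adjoints, hence so is its commutant, and [hker] applies to both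
    self-adjoint parts of [A]. *)
Lemma hkerC A : (forall j, comm (V j) A = 0) -> exists c : C, A = c%:M.
Proof.
move=> h; case: (hV) => _ _ _ _ hj.
have h' j : comm (V j) (A^t*) = 0.
  have [j' [e _]] := hj j.
  by rewrite -(trmxCK (V j)) -[LHS]opprK -comm_ct e h ct0 oppr0.
have cl j c X Y : comm (V j) (c *: X + Y) = c *: comm (V j) X + comm (V j) Y := commZ _ _ _ _.
have h1 j : comm (V j) (A + A^t*) = 0.
  by have := cl j 1 A (A^t*); rewrite !scale1r h h' addr0.
have h2 j : comm (V j) ('i *: A + (- 'i) *: A^t*) = 0.
  have [_ _ cZ _] := linear_of (commZ (V j)).
  by rewrite cl cZ h h' !scaler0 addr0.
have [|c1 e1] := hker _ h1; first by rewrite ctD trmxCK addrC.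
have [|c2 e2] := hker _ h2.
  have cNi (X : M) : (- 'i *: X)^t* = 'i *: X^t* by rewrite scaleNr ctN ct_i scaleNr opprK.
  by rewrite ctD ct_i cNi trmxCK addrC.
exists (2^-1 * (c1 - 'i * c2)).
have : 2 *: A = (c1 - 'i * c2)%:M.
  rewrite raddfB /= -scale_scalar_mx -e1 -e2 scalerDr !scalerA mulrN -expr2 sqr_i.
  rewrite scaleN1r opprK scale1r opprD addrACA subrr addr0 opprK.
  by rewrite scaler_nat mulr2n.
move=> e; by rewrite -scale_scalar_mx -e scalerA mulVf ?scale1r // pnatr_eq0.
Qed.

Lemma DD_inj rho A : pd rho -> DD rho A = 0 -> \tr A = 0 -> A = 0.
Proof.
move=> hr hA tA; have [_ hk] := DD_pos omega V q01 sp A hr.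
have {}hk : forall j, comm (V j) A = 0 by apply: hk; rewrite hA ipC ip0r.
have [c e] := hkerC hk; rewrite e in tA *.
move: tA => /eqP; rewrite mxtrace_scalar -mulr_natr mulf_eq0 pnatr_eq0.
rewrite -[(d == 0)%N]negbK -lt0n d0 orbF.
by move=> /eqP ->; rewrite raddf0.
Qed.

(** [DD rho] kills scalars and has traceless range. Adding [tr A] times the identity makes it
    injective on all matrices, and the inverse of the sum restricts to traceless ones. *)
Lemma DD_inverse rho : pd rho -> exists G : M -> M, [/\ lin G,
  forall A, \tr A = 0 -> G (DD rho A) = A &
  forall nu, traceless_sa nu -> traceless_sa (G nu) /\ DD rho (G nu) = nu].
Proof.
move=> hr; pose f (A : M) : M := DD rho A + (\tr A)%:M.
have fl : lin f.
  move=> c X Y; rewrite /f DDZ mxtraceD mxtraceZ raddfD /= scalerDr addrACA.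
  by rewrite scale_scalar_mx.
have trf A : \tr (f A) = \tr A * d%:R.
  by rewrite /f mxtraceD tr_DD add0r mxtrace_scalar mulr_natr.
have dC : (d%:R : C) != 0 by rewrite pnatr_eq0 -lt0n.
have fi X : f X = 0 -> X = 0.
  move=> e; have := trf X; rewrite e mxtrace0 => /esym/eqP.
  rewrite mulf_eq0 (negPf dC) orbF => /eqP t0.
  by apply: (DD_inj hr) => //; move: e; rewrite /f t0 raddf0 addr0.
have [G [Gl fG Gf]] := lin_inverse fl fi; exists G; split=> //.
  by move=> A tA; rewrite -[RHS]fG /f tA raddf0 addr0.
move=> nu /traceless_saP[hn tn].
have tG : \tr (G nu) = 0.
  have := trf (G nu); rewrite Gf tn => /esym/eqP.
  by rewrite mulf_eq0 (negPf dC) orbF => /eqP.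
have eG : DD rho (G nu) = nu by rewrite -[RHS]Gf /f tG raddf0 addr0.
split=> //; apply/traceless_saP; split=> //.
apply/eqP; rewrite -subr_eq0; apply/eqP; apply: (DD_inj hr).
  have [_ DDD _ DN] := linear_of (DDZ sigma omega V q rho).
  by rewrite DDD DN -(DD_ct q hV) eG hn subrr.
by rewrite mxtraceD raddfN /= tr_ct tG conjc0 subrr.
Qed.

Lemma DpinvP rho nu : pd rho -> traceless_sa nu ->
  traceless_sa (Gp rho nu) /\ DD rho (Gp rho nu) = nu.
Proof.
move=> hr hn; have [G [_ _ hG]] := DD_inverse hr; have [h1 h2] := hG nu hn.
have ex : exists A, traceless_sa A /\ Dp sigma omega V p rho A = nu.
  by exists (G nu); split=> //; rewrite DpE //; case: hr.
have := xgetPex 0 ex; rewrite -/(Dpinv sigma omega V p rho nu) /= => -[h3 h4].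
split=> //; rewrite -[RHS]h4 DpE //; by case: hr.
Qed.

Lemma Dpinv_uniq rho nu A : pd rho -> traceless_sa A -> DD rho A = nu -> Gp rho nu = A.
Proof.
move=> hr hA e; have hn : traceless_sa nu.
  apply/traceless_saP; rewrite -e tr_DD (DD_ct q hV); split=> //.
  by case/traceless_saP: hA => ->.
have [h1 h2] := DpinvP hr hn.
have [G [_ GK _]] := DD_inverse hr.
case/traceless_saP: h1 => _ t1; case/traceless_saP: hA => _ t2.
by rewrite -(GK _ t1) h2 -e GK.
Qed.

Lemma gpE rho u v : g rho u v = ip (Gp rho u) v. Proof. by []. Qed.

Lemma ip_DD_sym rho A B : ip (DD rho A) B = ip A (DD rho B).
Proof. by rewrite /ip hs_DD. Qed.

Lemma gp_sym rho u v : pd rho -> traceless_sa u -> traceless_sa v ->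
  ip (Gp rho u) v = ip u (Gp rho v).
Proof.
move=> hr hu hv; have [_ e1] := DpinvP hr hu; have [_ e2] := DpinvP hr hv.
by rewrite -{1}e2 -ip_DD_sym e1.
Qed.

Lemma traceless_saB (X Y : M) : traceless_sa X -> traceless_sa Y -> traceless_sa (X - Y).
Proof.
move=> /traceless_saP[h1 t1] /traceless_saP[h2 t2]; apply/traceless_saP.
by rewrite ctB h1 h2 mxtraceD raddfN /= t1 t2 subrr.
Qed.

(** A perturbation argument: for [A = Gp rho nu], inverting [DD rho0] bounds [A] by [nu] and
    [(DD rho - DD rho0) A]. The radius makes the latter at most half of [A], whence the factor 2. *)
Lemma Dpinv_bounded rho0 : pd rho0 -> exists r K, [/\ 0 < r, 0 <= K,
  forall rho, nearby rho0 r rho -> pd rho &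
  forall rho nu, nearby rho0 r rho -> traceless_sa nu -> nrm (Gp rho nu) <= K * nrm nu].
Proof.
move=> h0; have [r [K [r0 hp [K0 _ e2 _ _ _]]]] := DD_Est omega V q01 sp h0.
have [G [Gl GK _]] := DD_inverse h0; have [k k0 hk] := linear_bounded Gl.
have c0 : 0 < 2 * (k * K + 1) by rewrite mulr_gt0 // ltr_wpDl // mulr_ge0.
have n0 : nearby rho0 r rho0 by split; [case: h0|rewrite subrr nrm0 ltW].
pose r' := Num.min r (2 * (k * K + 1))^-1.
have sub rho : nearby rho0 r' rho -> nearby rho0 r rho.
  by move=> [h1 h2]; split=> //; apply: le_trans h2 _; rewrite ge_min lexx.
exists r', (2 * k); split; [by rewrite lt_min r0 invr_gt0|by rewrite mulr_ge0| |].
  by move=> rho /sub; exact: hp.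
move=> rho nu hr hn; have hpr := hp _ (sub _ hr).
have [h1 h2] := DpinvP hpr hn; case/traceless_saP: h1 => _ t1.
set A := Gp rho nu in h2 t1 *.
have b1 : nrm A <= k * nrm (DD rho0 A) by rewrite -{1}(GK _ t1); exact: hk.
have b2 : nrm (DD rho0 A) <= nrm nu + nrm (DD rho A - DD rho0 A).
  rewrite -h2 -[X in nrm X <= _](subrK (DD rho A)) addrC (nrmBC (DD rho A)).
  exact: nrmD.
have b3 := e2 _ _ A n0 (sub _ hr).
have b4 : nrm (rho - rho0) <= (2 * (k * K + 1))^-1.
  by case: hr => _ /le_trans; apply; rewrite ge_min lexx orbT.
have b5 : k * K * nrm (rho - rho0) <= 2^-1.
  apply: (@le_trans _ _ (k * K * (2 * (k * K + 1))^-1)).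
    by rewrite ler_wpM2l ?mulr_ge0.
  rewrite invfM mulrCA ler_piMr ?invr_ge0 // ler_pdivrMr; last by rewrite ltr_wpDl // mulr_ge0.
  by rewrite mul1r lerDl.
have A0 := nrm_ge0 A.
have b6 : k * nrm (DD rho0 A) <= k * (nrm nu + K * nrm (rho - rho0) * nrm A).
  by rewrite ler_wpM2l // (le_trans b2) // lerD2l.
have b7 : k * K * nrm (rho - rho0) * nrm A <= 2^-1 * nrm A by rewrite ler_wpM2r.
rewrite mulrDr !mulrA in b6; lra.
Qed.

Lemma dmetricE rho w u v : pd rho -> w^t* = w -> traceless_sa u -> traceless_sa v ->
  dmetric g rho w u v = - ip (dDD rho w (Gp rho u)) (Gp rho v).
Proof.
move=> hr hw hu hv; rewrite /dmetric derive1E; apply: derive_val.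
apply/is_deriveP => e e0.
have [r1 [K1 [r10 K10 hp1 hG]]] := Dpinv_bounded hr.
have [r2 [K2 [r20 hp2 [K20 _ e2 e3 e4 _]]]] := DD_Est omega V q01 sp hr.
set A0 := Gp rho u; set B := Gp rho v.
have [hA0 eA0] := DpinvP hr hu; have [hB eB] := DpinvP hr hv.
rewrite -/A0 in hA0 eA0; rewrite -/B in hB eB.
pose a := K1 * nrm u; pose n := nrm w.
have a0 : 0 <= a by rewrite mulr_ge0 ?nrm_ge0.
have n0 : 0 <= n := nrm_ge0 w.
pose cst := (K2 * n ^+ 2 * a + K2 * n * (K1 * (K2 * n * a))) * nrm B.
have cst0 : 0 <= cst.
  have k1 : 0 <= K2 * n ^+ 2 * a := mulr_ge0 (mulr_ge0 K20 (exprn_ge0 2 n0)) a0.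
  have k2 : 0 <= K2 * n * (K1 * (K2 * n * a)).
    exact: mulr_ge0 (mulr_ge0 K20 n0) (mulr_ge0 K10 (mulr_ge0 (mulr_ge0 K20 n0) a0)).
  by rewrite mulr_ge0 ?nrm_ge0 // addr_ge0.
have s1 := near0I (near0_small n0 r10) (near0_small n0 r20).
apply: filterS2 s1 (near0_small cst0 e0) => h [h1 h2] h3.
rewrite add0r scale0r addr0.
set rh := rho + h%:C *: w.
have dr : rh - rho = h%:C *: w by rewrite /rh addrC addKr.
have nr : nrm (rh - rho) = n * `|h| by rewrite dr nrmZr mulrC.
have hrh : rh^t* = rh by rewrite /rh ctD ctZr hw; case: hr => ->.
have nb1 : nearby rho r1 rh by split; rewrite ?nr.
have nb2 : nearby rho r2 rh by split; rewrite ?nr.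
have nb0 : nearby rho r2 rho by split; [case: hr|rewrite subrr nrm0 ltW].
have nb01 : nearby rho r1 rho by split; [case: hr|rewrite subrr nrm0 ltW].
have ph := hp1 _ nb1; have [hAh eAh] := DpinvP ph hu.
set Ah := Gp rh u in hAh eAh *.
have bA : nrm Ah <= a by exact: hG.
rewrite !gpE -/A0 -/Ah; clearbody A0 B Ah rh.
have [_ DDD _ DN] := linear_of (DDZ sigma omega V q rho).
(* The resolvent identity, tested against [v = DD rho B]: exact, so only [DD] remains to be expanded
   in [h]. *)
have eq1 : ip Ah v - ip A0 v = - ip (DD rh Ah - DD rho Ah) B.
  have x1 : ip Ah v = ip (DD rho Ah) B.
    exact: etrans (congr1 (ip Ah) (esym eB)) (esym (ip_DD_sym rho Ah B)).
  have x2 : ip A0 v = ip (DD rh Ah) B.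
    apply: etrans (congr1 (ip A0) (esym eB)) (etrans (esym (ip_DD_sym rho A0 B)) _).
    have e12 : DD rho A0 = DD rh Ah := etrans eA0 (esym eAh).
    by rewrite e12.
  apply: etrans (f_equal2 (fun y z : R => y - z) x1 x2) _.
  exact: etrans (esym (opprB _ _)) (congr1 -%R (esym (ipBl _ _ _))).
have hd : traceless_sa (DD rho Ah - u).
  apply: traceless_saB => //; apply/traceless_saP; rewrite tr_DD (DD_ct q hV).
  by case/traceless_saP: hAh => ->.
have eq2 : Ah - A0 = Gp rho (DD rho Ah - u).
  apply/esym; apply: (Dpinv_uniq hr (traceless_saB hAh hA0)).
  by rewrite DDD DN eA0.
have bd : nrm (Ah - A0) <= K1 * (K2 * n * a) * `|h|.
  rewrite eq2; apply: le_trans (hG _ _ nb01 hd) _; rewrite -mulrA ler_wpM2l //.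
  rewrite -{1}eAh nrmBC; apply: le_trans (e2 _ _ _ nb0 nb2) _.
  rewrite nr [leRHS](_ : _ = K2 * (n * `|h|) * a); last by ring.
  by rewrite ler_wpM2l ?mulr_ge0.
rewrite eq1 mulrN opprK -ipZl.
have [_ dD dZ dN] := linear_of (dDD_linr sigma omega V q rho w).
have [_ _ dZl _] := linear_of (dDD_linl sigma omega V q rho Ah).
rewrite addrC -ipBl.
have -> : h%:C *: dDD rho w A0 - (DD rh Ah - DD rho Ah) =
   - ((DD rh Ah - DD rho Ah - dDD rho (rh - rho) Ah) + h%:C *: dDD rho w (Ah - A0)).
  rewrite dr dZl dD dN scalerBr.
  move: (h%:C *: dDD rho w Ah) (h%:C *: dDD rho w A0) (DD rh Ah) (DD rho Ah) => x y z t.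
  by apply/matrixP => i j; rewrite !mxE; ring.
rewrite ipNl normrN; apply: le_trans (ip_le _ _) _.
apply: (@le_trans _ _ (cst * `|h| * `|h|)); last by rewrite ler_wpM2r.
rewrite /cst -!mulrA [nrm B * _]mulrC !mulrA ler_wpM2r ?nrm_ge0 //.
apply: le_trans (nrmD _ _) _.
have t1 := e3 _ _ Ah nb0 nb2; have t2 := e4 _ w (Ah - A0) nb0.
rewrite nr in t1.
have f1 : K2 * (n * `|h|) ^+ 2 * nrm Ah <= K2 * (n * `|h|) ^+ 2 * a.
  by rewrite ler_wpM2l ?mulr_ge0 ?exprn_ge0 ?mulr_ge0.
have f2 : nrm (h%:C *: dDD rho w (Ah - A0)) <= `|h| * (K2 * n * (K1 * (K2 * n * a) * `|h|)).
  rewrite nrmZr ler_wpM2l //; apply: le_trans t2 _.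
  by rewrite ler_wpM2l ?mulr_ge0.
apply: le_trans (lerD (le_trans t1 f1) f2) _.
rewrite le_eqVlt; apply/orP; left; apply/eqP.
by rewrite /a /n; move: (nrm u) (nrm w) `|h| => x y z; ring.
Qed.

Lemma hs_delta_sum (X Y : M) : hs X Y = \sum_a \sum_b (X a b)^* * Y a b.
Proof.
rewrite /hs /mxtrace exchange_big /=; apply: eq_bigr => b _.
by rewrite !mxE; apply: eq_bigr => a _; rewrite !mxE.
Qed.

Lemma hs_Kmx rho A w : hs (Kmx rho A) w = hs A (dDD rho w A).
Proof.
rewrite hs_delta_sum {2}[w]matrix_sum_delta.
have [_ dD dZ _] := linear_of (dDD_linl sigma omega V q rho A).
have ds I (r : seq I) (F : I -> M) : dDD rho (\sum_(i <- r) F i) A = \sum_(i <- r) dDD rho (F i) A.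
  elim: r => [|x s IH]; last by rewrite !big_cons dD IH.
  by rewrite !big_nil -[X in dDD rho X A](scale0r 0) dZ scale0r.
rewrite ds hs_sumr; apply: eq_bigr => a _; rewrite ds hs_sumr; apply: eq_bigr => b _.
rewrite (dZ (w a b)) [RHS]hsZr Kmx.unlock mxE [RHS]mulrC; congr (_ * _).
exact: conjCK.
Qed.

Lemma ip_Kmx rho A w : ip (Kmx rho A) w = ip (dDD rho w A) A.
Proof. by rewrite /ip hs_Kmx hsC Re_conj. Qed.

(* With [u = DD rho A] the Koszul formula only involves [dDD rho _ A] by
   [dmetricE], so the geodesic equation is that of the Hamiltonian flow. *)
Lemma christoffelE rho A a1 : pd rho -> traceless_sa A -> traceless_sa a1 ->
  (forall w, traceless_sa w -> ip a1 w = - (2^-1 * ip (dDD rho w A) A)) ->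
  christoffel g rho (DD rho A) (DD rho A) = - (dDD rho (DD rho A) A + DD rho a1).
Proof.
move=> hr hA ha1 e1; set u := DD rho A.
have [hAh hAt] := (traceless_saP A).1 hA.
have hu : traceless_sa u.
  by apply/traceless_saP; rewrite tr_DD (DD_ct q hV) hAh.
have [huh _] := (traceless_saP u).1 hu.
have Gu : Gp rho u = A by apply: Dpinv_uniq.
set c := - (dDD rho u A + DD rho a1).
have hc : traceless_sa c.
  apply/traceless_saP; split.
    rewrite /c ctN ctD (dDD_ct q01 sp hV) // (DD_ct q hV) hAh.
    by case/traceless_saP: ha1 => ->.
  by rewrite raddfN /= mxtraceD tr_DD tr_dDD addr0 oppr0.
(* As [christoffel] is a choice by [xget], its value is known once [c] is the only solution
   ([solves]) and is a solution ([csol]). *)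
have solves a : (traceless_sa a /\ forall w, traceless_sa w ->
    2 * g rho a w = dmetric g rho u u w + dmetric g rho u u w - dmetric g rho w u u) ->
    a = c.
  move=> [ha ea].
  have key w : traceless_sa w -> ip (Gp rho a - Gp rho c) w = 0.
    move=> hw; have [hwh _] := (traceless_saP w).1 hw.
    have := ea w hw; rewrite !dmetricE // Gu gpE => ea'.
    have [hB eB] := DpinvP hr hw; set B := Gp rho w in ea' hB eB.
    rewrite ipBl (gp_sym hr hc hw) -/B /c ipNl ipDl ip_DD_sym eB e1 //.
    by move: ea'; lra.
  have [h1 e2] := DpinvP hr ha; have [h2 e3] := DpinvP hr hc.
  have := key _ (traceless_saB h1 h2) => /ip_eq0/eqP; rewrite subr_eq0 => /eqP ee.
  by rewrite -e2 ee e3.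
have csol : traceless_sa c /\ forall w, traceless_sa w ->
    2 * g rho c w = dmetric g rho u u w + dmetric g rho u u w - dmetric g rho w u u.
  split=> // w hw; have [hwh _] := (traceless_saP w).1 hw.
  rewrite !dmetricE // Gu gpE; have [hB eB] := DpinvP hr hw; set B := Gp rho w in hB eB *.
  rewrite (gp_sym hr hc hw) -/B /c ipNl ipDl ip_DD_sym eB e1 //; lra.
apply: solves; have := xgetPex 0 (ex_intro (fun a => traceless_sa a /\ forall w, traceless_sa w ->
    2 * g rho a w = dmetric g rho u u w + dmetric g rho u u w - dmetric g rho w u u) c csol).
by [].
Qed.

End Geodesics.

(** * Existence of geodesics by the Hamiltonian flow *)

Section GeodesicExistence.
Variables (R : realType) (d J : nat).
Hypothesis d0 : (0 < d)%N.
Local Notation C := R[i].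
Local Notation M := 'M[C]_d.
Variables (sigma : M) (omega : 'I_J -> R) (V : 'I_J -> M) (q : R) (L : M -> M).
Hypotheses (q01 : 0 < q <= 1) (sp : pd sigma) (hV : alicki_form sigma L omega V).
Hypothesis hker : forall A, A^t* = A -> (forall j, comm (V j) A = 0) ->
  exists c : C, A = c%:M.

Local Notation p := (q + 1).
Local Notation DD := (DD sigma omega V q).
Local Notation dDD := (dDD sigma omega V q).
Local Notation Kmx := (Kmx sigma omega V q).
Local Notation g := (gp sigma omega V p).

Lemma Kmx_lip (U : M -> Prop) (K a : R) (rho rho' A B : M) :
  Est U K DD dDD -> U rho -> U rho' -> 0 <= a -> nrm A <= a -> nrm B <= a ->
  nrm (Kmx rho A - Kmx rho' B) <=
    d%:R * d%:R * (K * (2 * a * nrm (A - B) + a ^+ 2 * nrm (rho - rho'))).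
Proof.
move=> [K0 _ _ _ e4 e5] hr hr' a0 hA hB; apply: nrm_le_entry => i j.
rewrite Kmx.unlock !mxE -raddfB /=.
set E := delta_mx i j.
have nE : nrm E = 1 by exact: nrm_delta.
apply: le_trans (_ : n1 (hs A (dDD rho E A) - hs B (dDD rho' E B)) <= _).
  by rewrite [leLHS]n1_conj.
have [_ dD _ dN] := linear_of (dDD_linr sigma omega V q rho' E).
have -> : hs A (dDD rho E A) - hs B (dDD rho' E B) =
  hs (A - B) (dDD rho E A) + hs B (dDD rho E A - dDD rho' E A)
  + hs B (dDD rho' E (A - B)).
  rewrite dD dN hsBl !hsBr.
  move: (hs A (dDD rho E A)) (hs B (dDD rho E A)) (hs B (dDD rho' E A)) => x y z.
  by rewrite [y - z]addrC addrA !addrA; ring.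
apply: le_trans (n1D _ _) _; apply: le_trans (lerD (n1D _ _) (lexx _)) _.
have t1 := n1_hs (A - B) (dDD rho E A).
have t2 := n1_hs B (dDD rho E A - dDD rho' E A).
have t3 := n1_hs B (dDD rho' E (A - B)).
have b1 := e4 _ E A hr; have b2 := e5 _ _ E A hr' hr; have b3 := e4 _ E (A - B) hr'.
rewrite nE !mulr1 in b1 b2 b3.
move: (nrm_ge0 (A - B)) (nrm_ge0 (rho - rho')) (nrm_ge0 A) (nrm_ge0 B).
move: (nrm_ge0 (dDD rho E A - dDD rho' E A)) (nrm_ge0 (dDD rho' E (A - B))) b1 b2 b3 t1 t2 t3 hA hB.
move: (nrm (A - B)) (nrm (rho - rho')) (nrm A) (nrm B) => x y u v.
move: (n1 _) (n1 _) (n1 _) => n1 n2 n3.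
move: (nrm _) (nrm _) (nrm _) => m1 m2 m3 m20 m30 b1 b2 b3 t1 t2 t3 ua va x0 y0 u0 v0.
have c1 : x * m1 <= x * (K * a).
  by rewrite ler_wpM2l // (le_trans b1) // ler_wpM2l.
have c2 : v * m3 <= a * (K * y * a).
  by rewrite ler_pM // (le_trans b2) // ler_wpM2l // mulr_ge0.
have c3 : v * m2 <= a * (K * x).
  by rewrite ler_pM.
rewrite (_ : K * _ = x * (K * a) + a * (K * y * a) + a * (K * x)); last by ring.
lra.
Qed.

Lemma traceless_saZ (c : R) (X : M) : traceless_sa X -> traceless_sa (c%:C *: X).
Proof.
move=> /traceless_saP[h t]; apply/traceless_saP.
by rewrite ctZr h mxtraceZ t mulr0.
Qed.

(** The constraints are built into the vector field: it sees its arguments only through projections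
    onto the constraint spaces, so an unconstrained solution, once projected, solves the equations
    and satisfies the constraints. *)
Lemma hamiltonian_flow rho0 a0 : full_density rho0 -> traceless_sa a0 ->
  exists (eps : R) (gam A : R -> M), [/\ 0 < eps, gam 0 = rho0, A 0 = a0 &
    forall s, `|s| < eps -> [/\ full_density (gam s), traceless_sa (A s),
      mxD gam s (DD (gam s) (A s)) &
      mxD A s ((- 2^-1)%:C *: pT (Kmx (gam s) (A s)))]].
Proof.
move=> hr0 ha0; have [pr0 tr0] := (full_densityP rho0).1 hr0.
have [r1 [K [r10 hp hE]]] := DD_Est omega V q01 sp pr0.
have K0 := est0 hE.
have [k k0 hk] := @pT_bounded R d d0.
(* Projection onto the affine space of self-adjoint matrices with the trace of [rho0]. *)
pose P (x : M) : M := rho0 + pT (x - rho0).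
have PB x y : P x - P y = pT (x - y).
  have -> : x - y = (x - rho0) - (y - rho0) by rewrite opprB addrA subrK.
  rewrite /P [in RHS]pTD pTN; move: (pT _) (pT _) => u v.
  by rewrite opprD addrACA subrr add0r.
pose r := r1 / (k + 1).
have kp : 0 < k + 1 by rewrite ltr_wpDl.
have r0 : 0 < r by rewrite divr_gt0.
have kr : k * r <= r1.
  rewrite /r mulrA ler_pdivrMr // mulrC ler_wpM2l ?(ltW r10) //; lra.
pose al := k * (nrm a0 + r).
have al0 : 0 <= al by rewrite mulr_ge0 // addr_ge0 ?nrm_ge0 ?ltW.
pose z0 := row_mx rho0 a0.
(* Position and momentum side by side form a single matrix, as [picard] expects. *)
pose F (z : 'M[C]_(d, d + d)) : 'M[C]_(d, d + d) :=
  row_mx (DD (P (lsubmx z)) (pT (rsubmx z)))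
    ((- 2^-1)%:C *: pT (Kmx (P (lsubmx z)) (pT (rsubmx z)))).
have nsub (z w : 'M[C]_(d, d + d)) :
    nrm (z - w) = nrm (lsubmx z - lsubmx w) + nrm (rsubmx z - rsubmx w).
  by rewrite -{1}[z]hsubmxK -{1}[w]hsubmxK opp_row_mx add_row_mx nrm_row_mx.
have near_z z : nrm (z - z0) <= r ->
    nearby rho0 r1 (P (lsubmx z)) /\ nrm (pT (rsubmx z)) <= al.
  rewrite nsub row_mxKl row_mxKr => h.
  have n1 := nrm_ge0 (lsubmx z - rho0); have n2 := nrm_ge0 (rsubmx z - a0).
  split; first split.
  - have [h1 _] := (traceless_saP _).1 (pT_in d0 (lsubmx z - rho0)).
    by rewrite /P ctD h1; case: pr0 => ->.
  - rewrite /P addrC addKr; apply: le_trans (hk _) _; apply: le_trans kr.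
    by rewrite ler_wpM2l //; lra.
  - apply: le_trans (hk _) _; rewrite ler_wpM2l //.
    rewrite -[rsubmx z](subrK a0) addrC; apply: le_trans (nrmD _ _) _.
    by rewrite lerD2l; lra.
pose dd : R := d%:R * d%:R.
have dd0 : 0 <= dd by rewrite mulr_ge0.
pose Lp := K * k * (al + 1) + k * (dd * (K * (2 * al * k + al ^+ 2 * k))).
have al2 : 0 <= al ^+ 2 := exprn_ge0 2 al0.
have al3 : 0 <= 2 * al := mulr_ge0 (ler0n _ 2) al0.
have Lp0 : 0 <= Lp.
  have w1 : 0 <= K * k * (al + 1) by rewrite !mulr_ge0 // addr_ge0.
  have w2 : 0 <= 2 * al * k + al ^+ 2 * k.
    exact: addr_ge0 (mulr_ge0 al3 k0) (mulr_ge0 al2 k0).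
  exact: addr_ge0 w1 (mulr_ge0 k0 (mulr_ge0 dd0 (mulr_ge0 K0 w2))).
have FL z w : nrm (z - z0) <= r -> nrm (w - z0) <= r ->
    nrm (F z - F w) <= Lp * nrm (z - w).
  move=> /near_z[hz az] /near_z[hw aw].
  rewrite /F opp_row_mx add_row_mx nrm_row_mx -scalerBr nrmZr normrN ger0_norm ?invr_ge0 //.
  have pTB X Y : pT X - pT Y = pT (X - Y) by rewrite pTD pTN.
  have := nsub z w.
  move: (lsubmx z) (lsubmx w) (rsubmx z) (rsubmx w) hz hw az aw => x y a b hz hw az aw e.
  have q1 : nrm (P x - P y) <= k * nrm (x - y) by rewrite PB.
  have q2 : nrm (pT a - pT b) <= k * nrm (a - b) by rewrite pTB.
  have DB := linB (DD_lin sigma omega V q (P y)).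
  have p1 : nrm (DD (P x) (pT a) - DD (P y) (pT b)) <=
      K * (k * nrm (x - y)) * al + K * (k * nrm (a - b)).
    rewrite -[X in nrm X](subrKA (DD (P y) (pT a))) -DB.
    apply: le_trans (nrmD _ _) _; apply: lerD.
      apply: le_trans (est2 hE _ hw hz) _; rewrite ler_pM ?mulr_ge0 ?nrm_ge0 //.
      by rewrite ler_wpM2l.
    by apply: le_trans (est1 hE _ hw) _; rewrite ler_wpM2l.
  have p2 : nrm (pT (Kmx (P x) (pT a)) - pT (Kmx (P y) (pT b))) <=
      k * (dd * (K * (2 * al * (k * nrm (a - b)) + al ^+ 2 * (k * nrm (x - y))))).
    rewrite pTB; apply: le_trans (hk _) _; rewrite ler_wpM2l //.
    apply: le_trans (Kmx_lip hE hz hw al0 az aw) _; rewrite ler_wpM2l // ler_wpM2l //.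
    by rewrite lerD // ler_wpM2l.
  move: p1 p2 (nrm_ge0 (pT (Kmx (P x) (pT a)) - pT (Kmx (P y) (pT b)))).
  rewrite e; move: (nrm_ge0 (x - y)) (nrm_ge0 (a - b)).
  move: (nrm _) (nrm _) (nrm _) (nrm _) => t s v u u0 v0 h1 h2 t0.
  have kk : 0 <= K * k by rewrite mulr_ge0.
  have g1 : K * (k * u) * al + K * (k * v) <= K * k * (al + 1) * (u + v).
    rewrite -subr_ge0 (_ : _ - _ = K * k * u + K * k * al * v); last by ring.
    exact: addr_ge0 (mulr_ge0 kk u0) (mulr_ge0 (mulr_ge0 kk al0) v0).
  have g2 : k * (dd * (K * (2 * al * (k * v) + al ^+ 2 * (k * u)))) <=
      k * (dd * (K * (2 * al * k + al ^+ 2 * k))) * (u + v).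
    rewrite -subr_ge0 (_ : _ - _ = k * dd * K * (2 * al * k * u + al ^+ 2 * k * v)); last by ring.
    have w2 : 0 <= 2 * al * k * u + al ^+ 2 * k * v.
      exact: addr_ge0 (mulr_ge0 (mulr_ge0 al3 k0) u0) (mulr_ge0 (mulr_ge0 al2 k0) v0).
    exact: mulr_ge0 (mulr_ge0 (mulr_ge0 k0 dd0) K0) w2.
  rewrite /Lp mulrDl; lra.
have [e e0 [y [y0 hy]]] := picard r0 Lp0 FL.
exists e, (fun t => P (lsubmx (y t))), (fun t => pT (rsubmx (y t))); split=> //.
- by rewrite y0 /z0 row_mxKl /P subrr -(subrr rho0) pTD pTN subrr addr0.
- by rewrite y0 /z0 row_mxKr pT_id.
move=> s /hy[/near_z[hz _] hD].
have [hrh _] := hz.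
have ht (X : M) : \tr (pT X) = 0 by case/traceless_saP: (pT_in d0 X).
split.
- by apply/full_densityP; split; [exact: hp|rewrite /P mxtraceD ht addr0].
- exact: pT_in.
- have E t : P (lsubmx (y t)) = (rho0 - pT rho0) + pT (lsubmx (y t)).
    by rewrite /P pTD pTN [pT _ - _]addrC addrA.
  have hl : mxD (fun t => pT (lsubmx (y t))) s (pT (lsubmx (F (y s)))).
    apply: (@mxD_linear R _ _ _ _ (fun z : 'M[C]_(d, d + d) => pT (lsubmx z)) k) => //.
    + by move=> X Y; rewrite raddfD pTD.
    + by move=> c X; rewrite linearZ /= pTZ.
    + move=> X; apply: le_trans (hk _) _; rewrite ler_wpM2l //.
      by rewrite -{2}[X]hsubmxK nrm_row_mx lerDl nrm_ge0.
  have := mxD_add (mxD_cst (rho0 - pT rho0) s) hl.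
  rewrite add0r (_ : (fun t => _ + _) = fun t => P (lsubmx (y t))); last first.
    by apply/funext => t; rewrite E.
  (* The velocity is already traceless self-adjoint, so projecting the solution does not alter
     it. *)
  rewrite /F row_mxKl pT_id //; apply/traceless_saP; rewrite (DD_ct q hV) tr_DD; split=> //.
  by have [-> _] := (traceless_saP _).1 (pT_in d0 (rsubmx (y s))).
have hl : mxD (fun t => pT (rsubmx (y t))) s (pT (rsubmx (F (y s)))).
  apply: (@mxD_linear R _ _ _ _ (fun z : 'M[C]_(d, d + d) => pT (rsubmx z)) k) => //.
  + by move=> X Y; rewrite raddfD pTD.
  + by move=> c X; rewrite linearZ /= pTZ.
  + move=> X; apply: le_trans (hk _) _; rewrite ler_wpM2l //.
    by rewrite -{2}[X]hsubmxK nrm_row_mx lerDr nrm_ge0.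
by move: hl; rewrite /F row_mxKr pT_id //; apply: traceless_saZ; exact: pT_in.
Qed.

Lemma near_abs_lt (s e : R) : `|s| < e -> \forall h \near (0 : R), `|s + h| < e.
Proof.
move=> se; have e0 : 0 < (e - `|s|) / 2 by rewrite divr_gt0 // subr_gt0.
apply: filterS (near0_small ler01 e0) => h; rewrite mul1r => hh.
by apply: le_lt_trans (ler_normD _ _) _; lra.
Qed.

Lemma geodesic_exists rho0 a0 : full_density rho0 -> traceless_sa a0 ->
  exists (eps : R) (gam A : R -> M), [/\ 0 < eps, geodesic g eps gam,
    gam 0 = rho0, A 0 = a0 &
    forall s, `|s| < eps -> [/\ full_density (gam s), traceless_sa (A s),
      mxD gam s (DD (gam s) (A s)) &
      mxD A s ((- 2^-1)%:C *: pT (Kmx (gam s) (A s)))]].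
Proof.
move=> hr ha; have [eps [gam [A [e0 g0 A0 h]]]] := hamiltonian_flow hr ha.
exists eps, gam, A; split=> // s se; have [fd tA Dg DA] := h s se.
have [pg _] := (full_densityP _).1 fd.
have [d1 d2] := mxD_mx_derive Dg.
have hn := near_abs_lt se.
have herm : \forall h \near (0 : R), (gam (s + h))^t* = gam (s + h).
  apply: filterS hn => t /h[/full_densityP[[ht _] _] _ _ _].
  exact: ht.
have DDg := mxD_DD omega V q01 sp pg Dg DA herm.
have DDg' : mxD (mx_derive gam) s (dDD (gam s) (DD (gam s) (A s)) (A s)
    + DD (gam s) ((- 2^-1)%:C *: pT (Kmx (gam s) (A s)))).
  apply: mxD_near DDg; apply: filterS hn => t /h[_ _ Dt _].
  by case: (mxD_mx_derive Dt).
have [d3 d4] := mxD_mx_derive DDg'.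
split=> //; rewrite d4 d2.
rewrite (christoffelE d0 q01 sp hV hker pg tA (a1 := (- 2^-1)%:C *: pT (Kmx (gam s) (A s)))).
- by rewrite subrr.
- by apply: traceless_saZ; exact: pT_in.
- by move=> w hw; rewrite ipZl ip_pT // ip_Kmx mulNr.
Qed.

End GeodesicExistence.

(** * First and second derivatives of the functional *)

Lemma is_derive_near (R : realType) (f g : R -> R) (s D : R) :
  (\forall h \near (0 : R), f (s + h) = g (s + h)) ->
  is_derive s 1 f D -> is_derive s 1 g D.
Proof.
move=> H /is_deriveP hf; apply/is_deriveP => e e0.
have := nbhs_singleton H; rewrite addr0 => e1.
by apply: filterS2 H (hf e e0) => h <-; rewrite e1.
Qed.

Lemma is_derive_affine (R : realType) (a b c : R) (f : R -> R) (s D : R) :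
  is_derive s 1 f D -> is_derive s 1 (fun t => a * (b * f t - c)) (a * b * D).
Proof.
move=> /is_deriveP hf; apply/is_deriveP => e e0.
have k0 : 0 < `|a * b| + 1 by rewrite ltr_wpDl.
apply: filterS (hf _ (divr_gt0 e0 k0)) => h.
have -> : a * (b * f (s + h) - c) - a * (b * f s - c) - h * (a * b * D) =
  a * b * (f (s + h) - f s - h * D) by ring.
rewrite (normrM (a * b)) mulrAC ler_pdivlMr // => hy; apply: le_trans hy.
by rewrite mulrC ler_wpM2l // lerDl.
Qed.

Section Functional.
Variables (R : realType) (d : nat).
Local Notation C := R[i].
Local Notation M := 'M[C]_d.
Variables (sigma : M) (q : R).
Hypotheses (q01 : 0 < q <= 1) (sp : pd sigma).

Local Notation p := (q + 1).
Local Notation sh := (sh q).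
Local Notation Yof := (Yof sigma q).
Local Notation Aof := (Aof sigma q).
Local Notation dAof := (dAof sigma q).

Lemma q_gt0 : 0 < q. Proof. by case/andP: q01. Qed.

Lemma p_gt0 : 0 < p. Proof. by rewrite addr_gt0 // q_gt0. Qed.

Lemma mxabs_pd (Y : M) : pd Y -> mxabs Y = Y.
Proof.
move=> [hY pY]; have rY := eig_resolution hY.
rewrite /mxabs hY -{1 2}(mxfun_id hY) mxfunM mxfun_comp // -[RHS](mxfun_id hY).
by apply: eq_mxfun => i /=; rewrite -expr2 sqrtr_sqr gtr0_norm.
Qed.

Lemma ip_Yof rho : q * ip rho (Aof rho) = ip (Yof rho) (mxpow (Yof rho) q).
Proof.
rewrite Aof.unlock ipZr mulrA mulfV ?gt_eqF ?q_gt0 // mul1r Yof.unlock.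
by rewrite /ip hs_Gam.
Qed.

Lemma ip_Ypow (Y : M) : pd Y -> ip Y (mxpow Y q) = complex.Re (\tr (mxpow Y p)).
Proof.
move=> pY; rewrite /ip /hs; case: (pY) => -> _.
by rewrite -{1}(mxpow1 pY) mxpowD // addrC.
Qed.

Lemma tr_mxpow_ge0 (Y : M) s : pd Y -> 0 <= complex.Re (\tr (mxpow Y s)).
Proof.
by move=> pY; rewrite /mxpow mxtrace_mxfun /=; apply: sumr_ge0 => i _; exact: powR_ge0.
Qed.

(** [Tr Y^p = <Y, Y^q>] becomes [q <rho, Aof rho>] once [Gam] is moved across; thus [Fp] can be
    differentiated through [Aof]. *)
Lemma FpE rho : pd rho ->
  Fp sigma p rho = (p * q)^-1 * (q * ip rho (Aof rho) - 1).
Proof.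
move=> pr; rewrite ip_Yof; have pY := Yof_pd q sp pr; rewrite ip_Ypow //.
rewrite /Fp addrK; congr (_ * (_ - _)); rewrite /pnorm.
have p0 : p != 0 by rewrite gt_eqF // p_gt0.
have -> : Gam sigma p^-1 (Gam sigma (-1) rho) = Yof rho.
  rewrite GamD // Yof.unlock shE; congr (Gam _ _ _); field; exact: p0.
by rewrite mxabs_pd // -powRrM mulVf // powRr1 // tr_mxpow_ge0.
Qed.

Lemma Fp_lower rho : pd rho -> - (p * q)^-1 <= Fp sigma p rho.
Proof.
move=> pr; rewrite FpE // ip_Yof; have pY := Yof_pd q sp pr; rewrite ip_Ypow //.
have := tr_mxpow_ge0 p pY; move: (complex.Re _) => x x0.
have pq0 : 0 <= (p * q)^-1 by rewrite invr_ge0 mulr_ge0 ?ltW ?q_gt0 ?p_gt0.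
by rewrite mulrBr mulr1 lerDr mulr_ge0.
Qed.

Lemma Aof_ct rho : (Aof rho)^t* = Aof rho.
Proof. by rewrite Aof.unlock ctZr Gam_ct mxpow_ct. Qed.

Lemma Aof_sigma : Aof sigma = (q^-1)%:C *: 1%:M.
Proof.
rewrite Aof.unlock; congr (_ *: _).
have p0 : p != 0 by rewrite gt_eqF // p_gt0.
have e s : Gam sigma s 1%:M = mxpow sigma s by rewrite /Gam mulmx1 mxpowD // -splitr.
have eY : Yof sigma = mxpow sigma p^-1.
  rewrite Yof.unlock /Gam -{2}(mxpow1 sp) !mxpowD //; congr (mxpow _ _).
  by rewrite shE; field; exact: p0.
rewrite eY mxpowM // -[RHS](Gam0 sigma) -(addNr sh) -GamD // e; congr (Gam _ _ (mxpow _ _)).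
by rewrite shE mulrC.
Qed.

Lemma Fp_sigma : \tr sigma = 1 -> Fp sigma p sigma = 0.
Proof.
move=> t1; rewrite FpE // Aof_sigma ipZr mulrA mulfV ?gt_eqF ?q_gt0 // mul1r.
rewrite /ip /hs mulmx1; case: sp => -> _.
by rewrite t1 /= subrr mulr0.
Qed.

Lemma Op2_pd1 (Y : M) : pd Y -> Op2 (pd1 q) Y Y Y = q%:C *: mxpow Y q.
Proof.
move=> [hY pY]; have rY := eproj_resolution hY.
rewrite Op2.unlock /mxpow mxfunE scaler_sumr; apply: eq_bigr => i _.
rewrite (bigD1 i) //= big1 ?addr0 => [|k ki]; last first.
  by rewrite (resolution_mull i rY) -scalemxAl eproj_mul eq_sym (negPf ki) !scaler0.
rewrite (resolution_mull i rY) -scalemxAl eproj_mul eqxx !scalerA -!rmorphM.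
congr (_%:C *: _); rewrite /pd1 avg2_xx /pw1 -mulrA; congr (_ * _).
by rewrite -{2}(powRr1 (ltW (pY i))) -powRD ?subrK // (gt_eqF (pY i)) implybT.
Qed.

(** Euler's relation: [Aof] is homogeneous of degree [q], and its derivative is symmetric for
    [ip]. *)
Lemma ip_dAof_base rho H : pd rho -> ip rho (dAof rho H) = q * ip (Aof rho) H.
Proof.
move=> pr; have pY := Yof_pd q sp pr; have q0 : q != 0 by rewrite gt_eqF ?q_gt0.
have -> : ip rho (dAof rho H) = q^-1 * ip (Op2 (pd1 q) (Yof rho) (Yof rho) (Yof rho)) (Yof H).
  rewrite dAof.unlock ipZr /ip -hs_Gam hs_Op2; congr (_ * _).
  by have -> : Gam sigma (- sh) rho = Yof rho by rewrite Yof.unlock.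
rewrite Op2_pd1 // ipZl mulrA mulVf // mul1r Aof.unlock ipZl mulrA mulfV // mul1r.
by rewrite /ip hs_Gam Yof.unlock.
Qed.

(** The product rule on [FpE] gives [q <Aof, D>] and, by Euler's relation, [q] times as much again;
    the total factor [p q] cancels the prefactor. *)
Lemma Fp_derive (gam : R -> M) (s : R) D : mxD gam s D ->
  (\forall h \near (0 : R), pd (gam (s + h))) ->
  is_derive s 1 (fun t => Fp sigma p (gam t)) (ip (Aof (gam s)) D).
Proof.
move=> hD hp; have ps : pd (gam s) by have := nbhs_singleton hp; rewrite addr0.
have herm : \forall h \near (0 : R), (gam (s + h))^t* = gam (s + h).
  by apply: filterS hp => h [].
have h1 := mxD_ip hD (mxD_Aof q01 sp ps hD herm).
have [p0 q0] : p != 0 /\ q != 0 by rewrite !gt_eqF ?p_gt0 ?q_gt0.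
apply: (@is_derive_near R (fun t => (p * q)^-1 * (q * ip (gam t) (Aof (gam t)) - 1))).
  by apply: filterS hp => h hh; rewrite FpE.
rewrite ip_dAof_base // [ip D _]ipC in h1.
have := is_derive_affine (p * q)^-1 q 1 h1.
have -> // : (p * q)^-1 * q * (ip (Aof (gam s)) D + q * ip (Aof (gam s)) D) = ip (Aof (gam s)) D.
by move: (ip _ _) => x; field; rewrite p0 q0.
Qed.

Lemma Fp_derive2 (gam D : R -> M) (s : R) E : mxD gam s (D s) -> mxD D s E ->
  (\forall h \near (0 : R), pd (gam (s + h))) ->
  is_derive s 1 (fun t => ip (Aof (gam t)) (D t))
    (ip (dAof (gam s) (D s)) (D s) + ip (Aof (gam s)) E).
Proof.
move=> hg hD hp; have ps : pd (gam s) by have := nbhs_singleton hp; rewrite addr0.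
have herm : \forall h \near (0 : R), (gam (s + h))^t* = gam (s + h).
  by apply: filterS hp => h [].
exact: mxD_ip (mxD_Aof q01 sp ps hg herm) hD.
Qed.

End Functional.

(** * The curvature bound in terms of the semigroup *)

Section Curvature.
Variables (R : realType) (d J : nat).
Hypothesis d0 : (0 < d)%N.
Local Notation C := R[i].
Local Notation M := 'M[C]_d.
Variables (sigma : M) (omega : 'I_J -> R) (V : 'I_J -> M) (q : R) (L : M -> M).
Hypotheses (q01 : 0 < q <= 1) (sp : pd sigma) (hV : alicki_form sigma L omega V).

Local Notation p := (q + 1).
Local Notation DD := (DD sigma omega V q).
Local Notation dDD := (dDD sigma omega V q).
Local Notation Kmx := (Kmx sigma omega V q).
Local Notation Aof := (Aof sigma q).
Local Notation dAof := (dAof sigma q).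
Local Notation Gp := (Dpinv sigma omega V p).
Local Notation g := (gp sigma omega V p).

Lemma adj_lin : lin (adj L).
Proof.
move=> c X Y; apply/matrixP => a b; rewrite !mxE hsDr hsZr.
by [].
Qed.

Lemma DD_scalar rho (c : C) : DD rho c%:M = 0.
Proof.
rewrite DD.unlock big1 // => j _; rewrite comm_scalar.
have [-> _ _ _] := linear_of (brZ sigma q rho (omega j)).
by have [-> _ _ _] := linear_of (comm_lin ((V j)^t*)).
Qed.

Lemma dDD_scalar rho H (c : C) : dDD rho H c%:M = 0.
Proof.
rewrite dDD.unlock big1 // => j _; rewrite comm_scalar.
have [-> _ _ _] := linear_of (dbr_linr sigma q rho H (omega j)).
by have [-> _ _ _] := linear_of (comm_lin ((V j)^t*)).
Qed.

Lemma pT_herm (X : M) : X^t* = X -> exists c : C, pT X = X - c%:M.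
Proof.
move=> h; exists (complex.Re (\tr X) / d%:R)%:C; rewrite /pT h; congr (_ - _).
by rewrite scalerDr -scalerDl -rmorphD -[RHS]scale1r; congr (_%:C *: _); lra.
Qed.

Lemma pd_near rho0 (gam : R -> M) (s : R) D : pd rho0 -> gam s = rho0 -> mxD gam s D ->
  (\forall h \near (0 : R), (gam (s + h))^t* = gam (s + h)) ->
  \forall h \near (0 : R), pd (gam (s + h)).
Proof.
move=> h0 e hD hh; have [r [m [b [r0 _ _ hb]]]] := nearby_box q sp h0.
have := mxD_nearby r0 hD hh; rewrite e; apply: filterS => h /hb[]//.
Qed.

(* The gradient identity differentiated along the flow. *)
Lemma dgradient rho : pd rho ->
  ip (dDD rho (adj L rho) (Aof rho)) (Aof rho) =
  ip (dAof rho (adj L rho)) (adj L rho) - ip (Aof rho) (adj L (adj L rho)).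
Proof.
move=> pr; set l := adj L rho.
have gi := gradient_identity q01 sp hV pr.
have lh : l^t* = l.
  by rewrite /l -[adj L rho]opprK -gi ctN (DD_ct q hV) Aof_ct.
have hD := mxD_line rho l (0 : R).
have e0 : rho + (0 : R)%:C *: l = rho by rewrite scale0r addr0.
have herm : \forall h \near (0 : R), (rho + (0 + h)%:C *: l)^t* = rho + (0 + h)%:C *: l.
  by apply: near0W => h; rewrite ctD ctZr lh; case: pr => ->.
have hp := pd_near pr e0 hD herm.
have p0 : pd (rho + (0 : R)%:C *: l) by rewrite e0.
have h1 := mxD_DD omega V q01 sp p0 hD (mxD_Aof q01 sp p0 hD herm) herm.
have h2 : mxD (fun t : R => DD (rho + t%:C *: l) (Aof (rho + t%:C *: l))) 0 (- adj L l).
  apply: (mxD_near (f := fun t : R => - adj L rho + t%:C *: (- adj L l))); last exact: mxD_line.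
  apply: filterS hp => h ph; rewrite (gradient_identity q01 sp hV ph).
  have [_ aD aZ aN] := linear_of adj_lin.
  by rewrite aD aZ scalerN opprD.
have := mxD_unique h1 h2; rewrite /= e0 => e.
have := congr1 (fun X => ip X (Aof rho)) e.
rewrite ipDl ipNl (ip_DD_sym sigma omega V q rho (dAof rho l) (Aof rho)) gi ipNr (ipC (adj L l)).
rewrite -/l; move: (ip _ _) (ip _ _) (ip _ _) => x y z; lra.
Qed.

Hypothesis hker : forall A, A^t* = A -> (forall j, comm (V j) A = 0) ->
  exists c : C, A = c%:M.

Lemma ricci_second_derivative kappa rho : Ric_ge sigma omega V p kappa ->
  full_density rho ->
  - (2 * kappa * ip (Aof rho) (adj L rho)) <=
  ip (dAof rho (adj L rho)) (adj L rho) + ip (Aof rho) (adj L (adj L rho)).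
Proof.
move=> hRic fr; have [pr tr1] := (full_densityP rho).1 fr; set l := adj L rho.
have gi := gradient_identity q01 sp hV pr; have dg := dgradient pr.
rewrite -/l in gi dg; clearbody l.
have Ah := Aof_ct sigma q rho.
have [c pA] := pT_herm Ah.
(* [pT] only removes a scalar, which [DD] ignores; so this admissible momentum has velocity
   [- DD rho (Aof rho) = l]. *)
set a0 := - pT (Aof rho).
have ha0 : traceless_sa a0.
  by rewrite /a0 -pTN; exact: pT_in.
have [eps [gam [A [e0 gg g0 A0 hg]]]] := geodesic_exists d0 q01 sp hV hker fr ha0.
have DDa0 : DD rho a0 = l.
  have [_ dD _ dN] := linear_of (DDZ sigma omega V q rho).
  by rewrite /a0 pA dN dD dN DD_scalar subr0 gi opprK.
have hl : traceless_sa l.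
  apply/traceless_saP; rewrite -DDa0 tr_DD (DD_ct q hV).
  by case/traceless_saP: ha0 => ->.
have [lh _] := (traceless_saP l).1 hl.
have dDDa0 : dDD rho l a0 = - dDD rho l (Aof rho).
  have [_ dD _ dN] := linear_of (dDD_linr sigma omega V q rho l).
  by rewrite /a0 pA dN dD dN dDD_scalar subr0.
have lt0 : `|0 : R| < eps by rewrite normr0.
pose D t := DD (gam t) (A t).
have eD0 : D 0 = l by rewrite /D g0 A0 DDa0.
have [_ _ D0 E0] := hg 0 lt0; rewrite -/(D 0) in D0.
have [_ dg0] := mxD_mx_derive D0; rewrite eD0 in dg0.
have ea0 : a0 = - pT (Aof rho) by [].
clearbody a0.
have := hRic rho eps gam fr e0 gg g0.
rewrite g0 dg0 gpE (Dpinv_uniq d0 q01 sp hV hker pr ha0 DDa0).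
have -> : ip a0 l = - ip (Aof rho) l by rewrite ea0 ipNl ip_pT.
have pdn (s : R) : `|s| < eps -> \forall h \near (0 : R), pd (gam (s + h)).
  by move=> /near_abs_lt; apply: filterS => h /hg[/full_densityP[]].
have herm : \forall h \near (0 : R), (gam (0 + h))^t* = gam (0 + h).
  by apply: filterS (pdn 0 lt0) => h [].
have DDg : mxD D 0 (dDD rho l a0 + DD rho ((- 2^-1)%:C *: pT (Kmx rho a0))).
  have [pg _ Dg _] := hg 0 lt0.
  have pg' : pd (gam 0) by rewrite g0.
  by have := mxD_DD omega V q01 sp pg' Dg E0 herm; rewrite g0 A0 DDa0.
have h2 := Fp_derive2 q01 sp D0 DDg (pdn 0 lt0).
have h1 : \forall h \near (0 : R), ip (Aof (gam (0 + h))) (D (0 + h)) =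
    derive1 (fun s => Fp sigma p (gam s)) (0 + h).
  apply: filterS (near_abs_lt lt0) => h hh; have [_ _ Dh _] := hg _ hh.
  by rewrite derive1E; have /@derive_val -> := Fp_derive q01 sp Dh (pdn _ hh).
have /@derive_val h3 := is_derive_near h1 h2.
have -> : derive1n 2 (fun s => Fp sigma p (gam s)) 0 =
   ip (dAof (gam 0) (D 0)) (D 0) + ip (Aof (gam 0))
     (dDD rho l a0 + DD rho ((- 2^-1)%:C *: pT (Kmx rho a0))).
  by rewrite -h3 /derive1n /= derive1E.
set X := ip (dDD rho l (Aof rho)) (Aof rho) in dg.
(* Contribution of the moving metric to [<A, gam''>]; that of Hamilton's force is [t3]. *)
have t1 : ip (Aof rho) (dDD rho l a0) = - X by rewrite dDDa0 ipNr ipC.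
have hdd : traceless_sa (dDD rho l (Aof rho)).
  by apply/traceless_saP; rewrite tr_dDD (dDD_ct q01 sp hV) // Ah.
have t2 : ip (Kmx rho a0) l = X.
  rewrite ip_Kmx dDDa0 ea0 ipNl ipNr opprK ipC (ip_pT _ hdd).
  by rewrite ipC.
have t3 : ip (Aof rho) (DD rho ((- 2^-1)%:C *: pT (Kmx rho a0))) = 2^-1 * X.
  rewrite -(ip_DD_sym sigma omega V q rho (Aof rho)) gi ipNl ipZr (ipC l) (ip_pT _ hl) t2.
  by rewrite mulNr opprK.
rewrite eD0 g0 ipDr t1 t3 dg.
move: (ip (Aof rho) l) (ip (dAof rho l) l) (ip _ _) => x y z; lra.
Qed.

End Curvature.

(** * Positivity and the Dirichlet form *)

Section PositiveSemidefinite.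
Variable R : realType.
Local Notation C := R[i].

Lemma psd_sandwich m n (B : 'M[C]_(m, n)) (A : 'M[C]_n) : psd A -> psd (B *m A *m B^t*).
Proof.
move=> [/hermP hA h]; split; first by apply/hermP; rewrite !ctM trmxCK hA mulmxA.
by move=> v; have := h (v *m B); rewrite ctM !mulmxA.
Qed.

Lemma psd_row n (v : 'rV[C]_n) : psd (v^t* *m v).
Proof.
have p1 : psd (1%:M : 'M[C]_1).
  split; first by apply/hermP; rewrite ct1.
  by move=> w; rewrite mulmx1 rsqE (lecR 0) rsq_ge0.
by have := psd_sandwich (v^t*) p1; rewrite mulmx1 trmxCK.
Qed.

(** Complete positivity at size 1 is positivity, but a 1 by 1 block matrix has another type than its
    block; the translation is conjugation by the unitary [Rc]. *)
Lemma psd_mxblock1 n (X : 'M[C]_n) :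
  psd X <-> psd (\mxblock_(i < 1, j < 1) (fun _ _ : 'I_1 => X) i j).
Proof.
pose Rc := \mxcol_(i < 1) (1%:M : 'M[C]_n).
pose Rr := \mxrow_(j < 1) (1%:M : 'M[C]_n).
have e : \mxblock_(i < 1, j < 1) (fun _ _ : 'I_1 => X) i j = Rc *m X *m Rr.
  rewrite mxcol_mul mul_mxcol_mxrow; apply: eq_mxblock => i j.
  by rewrite mul1mx mulmx1.
have rc : Rr *m Rc = 1%:M by rewrite mul_mxrow_mxcol big_ord1 mulmx1.
have ct : Rc^t* = Rr.
  apply/matrixP => i j; rewrite !mxE.
  by rewrite conjC_nat eq_sym.
have ct' : Rr^t* = Rc by rewrite -ct trmxCK.
rewrite e; split=> h; first by have := psd_sandwich Rc h; rewrite ct.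
have := psd_sandwich Rr h.
by rewrite ct' !mulmxA rc mul1mx -(mulmxA X) rc mulmx1.
Qed.

(* [B = W W*] turns the trace into a sum of values of the quadratic form of [A]. *)
Lemma hs_psd_pd n (A B : 'M[C]_n) : psd A -> pd B -> 0 <= hs A B.
Proof.
move=> hA pB; set W := mxpow B (2^-1).
have eB : B = W *m W.
  have h2 : (1 : R) = 2^-1 + 2^-1 by lra.
  by rewrite mxpowD // -h2 mxpow1.
have [/hermP hAh _] := hA.
have -> : hs A B = \tr (W *m A *m W^t*).
  by rewrite /hs hAh mxpow_ct [in LHS]eB !mulmxA mxtrace_mulC !mulmxA.
have [_ h] := psd_sandwich W hA.
rewrite /mxtrace; apply: sumr_ge0 => i _.
have := h (delta_mx 0 i); congr (0 <= _).
rewrite mxE (bigD1 i) //= big1 ?addr0 => [|k ki].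
  rewrite mxE (bigD1 i) //= big1 ?addr0 => [|k ki]; last by rewrite mxE (negPf ki) andbF mul0r.
  by rewrite !mxE !eqxx mul1r conjC1 mulr1.
by rewrite !mxE (negPf ki) andbF conjC0 mulr0.
Qed.

Lemma hermitian_split n (X : 'M[C]_n) : exists H1 H2 : 'M[C]_n,
  [/\ H1^t* = H1, H2^t* = H2, X = H1 + 'i *: H2 & X^t* = H1 + (- 'i) *: H2].
Proof.
have ii : 'i * 'i = -1 :> C by rewrite -expr2 sqr_i.
have cNi (Y : 'M[C]_n) : (- 'i *: Y)^t* = 'i *: Y^t* by rewrite scaleNr ctN ct_i scaleNr opprK.
pose H1 : 'M[C]_n := (2^-1)%:C *: (X + X^t*).
pose H2 : 'M[C]_n := (2^-1)%:C *: (- 'i *: (X - X^t*)).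
have h1 : H1^t* = H1 by rewrite /H1 ctZr ctD trmxCK addrC.
have h2 : H2^t* = H2.
  by rewrite /H2 ctZr cNi ctB trmxCK scaleNr -scalerN opprB.
have half (Y : 'M[C]_n) : (2^-1)%:C *: Y + (2^-1)%:C *: Y = Y.
  rewrite -scalerDl -rmorphD -[RHS]scale1r; congr (_%:C *: _); lra.
have eX : X = H1 + 'i *: H2.
  have -> : 'i *: H2 = (2^-1)%:C *: (X - X^t*).
    by rewrite /H2 scalerA mulrC -scalerA (scalerA 'i) mulrN ii opprK scale1r.
  by rewrite -scalerDr addrACA subrr addr0 scalerDr half.
clearbody H1 H2; exists H1, H2; split; [exact: h1|exact: h2|exact: eX|].
have := congr1 (fun Z : 'M[C]_n => Z^t*) eX; rewrite /= ctD (ct_i H2) h1 h2.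
exact.
Qed.

Lemma lin_ct n (f : 'M[C]_n -> 'M[C]_n) : lin f ->
  (forall H, H^t* = H -> (f H)^t* = f H) -> forall X, f (X^t*) = (f X)^t*.
Proof.
move=> /linear_of[_ fD fZ _] fh X.
have [H1 [H2 [h1 h2 e1 e2]]] := hermitian_split X.
rewrite e2 [in RHS]e1 !fD !fZ ctD (fh _ h1); congr (_ + _).
rewrite ctZ (fh _ h2); congr (_ *: _); apply/eqP.
by rewrite eq_complex /= oppr0 !eqxx.
Qed.

Lemma mx_cvg_nrm n (F : set_system R) (f : R -> 'M[C]_n) (A : 'M[C]_n) (e : R) :
  Filter F -> mx_cvg F f A -> 0 < e -> \forall t \near F, nrm (f t - A) <= e.
Proof.
move=> FF h e0; pose k : R := n%:R * n%:R * 2 + 1.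
have k0 : 0 < k by rewrite ltr_wpDl // !mulr_ge0.
have ek : 0 < e / k by rewrite divr_gt0.
have : \forall t \near F, forall ij : 'I_n * 'I_n, n1 ((f t - A) ij.1 ij.2) <= 2 * (e / k).
  apply: filter_forall => -[i j] /=; have [h1 h2] := h i j.
  move: h1 => /cvgrPdist_le/(_ _ ek) h1; move: h2 => /cvgrPdist_le/(_ _ ek) h2.
  apply: filterS2 h1 h2 => t h1 h2.
  rewrite /n1 !mxE ReD ReN ImD ImN mulr_natl mulr2n lerD // distrC //.
apply: filterS => t ht.
apply: le_trans (nrm_le_entry (fun i j => ht (i, j))) _.
rewrite [leLHS](_ : _ = (n%:R * n%:R * 2) * e / k); last by ring.
rewrite ler_pdivrMr // mulrC ler_wpM2l ?(ltW e0) // /k lerDl //.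
Qed.

End PositiveSemidefinite.

(** * The Dirichlet form and symmetry of the generator *)

Section EpRelation.
Variables (R : realType) (d J : nat).
Local Notation C := R[i].
Local Notation M := 'M[C]_d.
Variables (sigma : M) (omega : 'I_J -> R) (V : 'I_J -> M) (q : R) (L : M -> M).
Hypotheses (q01 : 0 < q <= 1) (sp : pd sigma) (hV : alicki_form sigma L omega V).

Local Notation p := (q + 1).
Local Notation Aof := (Aof sigma q).

Lemma jump_sandwich (S X A W rho : M) (a b : C) : a * b = 1 ->
  S *m A = b *: (A *m S) -> A *m S = a *: (S *m A) ->
  S *m W = a *: (W *m S) -> W *m S = b *: (S *m W) -> S *m X *m S = rho ->
  S *m (b *: (W *m comm X A) + a *: (comm A X *m W)) *m S =
  b *: (A *m rho *m W - W *m A *m rho) + a *: (W *m rho *m A - rho *m A *m W).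
Proof.
move=> ab SA AS SW WS <-.
have ba : b * a = 1 by rewrite mulrC.
have t1 : S *m (W *m (X *m A)) *m S = (a * a) *: (W *m (S *m X *m S) *m A).
  by rewrite !mulmxA SW -!mulmxA AS -!scalemxAr -!scalemxAl scalerA !mulmxA.
have t2 : S *m (W *m (A *m X)) *m S = W *m A *m (S *m X *m S).
  rewrite !mulmxA SW -!scalemxAl -(mulmxA W S A) SA -!scalemxAr.
  by rewrite -!scalemxAl scalerA ab scale1r !mulmxA.
have t3 : S *m ((A *m X) *m W) *m S = (b * b) *: (A *m (S *m X *m S) *m W).
  by rewrite !mulmxA SA -!mulmxA WS -!scalemxAr -!scalemxAl scalerA !mulmxA.
have t4 : S *m ((X *m A) *m W) *m S = S *m X *m S *m A *m W.
  rewrite !mulmxA -(mulmxA _ W S) WS -!scalemxAr !mulmxA -(mulmxA _ A S) AS -!scalemxAr.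
  by rewrite -!scalemxAl scalerA ba scale1r !mulmxA.
rewrite mulmxDr mulmxDl -!scalemxAr -!scalemxAl /comm.
rewrite [W *m (_ - _)]mulmxBr [S *m (_ - _)]mulmxBr mulmxBl t1 t2.
rewrite [(_ - _) *m W]mulmxBl [S *m (_ - _)]mulmxBr mulmxBl t3 t4.
rewrite !scalerBr !scalerA !mulrA ba ab !mul1r.
move: (a *: _) (b *: _) (b *: _) (a *: _) => x y z t.
by rewrite addrACA [t + y]addrC addrACA.
Qed.

Lemma Gam_sum (I : finType) s (F : I -> M) :
  Gam sigma s (\sum_i F i) = \sum_i Gam sigma s (F i).
Proof.
have [G0 GD _ _] := linear_of (Gam_lin sigma s).
by elim/big_rec2: _ => [//|i x y _ <-]; rewrite GD.
Qed.

Lemma kmsE (X Y : M) : kms sigma X Y = hs (Gam sigma 1 X) Y.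
Proof. by rewrite /kms /hs Gam_ct /Gam div1r. Qed.

(** Self-adjointness of [L] for the [kms] product, read off the Alicki form by moving [sigma^(1/2)]
    through each jump term. *)
Lemma kms_symmetric rho : Gam sigma 1 (L (Gam sigma (-1) rho)) = adj L rho.
Proof.
have e : mxpow sigma (1 / 2) *m Gam sigma (-1) rho *m mxpow sigma (1 / 2) = rho.
  by rewrite -[LHS]/(Gam sigma 1 (Gam sigma (-1) rho)) GamD // subrr Gam0.
rewrite (adjL_E hV); case: (hV) => -> _ _ _ _.
rewrite Gam_sum; apply: eq_bigr => j _.
move: (Gam sigma (-1) rho) e => X e.
set S := mxpow sigma _ in e; set w := omega j.
have ew : 1 / 2 * w = w / 2 by rewrite mulrC mulrA mulr1.
have h1 := mxpow_comm sp hV j (1 / 2); have h2 := comm_mxpow sp hV j (1 / 2).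
rewrite -/S -/w ew in h1 h2.
have h3 := congr1 (fun X : M => X^t*) h1; have h4 := congr1 (fun X : M => X^t*) h2.
rewrite /= !ctZr !ctM mxpow_ct -/S in h3 h4.
have ab : (expR (w / 2))%:C * (expR (- (w / 2)))%:C = 1 :> C.
  by rewrite -rmorphM -expRD subrr expR0.
exact: jump_sandwich ab h1 h2 h4 h3 e.
Qed.

(** The power in [Ep] is [q] times [Aof rho], and [hat p * p * q = p ^+ 2] leaves the constant
    1/4. *)
Lemma Ep_gradient rho :
  p ^- 2 * Ep sigma L p (Gam sigma (-1) rho) = - (4^-1 * ip (Aof rho) (adj L rho)).
Proof.
have q0 : q != 0 by rewrite gt_eqF ?(q_gt0 q01).
have p0 : p != 0 by rewrite gt_eqF // (p_gt0 q01).
have -> : Ep sigma L p (Gam sigma (-1) rho) = - (hat p * p / 4) * (q * ip (Aof rho) (adj L rho)).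
  rewrite /Ep; congr (_ * _).
  have -> : Gam sigma p^-1 (Gam sigma (-1) rho) = Yof sigma q rho.
    by rewrite GamD // Yof.unlock shE; congr (Gam _ _ _); field.
  rewrite addrK Aof.unlock ipZl mulrA mulfV // mul1r kmsE.
  by rewrite -kms_symmetric /ip -hs_Gam.
by rewrite /hat addrK; move: (ip _ _) => x; field; rewrite p0 q0.
Qed.

Lemma generator_unit : L 1%:M = 0.
Proof.
case: (hV) => -> _ _ _ _; apply: big1 => j _.
by rewrite /comm mul1mx mulmx1 subrr mulmx0 mul0mx !scaler0 addr0.
Qed.

Lemma Gam_sigma : Gam sigma (-1) sigma = 1%:M.
Proof.
rewrite /Gam -{2}(mxpow1 sp) !mxpowD // -(mxpow0 sigma); congr (mxpow _ _); lra.
Qed.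

Lemma adjL_sigma : adj L sigma = 0.
Proof.
rewrite -kms_symmetric Gam_sigma generator_unit.
by have [-> _ _ _] := linear_of (Gam_lin sigma 1).
Qed.

Lemma tr_adjL X : \tr (adj L X) = 0.
Proof.
have := adj_hs 1%:M X (generator_lin hV); rewrite generator_unit hs0l /hs ct1 mul1mx.
by move=> <-.
Qed.

End EpRelation.

(** * The dual semigroup *)

Lemma shrink_time (R : realType) (t h : R) : h < 0 -> 0 < t -> `|h| <= t / 2 -> 0 <= t + h <= t.
Proof. by move=> h0 t0; rewrite ltr0_norm // => h5; apply/andP; split; lra. Qed.

Section Flow.
Variables (R : realType) (d : nat).
Local Notation C := R[i].
Local Notation M := 'M[C]_d.
Variables (P : R -> {linear M -> M}) (L : M -> M).
Hypotheses (hP : quantum_markov_semigroup P) (hL : is_generator P L).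

Lemma P_lin t : lin (P t).
Proof. by move=> c X Y; rewrite linearP. Qed.

Lemma Ad_hs t X Y : hs X (adj (P t) Y) = hs (P t X) Y.
Proof. by rewrite hs_adj. Qed.

Lemma Ad_lin t : lin (adj (P t)). Proof. exact: adj_lin. Qed.

Lemma Ad_add s t X : 0 <= s -> 0 <= t -> adj (P (s + t)) X = adj (P t) (adj (P s) X).
Proof.
case: hP => _ hst _ _ s0 t0; apply/matrixP => a b.
by rewrite -!hs_delta !Ad_hs hst.
Qed.

Lemma Ad_addC s t X : 0 <= s -> 0 <= t -> adj (P (s + t)) X = adj (P s) (adj (P t) X).
Proof. by move=> s0 t0; rewrite addrC Ad_add. Qed.

Lemma tr_Ad t X : 0 <= t -> \tr (adj (P t) X) = \tr X.
Proof.
case: hP => _ _ _ h4 t0; have [_ u] := h4 t t0.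
by have := Ad_hs t 1%:M X; rewrite u /hs ct1 !mul1mx.
Qed.

Lemma psd_P t X : 0 <= t -> psd X -> psd (P t X).
Proof.
case: hP => _ _ _ h4 t0; have [cp _] := h4 t t0.
by move=> /psd_mxblock1/(cp 1%N)/(psd_mxblock1 (P t X)).
Qed.

(** [X] is a real combination of rank-one projections, and their images are positive, hence
    self-adjoint. *)
Lemma P_herm t X : 0 <= t -> X^t* = X -> (P t X)^t* = P t X.
Proof.
move=> t0 /hermP/spectral_decomposition ->; rewrite raddf_sum ct_sum.
apply: eq_bigr => i _ /=; rewrite linearZ /= ctZr; congr (_ *: _).
by have [/hermP] := psd_P t0 (psd_row (row i (spectralmx X))).
Qed.

Lemma P_ct t X : 0 <= t -> P t (X^t*) = (P t X)^t*.
Proof. by move=> t0; apply: (lin_ct (P_lin t)) => H; exact: P_herm. Qed.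

Lemma Ad_ct t X : 0 <= t -> adj (P t) (X^t*) = (adj (P t) X)^t*.
Proof.
move=> t0; apply/matrixP => a b; rewrite ctE -!hs_delta !Ad_hs -hsC.
have e : (P t (delta_mx a b))^t* = P t (delta_mx b a).
  by rewrite -P_ct // trmx_delta map_delta_mx.
by rewrite /hs e mxtrace_mulC.
Qed.

(** [is_generator] is pointwise in its argument, but the entries of the dual map are pairings with
    images of the finitely many matrix units. *)
Lemma generator_bound Z (e : R) : 0 < e ->
  \forall h \near (0 : R), 0 < h -> nrm (adj (P h) Z - Z - h%:C *: adj L Z) <= e * h.
Proof.
move=> e0; pose k : R := d%:R * d%:R * nrm Z + 1.
have k0 : 0 < k by rewrite ltr_wpDl // !mulr_ge0 ?nrm_ge0.
have ek : 0 < e / k by rewrite divr_gt0.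
have : \forall h \near (0 : R), forall ab : 'I_d * 'I_d, 0 < h ->
    nrm ((h^-1)%:C *: (P h (delta_mx ab.1 ab.2) - delta_mx ab.1 ab.2)
         - L (delta_mx ab.1 ab.2)) <= e / k.
  apply: near_all => -[a b] /=.
  have := mx_cvg_nrm _ (hL (delta_mx a b)) ek; rewrite near_withinE; exact.
apply: filterS => h hh h0.
have {}hh a b : nrm (P h (delta_mx a b) - delta_mx a b - h%:C *: L (delta_mx a b)) <= e / k * h.
  rewrite [X in nrm X](_ : _ = h%:C *:
      ((h^-1)%:C *: (P h (delta_mx a b) - delta_mx a b) - L (delta_mx a b))).
    by rewrite nrmZr gtr0_norm // mulrC ler_wpM2r ?(ltW h0) //; exact: (hh (a, b)).
  by rewrite scalerBr scalerA -rmorphM mulfV ?gt_eqF // rmorph1 scale1r.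
apply: le_trans (nrm_le_entry (K := e / k * h * nrm Z) _) _.
  move=> a b; have -> : (adj (P h) Z - Z - h%:C *: adj L Z) a b =
      hs (P h (delta_mx a b) - delta_mx a b - h%:C *: L (delta_mx a b)) Z.
    rewrite !hsBl hsZl hs_delta !mxE; congr (_ - _ * _).
    by apply/esym; exact: conjc_real.
  by apply: le_trans (n1_hs _ _) _; rewrite ler_wpM2r ?nrm_ge0.
rewrite [leLHS](_ : _ = d%:R * d%:R * nrm Z * e / k * h); last by ring.
rewrite ler_wpM2r ?(ltW h0) // ler_pdivrMr // mulrC ler_wpM2l ?(ltW e0) //.
by rewrite /k lerDl.
Qed.

Lemma flow_cont0 Z (e : R) : 0 < e ->
  \forall h \near (0 : R), 0 < h -> nrm (adj (P h) Z - Z) <= e.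
Proof.
move=> e0; have K0 : 0 <= nrm (adj L Z) + 1 by rewrite addr_ge0 ?nrm_ge0.
apply: filterS2 (generator_bound Z ltr01) (near0_small K0 e0) => h h1 h2 h0.
apply: le_trans h2; rewrite -[X in nrm X](subrK (h%:C *: adj L Z)).
apply: le_trans (nrmD _ _) _; have := h1 h0; rewrite nrmZr !gtr0_norm //; lra.
Qed.

Lemma lin_bound_delta (f : M -> M) k : lin f -> (forall a b, nrm (f (delta_mx a b)) <= k) ->
  forall X, nrm (f X) <= k * nrm X.
Proof.
move=> /linear_of[f0 fD fZ _] hk X.
have fs I (r : seq I) F : f (\sum_(i <- r) F i) = \sum_(i <- r) f (F i).
  by elim/big_ind2: _ => // x1 x2 y1 y2 <- <-.
rewrite {1}[X]matrix_sum_delta fs.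
apply: le_trans (nrm_sum _ _ _) _; rewrite mulr_sumr; apply: ler_sum => i _.
rewrite fs; apply: le_trans (nrm_sum _ _ _) _; rewrite mulr_sumr.
apply: ler_sum => j _; rewrite fZ; apply: le_trans (nrmZ _ _) _.
by rewrite mulrC ler_wpM2r ?n1_ge0.
Qed.

Lemma Ad0 X : adj (P 0) X = X.
Proof. by case: hP => h _ _ _; apply/matrixP => a b; rewrite -hs_delta Ad_hs h hs_delta. Qed.

(** Right continuity at 0, tested on matrix units, bounds the maps by 2 for short times; the
    semigroup law with [n] short steps reaches [t], at the price [2 ^+ n]. *)
Lemma Ad_bounded (t : R) : exists2 K : R, 0 <= K &
  forall s X, 0 <= s <= t -> nrm (adj (P s) X) <= K * nrm X.
Proof.
have [e /= e0 he] : exists2 e : R, 0 < e & forall h, 0 <= h < e ->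
    forall X, nrm (adj (P h) X) <= 2 * nrm X.
  have : \forall h \near (0 : R), forall ab : 'I_d * 'I_d, 0 < h ->
      nrm (adj (P h) (delta_mx ab.1 ab.2) - delta_mx ab.1 ab.2) <= 1.
    by apply: near_all => -[a b]; exact: flow_cont0.
  move=> /nbhs_ballP[e /= e0 he]; exists e => // h /andP[h0 h1] X.
  move: h0; rewrite le_eqVlt => /orP[/eqP <-|h0].
    by rewrite Ad0; have := nrm_ge0 X; lra.
  have hb : ball (0 : R) e h by rewrite /ball /= sub0r normrN gtr0_norm.
  have fl : lin (fun X => adj (P h) X - X).
    move=> c U W; rewrite /= (Ad_lin h c U W) opprD addrACA.
    by rewrite scalerBr.
  have := lin_bound_delta fl (fun a b => he h hb (a, b) h0) X.
  rewrite mul1r => b; rewrite -[X in nrm X](subrK X).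
  apply: le_trans (nrmD _ _) _; lra.
pose n := (Num.bound (`|t| / e)).+1.
have tn : `|t| / e < n%:R.
  apply: lt_le_trans (archi_boundP _) _; first by rewrite divr_ge0 // ltW.
  by rewrite ler_nat.
have n0 : 0 < n%:R :> R by rewrite ltr0n.
exists (2 ^+ n); first by rewrite exprn_ge0.
move=> s X /andP[s0 st].
have se : 0 <= s / n%:R < e.
  rewrite divr_ge0 ?(ltW n0) //= ltr_pdivrMr // mulrC -ltr_pdivrMr //.
  apply: le_lt_trans tn; rewrite ler_pM2r ?invr_gt0 //.
  by apply: le_trans st _; exact: ler_norm.
have sn : 0 <= s / n%:R by case/andP: se.
have H k Y : nrm (adj (P (k%:R * (s / n%:R))) Y) <= 2 ^+ k * nrm Y.
  elim: k Y => [|k IH] Y; first by rewrite mul0r Ad0 expr0 mul1r.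
  rewrite -natr1 mulrDl mul1r Ad_add ?mulr_ge0 //.
  apply: le_trans (he _ se _) _; rewrite exprS -mulrA ler_wpM2l //.
have ns : n%:R * (s / n%:R) = s by rewrite mulrC divfK // gt_eqF.
by have := H n X; rewrite ns.
Qed.

Lemma Ad_B t X Y : adj (P t) (X - Y) = adj (P t) X - adj (P t) Y.
Proof. exact: linB (Ad_lin t) X Y. Qed.

(** From a right derivative at 0 to a two-sided one: for [h > 0] the map at time [t] is factored
    out, for [h < 0] the one at time [t + h]. In the latter case the derivative sits at the wrong
    base point, hence the second error term. *)
Lemma mxD_flow t Z : 0 < t -> mxD (fun s => adj (P s) Z) t (adj (P t) (adj L Z)).
Proof.
move=> t0 e e0; have [K K0 hK] := Ad_bounded t.
have k0 : 0 < 2 * K + 1 by rewrite ltr_wpDl // mulr_ge0.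
have ek : 0 < e / (2 * K + 1) by rewrite divr_gt0.
have hn := near0I (generator_bound Z ek) (flow_cont0 (adj L Z) ek).
have hneg : \forall h \near (0 : R),
    (0 < - h -> nrm (adj (P (- h)) Z - Z - (- h)%:C *: adj L Z) <= e / (2 * K + 1) * - h) /\
    (0 < - h -> nrm (adj (P (- h)) (adj L Z) - adj L Z) <= e / (2 * K + 1)).
  move: hn => /nbhs_ballP[r /= r0 hr]; apply/nbhs_ballP; exists r => //= h hh.
  by apply: hr; move: hh; rewrite /ball /= !sub0r !normrN.
have t20 : 0 < t / 2 by rewrite divr_gt0.
have hs := near0_small (ler01 : 0 <= (1 : R)) t20.
have hnn := near0I hn hneg.
apply: filterS2 hnn hs => h [[h1 h2] [h3 h4]]; rewrite mul1r => h5.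
have [Z0 ZD ZZ ZN] := linear_of (Ad_lin t).
have kk (x : R) : 0 <= x -> K * (e / (2 * K + 1) * x) + K * (e / (2 * K + 1)) * x <= e * x.
  move=> x0; rewrite [leLHS](_ : _ = (2 * K) * e / (2 * K + 1) * x); last by ring.
  by rewrite ler_wpM2r // ler_pdivrMr // mulrDr mulr1 [e * _]mulrC lerDl ltW.
have tt : 0 <= t <= t by rewrite lexx ltW.
have ek0 := ltW ek.
case: (ltgtP h 0) => h0; last first.
- by rewrite h0 addr0 subrr sub0r scale0r oppr0 nrm0 normr0 mulr0.
- rewrite Ad_addC ?(ltW h0) ?(ltW t0) // -Ad_B -ZZ -Ad_B.
  apply: le_trans (hK _ _ tt) _; rewrite gtr0_norm //.
  apply: (le_trans _ (kk h (ltW h0))); apply: ler_wpDr.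
    exact: mulr_ge0 (mulr_ge0 K0 ek0) (ltW h0).
  by rewrite ler_wpM2l //; exact: h1.
have hp : 0 < - h by rewrite oppr_gt0.
have th := shrink_time h0 t0 h5.
have th0 : 0 <= t + h by case/andP: th.
have eA W : adj (P t) W = adj (P (t + h)) (adj (P (- h)) W).
  by rewrite -Ad_addC ?(ltW hp) // addrK.
have [_ ZD' ZZ' ZN'] := linear_of (Ad_lin (t + h)).
have -> : adj (P (t + h)) Z - adj (P t) Z - h%:C *: adj (P t) (adj L Z) =
   - adj (P (t + h)) (adj (P (- h)) Z - Z - (- h)%:C *: adj L Z)
   + (- h)%:C *: adj (P (t + h)) (adj (P (- h)) (adj L Z) - adj L Z).
  rewrite (eA Z) (eA (adj L Z)) !Ad_B ZZ' rmorphN !scaleNr.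
  rewrite scalerBr opprB.
  move: (h%:C *: _) (h%:C *: _) (adj _ _) (adj _ _) => x y z w.
  by rewrite !opprD !opprK addrA; apply/matrixP => i j; rewrite !mxE; ring.
apply: le_trans (nrmD _ _) _; rewrite nrmN nrmZr normrN ltr0_norm //.
apply: le_trans (kk _ (ltW hp)); apply: lerD.
  by apply: le_trans (hK _ _ th) _; rewrite ler_wpM2l //; exact: h3.
rewrite mulrC ler_wpM2r ?(ltW hp) //.
by apply: le_trans (hK _ _ th) _; rewrite ler_wpM2l //; exact: h4.
Qed.

Lemma right_lim_unique (A B : M) (u : R -> M) :
  (forall e : R, 0 < e -> \forall h \near (0 : R), 0 < h -> nrm (u h - A) <= e) ->
  (forall e : R, 0 < e -> \forall h \near (0 : R), 0 < h -> nrm (u h - B) <= e) -> A = B.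
Proof.
move=> hA hB; apply/eqP; rewrite -subr_eq0; apply/eqP/nrm_eq0/eqP.
rewrite eq_le nrm_ge0 andbT; apply/ler_addgt0Pr => e e0; rewrite add0r.
have e2 : 0 < e / 2 by rewrite divr_gt0.
have := near0I (hA _ e2) (hB _ e2) => /nbhs_ballP[r /= r0 hr].
have r2 : 0 < r / 2 by rewrite divr_gt0.
have hb : ball (0 : R) r (r / 2) by rewrite /ball /= sub0r normrN gtr0_norm //; lra.
have [/(_ r2) h1 /(_ r2) h2] := hr _ hb.
rewrite -(subrKA (u (r / 2))) [e]splitr; apply: le_trans (nrmD _ _) _.
by rewrite lerD // nrmBC.
Qed.

(** Both sides are the right derivative at [h = 0] of the flow at time [t + h], factored in the two
    possible orders. *)
Lemma adjL_Ad t Z : 0 < t -> adj L (adj (P t) Z) = adj (P t) (adj L Z).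
Proof.
move=> t0; have [K K0 hK] := Ad_bounded t.
have tt : 0 <= t <= t by rewrite lexx ltW.
have [_ ZD ZZ ZN] := linear_of (Ad_lin t).
pose v (h : R) := (h^-1)%:C *: (adj (P h) (adj (P t) Z) - adj (P t) Z).
apply: (@right_lim_unique _ _ v) => e e0; rewrite /v.
  apply: filterS (generator_bound (adj (P t) Z) e0) => h hh h0.
  have := hh h0; move: (adj (P h) _ - _) (adj L _) => X Y hXY.
  have -> : (h^-1)%:C *: X - Y = (h^-1)%:C *: (X - h%:C *: Y).
    by rewrite scalerBr scalerA -rmorphM mulVf ?gt_eqF // rmorph1 scale1r.
  by rewrite nrmZr gtr0_norm ?invr_gt0 // mulrC ler_pdivrMr.
have k1 : 0 < K + 1 by rewrite ltr_wpDl.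
have ek : 0 < e / (K + 1) by rewrite divr_gt0.
apply: filterS (generator_bound Z ek) => h hh h0.
have -> : adj (P h) (adj (P t) Z) = adj (P t) (adj (P h) Z).
  by rewrite -Ad_addC ?(ltW h0) ?(ltW t0) // Ad_add ?(ltW h0) ?(ltW t0).
rewrite -Ad_B -ZZ -Ad_B; apply: le_trans (hK _ _ tt) _.
have := hh h0; move: (adj (P h) _ - _) (adj L _) => X Y hXY.
have -> : (h^-1)%:C *: X - Y = (h^-1)%:C *: (X - h%:C *: Y).
  by rewrite scalerBr scalerA -rmorphM mulVf ?gt_eqF // rmorph1 scale1r.
rewrite nrmZr gtr0_norm ?invr_gt0 //.
apply: (@le_trans _ _ (K * (e / (K + 1)))).
  by rewrite ler_wpM2l // mulrC ler_pdivrMr.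
by rewrite mulrA ler_pdivrMr // mulrC ler_wpM2l ?(ltW e0) // lerDl.
Qed.

(** The flow is differentiable for positive times only: it is constant on [[h, t]] by the mean value
    bound, and [h] tends to 0. *)
Lemma stationary Z t : adj L Z = 0 -> 0 <= t -> adj (P t) Z = Z.
Proof.
move=> hZ; rewrite le_eqVlt => /orP[/eqP <-|t0]; first exact: Ad0.
apply: (@right_lim_unique _ _ (fun h => adj (P h) Z)) => e e0; last exact: flow_cont0.
apply/nbhs_ballP; exists t => //= h; rewrite /ball /= sub0r normrN => ht h0.
have [A0 _ _ _] := linear_of (Ad_lin 0).
have := @mx_mean R d d (fun s => adj (P s) Z) (fun=> 0) h t 0.
have hh : h <= h <= t by move: ht; rewrite lexx gtr0_norm //= => /ltW.
have ht' : h <= t <= t by case/andP: hh => _ ->; rewrite lexx.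
move=> /(_ _ _ h t hh ht') le0; apply: le_trans (le0 _ _) _.
- move=> s /andP[hs _]; have := mxD_flow Z (lt_le_trans h0 hs).
  by rewrite hZ; have [-> _ _ _] := linear_of (Ad_lin s).
- by move=> s _; rewrite nrm0.
by rewrite mulr0 mulr0 mul0r ltW.
Qed.

End Flow.

(** * Convergence to the invariant state *)

Section Positivity.
Variables (R : realType) (d : nat).
Local Notation C := R[i].
Local Notation M := 'M[C]_d.
Variables (P : R -> {linear M -> M}) (sigma : M).
Hypotheses (hP : quantum_markov_semigroup P) (sp : pd sigma).
Hypothesis hinv : forall t, 0 <= t -> adj (P t) sigma = sigma.

Lemma form_Ad t Z (v : 'rV[C]_d) :
  (v *m adj (P t) Z *m v^t*) 0 0 = hs (P t (v^t* *m v)) Z.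
Proof.
rewrite -Ad_hs /hs ctM trmxCK mxtrace_mulC mulmxA mxtrace_mulC mulmxA.
by rewrite /mxtrace big_ord1.
Qed.

Lemma pd_perturb (A B : M) : pd A -> B^t* = B ->
  exists2 c : R, 0 < c & pd (A + c%:C *: B) /\ pd (A - c%:C *: B).
Proof.
move=> pA hB; have [r [m [b [r0 _ _ hb]]]] := nearby_box 1 sp pA.
have k0 : 0 < nrm B + 1 by rewrite ltr_wpDl ?nrm_ge0.
have c0 : 0 < r / (nrm B + 1) by rewrite divr_gt0.
have cb : nrm ((r / (nrm B + 1))%:C *: B) <= r.
  rewrite nrmZr gtr0_norm // mulrAC ler_pdivrMr // ler_wpM2l ?(ltW r0) //.
  by rewrite lerDl.
exists (r / (nrm B + 1)) => //; case: (pA) => hA _.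
have [|_ p1] := hb (A + (r / (nrm B + 1))%:C *: B).
  by split; [rewrite ctD ctZr hA hB|rewrite addrC addKr].
have [|_ p2] := hb (A - (r / (nrm B + 1))%:C *: B).
  by split; [rewrite ctB ctZr hA hB|rewrite addrC addKr nrmN].
by [].
Qed.

(** Positivity alone could lose rank; but [Z] dominates a small multiple of [sigma], which the flow
    fixes. *)
Lemma Ad_pd t Z : 0 <= t -> pd Z -> pd (adj (P t) Z).
Proof.
move=> t0 pZ; case: (pZ) (sp) => hZ _ [hs0 _]; apply/pdP; split.
  by rewrite -(Ad_ct hP) // hZ.
move=> v v0; have [c c0 [_ pc]] := pd_perturb pZ hs0.
rewrite form_Ad -[Z in hs _ Z](subrK (c%:C *: sigma)) hsDr hsZr -(form_Ad t sigma v) hinv //.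
have h1 := hs_psd_pd (psd_P hP t0 (psd_row v)) pc.
have [_ /(_ v v0) h2] := (pdP sigma).1 sp.
by rewrite ltr_wpDl // mulr_gt0 // (ltcR 0).
Qed.

End Positivity.

(** * Consequences of primitivity and coercivity *)

Section Main.
Variables (R : realType) (d J : nat).
Local Notation C := R[i].
Local Notation M := 'M[C]_d.
Variables (P : R -> {linear M -> M}) (L : M -> M) (sigma : M).
Variables (omega : 'I_J -> R) (V : 'I_J -> M) (q kappa : R).
Hypotheses (hP : quantum_markov_semigroup P) (hL : is_generator P L).
Hypotheses (hprim : primitive P sigma) (hV : alicki_form sigma L omega V).
Hypotheses (q01 : 0 < q <= 1) (kp : 0 < kappa).

Local Notation p := (q + 1).
Local Notation DD := (DD sigma omega V q).
Local Notation Aof := (Aof sigma q).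
Local Notation dAof := (dAof sigma q).

Lemma sigma_pd : pd sigma.
Proof. by case: hprim => _ _ /full_densityP[]. Qed.

Lemma sigma_tr : \tr sigma = 1.
Proof. by case: hprim => _ _ /full_densityP[]. Qed.

Local Notation sp := sigma_pd.

Lemma dim_gt0 : (0 < d)%N.
Proof.
rewrite lt0n; apply/eqP => d0; have := sigma_tr.
rewrite /mxtrace big1 => [/eqP|[i hi] _]; first by rewrite eq_sym oner_eq0.
by exfalso; move: hi; rewrite d0.
Qed.

Lemma sigma_inv t : 0 <= t -> adj (P t) sigma = sigma.
Proof. by case: hprim => -[_ h] _ _; exact: h. Qed.

Lemma flow_full_density t rho : 0 <= t -> full_density rho -> full_density (adj (P t) rho).
Proof.
move=> t0 /full_densityP[pr tr1]; apply/full_densityP.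
by rewrite (tr_Ad hP) //; split=> //; exact: (Ad_pd hP sp sigma_inv).
Qed.

(** Otherwise [sigma + c H], for small [c > 0], would be a second invariant state. *)
Lemma invariant_herm0 (H : M) : H^t* = H -> (forall t, 0 <= t -> adj (P t) H = H) ->
  \tr H = 0 -> H = 0.
Proof.
move=> hH inv t0; have [c c0 [pc _]] := pd_perturb sp sp hH.
case: hprim => _ uniq _; have : sigma + c%:C *: H = sigma.
  apply: uniq; split.
    have : full_density (sigma + c%:C *: H).
      by apply/full_densityP; rewrite mxtraceD mxtraceZ t0 mulr0 addr0 sigma_tr.
    by case.
  move=> t ht; have [_ aD aZ _] := linear_of (Ad_lin P t).
  by rewrite aD aZ inv // sigma_inv.
move=> /(congr1 (fun X => X - sigma)); rewrite addrC addKr subrr => /eqP.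
rewrite scaler_eq0 => /orP[/eqP/(@complexI R _ 0) c1|/eqP//].
by move: c0; rewrite c1 ltxx.
Qed.

Lemma adjL_kernel (X : M) : adj L X = 0 -> \tr X = 0 -> X = 0.
Proof.
move=> hX tX; have inv t : 0 <= t -> adj (P t) X = X by exact: stationary.
have invc t : 0 <= t -> adj (P t) (X^t*) = X^t* by move=> t0; rewrite (Ad_ct hP) // inv.
have tc : \tr (X^t*) = 0 by rewrite tr_ct tX conjc0.
have h1 : X + X^t* = 0.
  apply: invariant_herm0; first by rewrite ctD trmxCK addrC.
    by move=> t t0; have [_ aD _ _] := linear_of (Ad_lin P t); rewrite aD inv // invc.
  by rewrite mxtraceD tX tc addr0.
have h2 : 'i *: X = 0.
  have e : X^t* = - X by apply/eqP; rewrite -addr_eq0 addrC h1.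
  apply: invariant_herm0; first by rewrite ct_i e scaleNr scalerN opprK.
    by move=> t t0; have [_ _ aZ _] := linear_of (Ad_lin P t); rewrite aZ inv.
  by rewrite mxtraceZ tX mulr0.
have := congr1 (fun Y : M => (- 'i) *: Y) h2.
rewrite /= scaler0 scalerA mulNr -expr2 sqr_i opprK scale1r.
exact.
Qed.

(** Such an [A] satisfies [L A = 0], so by [kms] symmetry [Gam sigma 1 A] lies in the kernel of
    [adj L] and is a multiple of [sigma]. This supplies the hypothesis [hker] of the geodesic
    part. *)
Lemma commutant_scalar (A : M) : A^t* = A -> (forall j, comm (V j) A = 0) ->
  exists c : C, A = c%:M.
Proof.
move=> hA cA; set B := Gam sigma 1 A.
have LA : L A = 0.
  case: (hV) => -> _ _ _ _; apply: big1 => j _.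
  have -> : comm A (V j) = 0 by rewrite -[LHS]opprK /comm opprB -/(comm (V j) A) cA oppr0.
  by rewrite cA mulmx0 mul0mx !scaler0 addr0.
have LB : adj L B = 0.
  rewrite -(kms_symmetric sp hV) /B GamD // ?addNr ?Gam0 ?LA; last exact: sp.
  by have [-> _ _ _] := linear_of (Gam_lin sigma 1).
have [_ aD aZ aN] := linear_of (adj_lin L).
have B0 : B - (\tr B) *: sigma = 0.
  apply: adjL_kernel; first by rewrite aD aN aZ LB (adjL_sigma sp hV) scaler0 subr0.
  by rewrite mxtraceD raddfN /= mxtraceZ sigma_tr mulr1 subrr.
exists (\tr B); rewrite -[A](Gam0 sigma) -(addNr 1) -GamD; last exact: sp.
have [_ _ gZ _] := linear_of (Gam_lin sigma (-1)).
move/eqP: B0; rewrite subr_eq0 -/B => /eqP ->.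
by rewrite gZ (Gam_sigma sp) mxtraceZ sigma_tr mulr1 scalemx1.
Qed.

Lemma dissipation_ge0 rho : pd rho -> 0 <= - ip (Aof rho) (adj L rho).
Proof.
move=> pr; rewrite -ipNr -(gradient_identity q01 sp hV pr) ipC.
by case: (DD_pos omega V q01 sp (Aof rho) pr).
Qed.

(* Expanding the square of [A + s l] for the form [DD rho], where [DD rho A = - l]. *)
Lemma adjL_le_dissipation : exists2 K : R, 0 <= K & forall rho, full_density rho ->
  nrm (adj L rho) ^+ 2 <= K * - ip (Aof rho) (adj L rho).
Proof.
have [K K0 hK] := DD_upper omega V q01 sp.
(* Chosen so that [<D l, l> <= k <l, l>]; then [s = 1 / k] in the expanded square leaves
   [<l, l> <= - k <A, l>]. *)
pose k : R := K * (2 * d%:R ^+ 4) + 1.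
have D0 : 0 <= 2 * d%:R ^+ 4 :> R by rewrite mulr_ge0 // exprn_ge0.
have k0 : 0 < k by rewrite ltr_wpDl // mulr_ge0.
exists (2 * d%:R ^+ 4 * k); first by rewrite mulr_ge0 // ltW.
move=> rho fr; have [pr _] := (full_densityP rho).1 fr.
have gi := gradient_identity q01 sp hV pr.
set l := adj L rho in gi *; set A := Aof rho in gi *.
have hl := hK rho l fr; have nl := nrm_sqr_ip l.
have := (DD_pos omega V q01 sp (A + (k^-1)%:C *: l) pr).1.
have [_ dD dZ _] := linear_of (DDZ sigma omega V q rho).
rewrite dD dZ gi ipDl !ipDr !ipNl !ipZl !ipZr (ip_DD_sym sigma omega V q rho l A) gi ipNr.
rewrite (ipC l A) -/l.
have I0 := ip_ge0 l.
have kV : 0 < k^-1 by rewrite invr_gt0.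
have kk : k * k^-1 = 1 by rewrite mulfV // gt_eqF.
move: nl hl I0; move: (ip A l) (ip l l) (ip (DD rho l) l) (nrm l ^+ 2) => a I x n nl hl I0 h.
have h1 : x <= k * I.
  apply: (le_trans hl); rewrite /k mulrDl mul1r -mulrA; apply: ler_wpDr => //.
  by rewrite ler_wpM2l.
have h2 : k^-1 * (k^-1 * x) <= k^-1 * I.
  by rewrite ler_wpM2l ?(ltW kV) // mulrC ler_pdivrMr // mulrC.
have h3 : I <= k * - a.
  rewrite -ler_pdivrMl //; move: h h2; rewrite mulrN; move: (k^-1 * I) => y; lra.
by apply: (le_trans nl); rewrite -(mulrA _ k) ler_wpM2l.
Qed.

(** As for [DD], adding the trace times the identity makes [adj L] invertible; on [rho - sigma] the
    added term vanishes, and so does [adj L sigma]. *)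
Lemma adjL_coercive : exists2 K : R, 0 <= K & forall rho, \tr rho = 1 ->
  nrm (rho - sigma) <= K * nrm (adj L rho).
Proof.
pose g (X : M) : M := adj L X + (\tr X)%:M.
have gl : lin g.
  move=> c X Y; rewrite /g (adj_lin L c X Y) mxtraceD mxtraceZ raddfD /= scalerDr.
  by rewrite addrACA scale_scalar_mx.
have trg X : \tr (g X) = \tr X * d%:R.
  by rewrite /g mxtraceD (tr_adjL hV) add0r mxtrace_scalar mulr_natr.
have dC : (d%:R : C) != 0 by rewrite pnatr_eq0 -lt0n dim_gt0.
have gi X : g X = 0 -> X = 0.
  move=> e; have := trg X; rewrite e mxtrace0 => /esym/eqP.
  rewrite mulf_eq0 (negPf dC) orbF => /eqP t0.
  by apply: adjL_kernel => //; move: e; rewrite /g t0 raddf0 addr0.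
have [G [Gl gK _]] := lin_inverse gl gi; have [K K0 hK] := linear_bounded Gl.
exists K => // rho tr1; rewrite -[X in nrm X <= _]gK; apply: le_trans (hK _) _.
rewrite /g mxtraceD raddfN /= tr1 sigma_tr subrr raddf0 addr0.
by rewrite (linB (adj_lin L)) (adjL_sigma sp hV) subr0.
Qed.

Lemma ip_Aof_lip (T : M -> M) rho0 : lin T -> pd rho0 -> exists r K : R, [/\ 0 < r, 0 <= K &
  forall rho, nearby rho0 r rho ->
    `|ip (Aof rho) (T rho) - ip (Aof rho0) (T rho0)| <= K * nrm (rho - rho0)].
Proof.
move=> lT p0; have [r [Ka [r0 Ka0 hA _]]] := Aof_diff q01 sp p0.
have [KT KT0 hT] := linear_bounded lT.
have n0 : nearby rho0 r rho0 by split; [case: p0|rewrite subrr nrm0 ltW].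
have m0 : 0 <= nrm rho0 + r by rewrite addr_ge0 ?nrm_ge0 // ltW.
exists r, (Ka * (KT * (nrm rho0 + r)) + nrm (Aof rho0) * KT); split=> //.
  by rewrite addr_ge0 // !mulr_ge0 // nrm_ge0.
move=> rho hr; have h1 := hA _ _ n0 hr; have [_ h2] := hr.
have -> : ip (Aof rho) (T rho) - ip (Aof rho0) (T rho0) =
    ip (Aof rho - Aof rho0) (T rho) + ip (Aof rho0) (T (rho - rho0)).
  by rewrite (linB lT) ipBl ipBr subrKA.
apply: le_trans (ler_normD _ _) _; rewrite mulrDl; apply: lerD.
  apply: le_trans (ip_le _ _) _; rewrite mulrAC ler_pM ?nrm_ge0 //.
  apply: le_trans (hT _) _; rewrite ler_wpM2l // -[rho in nrm rho](subrK rho0) addrC.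
  by apply: le_trans (nrmD _ _) _; rewrite lerD2l.
apply: le_trans (ip_le _ _) _; rewrite -mulrA ler_wpM2l ?nrm_ge0 //.
Qed.

Lemma Fp_lip rho0 : pd rho0 -> exists r K : R, [/\ 0 < r, 0 <= K &
  forall rho, nearby rho0 r rho ->
    `|Fp sigma p rho - Fp sigma p rho0| <= K * nrm (rho - rho0)].
Proof.
move=> p0; have [r1 [K [r10 K0 h1]]] := ip_Aof_lip (T := id) (fun _ _ _ => erefl) p0.
have [r2 [m [b [r20 _ _ hb]]]] := nearby_box q sp p0.
have k0 : 0 <= (p * q)^-1 * q.
  by rewrite mulr_ge0 ?invr_ge0 ?mulr_ge0 // ltW ?(p_gt0 q01) ?(q_gt0 q01).
exists (Num.min r1 r2), ((p * q)^-1 * q * K); split; [by rewrite lt_min r10|by rewrite mulr_ge0|].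
move=> rho [hr]; rewrite le_min => /andP[l1 l2].
have [_ pr] := hb rho (conj hr l2); have := h1 rho (conj hr l1) => hh.
rewrite !(FpE q01 sp) // (_ : _ - _ = (p * q)^-1 * q * (ip (Aof rho) rho - ip (Aof rho0) rho0)).
  by rewrite normrM (ger0_norm k0) -[leRHS]mulrA ler_wpM2l.
rewrite (ipC rho) (ipC rho0); move: ((p * q)^-1) (ip _ _) (ip _ _) => x y z; ring.
Qed.

Hypothesis hRic : Ric_ge sigma omega V p kappa.

(** * Decay of the functional along a trajectory *)

Section Trajectory.
Variable rho : M.
Hypothesis fr : full_density rho.

Let u (t : R) : M := adj (P t) rho.
Let phi (t : R) : R := ip (Aof (u t)) (adj L (u t)).
Let f (t : R) : R := Fp sigma p (u t).

Lemma u_full (t : R) : 0 <= t -> full_density (u t).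
Proof. by move=> t0; exact: flow_full_density. Qed.

Lemma u_pd (t : R) : 0 <= t -> pd (u t).
Proof. by move=> /u_full/full_densityP[]. Qed.

Lemma mxD_u (t : R) : 0 < t -> mxD u t (adj L (u t)).
Proof. by move=> t0; rewrite /u (adjL_Ad hP hL) //; exact: mxD_flow. Qed.

Lemma u_pd_near (t : R) : 0 < t -> \forall h \near (0 : R), pd (u (t + h)).
Proof.
move=> t0; have t20 : 0 < t / 2 by rewrite divr_gt0.
apply: filterS (near0_small (ler01 : 0 <= (1 : R)) t20) => h; rewrite mul1r => hh.
by apply: u_pd; move: hh; rewrite ler_norml => /andP[]; lra.
Qed.

Lemma f_derive (t : R) : 0 < t -> is_derive t 1 f (phi t).
Proof. by move=> t0; exact: (Fp_derive q01 sp (mxD_u t0) (u_pd_near t0)). Qed.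

Lemma phi_derive (t : R) : 0 < t -> is_derive t 1 phi
  (ip (dAof (u t) (adj L (u t))) (adj L (u t)) + ip (Aof (u t)) (adj L (adj L (u t)))).
Proof.
move=> t0; have [K K0 hK] := linear_bounded (adj_lin L).
have [_ aD aZ _] := linear_of (adj_lin L).
have h2 : mxD (fun s => adj L (u s)) t (adj L (adj L (u t))).
  by apply: (mxD_linear aD _ K0 hK (mxD_u t0)) => c X; rewrite aZ.
exact: (Fp_derive2 q01 sp (D := fun s => adj L (u s)) (mxD_u t0) h2 (u_pd_near t0)).
Qed.

Lemma phi_le0 (t : R) : 0 <= t -> phi t <= 0.
Proof. by move=> /u_pd/dissipation_ge0; rewrite oppr_ge0. Qed.

Lemma phi_f_mono (a b : R) : 0 < a -> a <= b -> phi a + 2 * kappa * f a <= phi b + 2 * kappa * f b.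
Proof.
move=> a0 ab.
pose dphi t := ip (dAof (u t) (adj L (u t))) (adj L (u t)) + ip (Aof (u t)) (adj L (adj L (u t))).
have hd (s : R) : a <= s <= b ->
    is_derive s 1 (fun t => phi t + 2 * kappa * f t) (dphi s + 2 * kappa * phi s).
  move=> /andP[as_ _]; have s0 := lt_le_trans a0 as_.
  have h1 := phi_derive s0; have h2 := is_derive_affine (2 * kappa) 1 0 (f_derive s0).
  have := is_deriveD h1 h2.
  rewrite mulr1; congr (is_derive _ _ _ _).
  by apply/funext => t; rewrite -[LHS]/(phi t + 2 * kappa * (1 * f t - 0)) mul1r subr0.
have [c /andP[ac _] e] := mean_value ab hd.
have c0 : 0 <= c by rewrite ltW // (lt_le_trans a0).
have hr := ricci_second_derivative dim_gt0 q01 sp hV commutant_scalar hRic (u_full c0).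
rewrite -subr_ge0 e mulr_ge0 ?subr_ge0 // /dphi /phi.
by move: hr; rewrite -subr_ge0 opprK.
Qed.

(** From time [T] on, [f] can drop by at most [f T + m]; over a time [N] longer than this drop
    divided by [e], the mean value theorem finds a slope of size at most [e]. *)
Lemma dissipation_small (T e : R) : 0 < T -> 0 < e -> exists2 t : R, T <= t & - phi t <= e.
Proof.
move=> T0 e0; have fT := Fp_lower q01 sp (u_pd (ltW T0)).
pose m := (p * q)^-1; have m0 : 0 <= f T + m by rewrite -[m]opprK subr_ge0.
pose N := (f T + m + 1) / e; have N0 : 0 < N by rewrite divr_gt0 // ltr_wpDl.
have [||t /andP[Tt tb] h] := @mean_value R f phi T (T + N).
- by rewrite lerDl ltW.
- by move=> s /andP[Ts _]; apply: f_derive; exact: lt_le_trans Ts.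
exists t => //; have tN0 : 0 <= T + N by rewrite addr_ge0 ?ltW.
have := Fp_lower q01 sp (u_pd tN0); rewrite -/(f _) -/m => hb.
have e1 : - phi t * N = f T - f (T + N).
  by rewrite mulNr -opprB h [T + N]addrC addrK.
have e2 : e * N = f T + m + 1 by rewrite /N mulrC divfK // gt_eqF.
rewrite -(ler_pM2r N0) e1 e2; apply: (@le_trans _ _ (f T + m)); last by rewrite lerDl.
by rewrite lerD2l lerNl.
Qed.

Lemma f_small (T e : R) : 0 < T -> 0 < e -> exists2 t : R, T <= t & f t <= e.
Proof.
move=> T0 e0; have [r [K [r0 K0 hf]]] := Fp_lip sp.
have [K1 K10 h1] := adjL_le_dissipation; have [K2 K20 h2] := adjL_coercive.
have k1 : 0 < K + 1 by rewrite ltr_wpDl.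
pose dl := Num.min r (e / (K + 1)).
have dl0 : 0 < dl by rewrite lt_min r0 divr_gt0.
have k2 : 0 < K2 ^+ 2 * K1 + 1 by rewrite ltr_wpDl // mulr_ge0 // exprn_ge0.
(* Coercivity and the dissipation bound give that the squared distance to [sigma] is at most
   [K2 ^+ 2 * K1] times [- phi], so this threshold brings the distance below [dl]. *)
have [||t Tt ht] := @dissipation_small T (dl ^+ 2 / (K2 ^+ 2 * K1 + 1)) => //.
  by rewrite divr_gt0 // exprn_gt0.
exists t => //; have t0 : 0 <= t by rewrite ltW // (lt_le_trans T0).
have fu := u_full t0; have [pu tu] := (full_densityP _).1 fu.
have n0 := nrm_ge0 (u t - sigma).
have hn : nrm (u t - sigma) <= dl.
  rewrite -(ler_pXn2r (n := 2)) ?nnegrE ?(ltW dl0) //.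
  apply: (@le_trans _ _ (K2 ^+ 2 * (K1 * - phi t))).
    apply: (@le_trans _ _ ((K2 * nrm (adj L (u t))) ^+ 2)).
      by rewrite ler_pXn2r ?nnegrE ?mulr_ge0 ?nrm_ge0 //; exact: h2.
    by rewrite exprMn ler_wpM2l ?exprn_ge0 //; exact: h1.
  rewrite mulrA; apply: (@le_trans _ _ ((K2 ^+ 2 * K1 + 1) * - phi t)).
    by rewrite ler_wpM2r ?oppr_ge0 ?phi_le0 // lerDl.
  by rewrite mulrC -ler_pdivlMr.
move: hn; rewrite le_min => /andP[hr he].
have hu : (u t)^t* = u t by case: pu.
have := hf _ (conj hu hr); rewrite (Fp_sigma q01 sp sigma_tr) subr0 => hh.
apply: le_trans (ler_norm _) _; apply: le_trans hh _.
apply: (@le_trans _ _ (K * (e / (K + 1)))); first by rewrite ler_wpM2l.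
by rewrite mulrA ler_pdivrMr // mulrC ler_wpM2l ?(ltW e0) // lerDl.
Qed.

Lemma phi_f_le0 (t : R) : 0 < t -> phi t + 2 * kappa * f t <= 0.
Proof.
move=> t0; apply/ler_addgt0Pr => e e0; rewrite add0r.
have k0 : 0 < 2 * kappa by rewrite mulr_gt0.
have [s ts fs] := f_small t0 (divr_gt0 e0 k0).
apply: le_trans (phi_f_mono t0 ts) _.
have s0 : 0 <= s by rewrite ltW // (lt_le_trans t0).
have := phi_le0 s0; move: fs; rewrite ler_pdivlMr // mulrC.
by move: (phi s) (2 * kappa * f s) => x y; lra.
Qed.

(** The differential argument covers positive times only; time 0 is reached by continuity of both
    terms at [rho] and of the flow at 0. *)
Lemma functional_inequality : ip (Aof rho) (adj L rho) + 2 * kappa * Fp sigma p rho <= 0.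
Proof.
have [pr _] := (full_densityP rho).1 fr.
have [r1 [K1 [r10 K10 h1]]] := ip_Aof_lip (adj_lin L) pr.
have [r2 [K2 [r20 K20 h2]]] := Fp_lip pr.
apply/ler_addgt0Pr => e e0; rewrite add0r.
have k0 : 0 <= 2 * kappa by rewrite mulr_ge0 // ltW.
have k1 : 0 < K1 + 2 * kappa * K2 + 1 by rewrite ltr_wpDl // addr_ge0 // mulr_ge0.
pose dl := Num.min (Num.min r1 r2) (e / (K1 + 2 * kappa * K2 + 1)).
have dl0 : 0 < dl by rewrite !lt_min r10 r20 divr_gt0.
have /nbhs_ballP[r /= r0 hr] := flow_cont0 hL rho dl0.
have r20' : 0 < r / 2 by rewrite divr_gt0.
have hb : ball (0 : R) r (r / 2) by rewrite /ball /= sub0r normrN gtr0_norm //; lra.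
have := hr _ hb r20'; rewrite -/(u _) => hn.
move: (hn); rewrite !le_min => /andP[/andP[n1_ n2_] n3_].
have hu : (u (r / 2))^t* = u (r / 2) by case: (u_pd (ltW r20')).
have g1 := h1 _ (conj hu n1_); have g2 := h2 _ (conj hu n2_).
have := phi_f_le0 r20'; rewrite /phi /f.
move: g1 g2 n3_ (nrm_ge0 (u (r / 2) - rho)).
rewrite !ler_norml ler_pdivlMr //.
move: (ip _ _) (ip _ _) (Fp _ _ _) (Fp _ _ _) (nrm _) => x0 x y0 y n.
move=> /andP[a1 _] /andP[a2 _] a3 n0 a4.
have b1 : 2 * kappa * (- (K2 * n)) <= 2 * kappa * (y - y0) by rewrite ler_wpM2l.
have b2 : n * (K1 + 2 * kappa * K2) <= e by apply: le_trans a3; rewrite ler_wpM2l // lerDl.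
move: b1 b2 a4; rewrite mulrBr mulrN mulrDr !(mulrA _ _ n) [n * K1]mulrC [n * (_ * K2)]mulrC.
move: (2 * kappa * y) (2 * kappa * y0) (K1 * n) (2 * kappa * K2 * n) a1 => *; lra.
Qed.

End Trajectory.

Lemma beckner_inequality rho : full_density rho ->
  kappa / 2 * Fp sigma p rho <= p ^- 2 * Ep sigma L p (Gam sigma (-1) rho).
Proof.
move=> fr; rewrite (Ep_gradient q01 sp hV); have := functional_inequality fr.
move: (ip _ _) (Fp _ _ _) => x y; lra.
Qed.

End Main.

Theorem corollary4p18 (R : realType) (d J : nat)
    (P : R -> {linear 'M[R[i]]_d -> 'M[R[i]]_d})
    (L : 'M[R[i]]_d -> 'M[R[i]]_d)
    (sigma : 'M[R[i]]_d)
    (omega : 'I_J -> R) (V : 'I_J -> 'M[R[i]]_d)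
    (p kappa : R)
    (hP : quantum_markov_semigroup P)
    (hL : is_generator P L)
    (hprim : primitive P sigma)
    (hdb : gns_detailed_balance sigma L)
    (hV : alicki_form sigma L omega V)
    (hp : 1 < p <= 2)
    (hkappa : 0 < kappa)
    (hRic : Ric_ge sigma omega V p kappa) :
  exists2 alpha : R, kappa / 2 <= alpha &
    forall rho : 'M[R[i]]_d, full_density rho ->
      alpha * Fp sigma p rho <= p ^- 2 * Ep sigma L p (Gam sigma (-1) rho).
Proof.
have [q q01 ep] : exists2 q : R, 0 < q <= 1 & p = q + 1.
  exists (p - 1); last by rewrite subrK.
  by case/andP: hp => h1 h2; apply/andP; split; lra.
rewrite ep in hRic *; exists (kappa / 2) => // rho.
exact: (beckner_inequality hP hL hprim hV q01 hkappa hRic).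
Qed.
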